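(* Let $n\ge3$, $T>0$ and $0<\mu<1/2$. Let $h^{\alpha\beta}\in C^1([0,T]\times\mathbb{R}^n)$ ($\alpha,\beta=0,1,\dots,n$) be uniformly bounded together with their first derivatives and satisfy $$\sum_{\alpha,\beta=0}^n|h^{\alpha\beta}(t,x)|\le\tfrac12,\qquad h^{\alpha\beta}(t,x)=h^{\beta\alpha}(t,x)\qquad\text{for all }(t,x)\in[0,T]\times\mathbb{R}^n .$$ Let $f\in H^1(\mathbb{R}^n)$, $g\in L^2(\mathbb{R}^n)$, and let $\phi\in C^2([0,T]\times\mathbb{R}^n)$ be a real-valued solution of $$\partial_t^2\phi-\Delta\phi+\sum_{\alpha,\beta=0}^n h^{\alpha\beta}(t,x)\partial_\alpha\partial_\beta\phi=F(t,x)\ \text{ in }(0,T)\times\mathbb{R}^n,\qquad\phi(0,\cdot)=f,\ \ \partial_t\phi(0,\cdot)=g .$$ Suppose also that $\phi\in C^0([0,T];H^1(\mathbb{R}^n))\cap C^1([0,T];L^2(\mathbb{R}^n))$ and $$|\partial\phi||F|+\frac{|\phi||F|}{r^{1-2\mu}\langle r\rangle^{2\mu}}\in L^1((0,T)\times\mathbb{R}^n).$$ Then $$\begin{aligned} &(1+T)^{-2\mu}\Big(\|r^{-3/2+\mu}\phi\|^2_{L^2((0,T)\times\mathbb{R}^n)}+\|r^{-1/2+\mu}\partial\phi\|^2_{L^2((0,T)\times\mathbb{R}^n)}\Big)\\ &\quad+(\log(2+T))^{-1}\Big(\|r^{-3/2+\mu}\langle r\rangle^{-\mu}\phi\|^2_{L^2((0,T)\times\mathbb{R}^n)}+\|r^{-1/2+\mu}\langle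 r\rangle^{-\mu}\partial\phi\|^2_{L^2((0,T)\times\mathbb{R}^n)}\Big)\\ &\le C_1\big(\|\nabla f\|^2_{L^2(\mathbb{R}^n)}+\|g\|^2_{L^2(\mathbb{R}^n)}\big)\\ &\quad+C_1\int_0^T\!\!\int_{\mathbb{R}^n}\Big(|\partial\phi||F|+\frac{|\phi||F|}{r^{1-2\mu}\langle r\rangle^{2\mu}}+|\partial h||\partial\phi|^2+\frac{|\partial h||\phi\,\partial\phi|}{r^{1-2\mu}\langle r\rangle^{2\mu}}+\frac{|h||\partial\phi|^2}{r^{1-2\mu}\langle r\rangle^{2\mu}}+\frac{|h||\phi\,\partial\phi|}{r^{2-2\mu}\langle r\rangle^{2\mu}}\Big)\,dx\,dt, \end{aligned}$$ where $C_1$ is a positive constant depending only on $n$ and $\mu$.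
   Context: $x^0=t$, $\partial_0=\partial_t$, $\partial_a=\partial/\partial x^a$ for $a=1,\dots,n$; $\partial\phi=(\partial_t\phi,\nabla\phi)$; $r=|x|$, $\langle r\rangle=\sqrt{1+r^2}$. $|\cdot|$ denotes the Euclidean norm of the vector of all components; in particular $|h|$ and $|\partial h|$ are the Euclidean norms of the arrays $(h^{\alpha\beta})_{\alpha,\beta}$ and $(\partial_\gamma h^{\alpha\beta})_{\alpha,\beta,\gamma}$. *)

(* Defs.v *)
From HB Require Import structures.
From mathcomp Require Import all_boot all_order all_algebra.
From mathcomp Require Import all_classical all_reals all_analysis.
Import numFieldNormedType.Exports.

Set Implicit Arguments.
Unset Strict Implicit.
Unset Printing Implicit Defensive.

Import Order.TTheory GRing.Theory Num.Theory.
Local Open Scope classical_set_scope.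
Local Open Scope ring_scope.

(* R^n is 'rV[R]_n: its library norm `|x| is the sup norm (same topology), so
   the Euclidean length is always written explicitly.  Its sigma-algebra is the
   product one, generated by the coordinates, i.e. the Borel sigma-algebra. *)

Section measurable_rV.
Context {R : realType}.
Variable n : nat.

Let coord (i : 'I_n) (x : 'rV[R]_n) : R := x 0 i.

Let rV_set0 : g_sigma_preimage coord set0.
Proof. exact: sigma_algebra0. Qed.

Let rV_setC A : g_sigma_preimage coord A -> g_sigma_preimage coord (~` A).
Proof. exact: sigma_algebraC. Qed.

Let rV_bigcup (F : _^nat) : (forall i, g_sigma_preimage coord (F i)) ->
  g_sigma_preimage coord (\bigcup_i (F i)).
Proof. exact: sigma_algebra_bigcup. Qed.

HB.instance Definition _ := @isMeasurable.Build default_measure_display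
  'rV[R]_n (g_sigma_preimage coord) rV_set0 rV_setC rV_bigcup.

Lemma measurable_coord (i : 'I_n) :
  measurable_fun [set: 'rV[R]_n] (fun x : 'rV[R]_n => x 0 i).
Proof.
move=> _ Y mY; rewrite setTI; apply: sub_sigma_algebra => /=.
rewrite -bigcup_seq/=; exists i => /=; first by rewrite mem_index_enum.
by exists Y => //; rewrite setTI.
Qed.

Lemma measurable_fun_rVP d (T : measurableType d) (f : T -> 'rV[R]_n) :
  measurable_fun [set: T] f <->
  forall i, measurable_fun [set: T] (fun t => f t 0 i).
Proof.
split=> [mf i|mf].
  exact: (measurableT_comp (measurable_coord i) mf).
have sub : g_sigma_preimage coord `<=` [set A | measurable (f @^-1` A)].
  apply: smallest_sub.
    split=> /=.
    - by rewrite preimage_set0.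
    - by move=> A mA; rewrite setTD preimage_setC; exact: measurableC.
    - by move=> F mF; rewrite preimage_bigcup; exact: bigcup_measurable.
  rewrite -bigcup_seq => A [i _] [B mB <-] /=; rewrite setTI.
  by have := mf i measurableT B mB; rewrite setTI.
by move=> _ A mA; rewrite setTI; exact: sub.
Qed.

End measurable_rV.

Section lebesgue_rV.
Context {R : realType}.
Let R1 : measurableType _ := measurableTypeR R.

Definition consrV n (p : R1 * 'rV[R]_n) : 'rV[R]_n.+1 :=
  \row_i (if unlift ord0 i is Some j then p.2 0 j else p.1).

Definition unconsrV n (v : 'rV[R]_n.+1) : R1 * 'rV[R]_n :=
  (v 0 ord0, \row_j v 0 (lift ord0 j)).

Lemma consrVK n : cancel (@consrV n) (@unconsrV n).
Proof.
move=> [t x]; rewrite /unconsrV mxE unlift_none; congr pair.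
by apply/rowP => j; rewrite !mxE liftK.
Qed.

Lemma measurable_consrV n : measurable_fun [set: R1 * 'rV[R]_n] (@consrV n).
Proof.
apply/measurable_fun_rVP => i.
case: (unliftP ord0 i) => [j|] ->.
  under eq_fun do rewrite mxE liftK.
  exact: (measurableT_comp (measurable_coord j) measurable_snd).
under eq_fun do rewrite mxE unlift_none.
exact: measurable_fst.
Qed.

Lemma measurable_unconsrV n : measurable_fun [set: 'rV[R]_n.+1] (@unconsrV n).
Proof.
apply/measurable_fun_pairP; split; first exact: measurable_coord.
apply/measurable_fun_rVP => j /=.
under eq_fun do rewrite mxE.
exact: measurable_coord.
Qed.

Section lebesgue_cons.
Variables (n : nat) (m : {sigma_finite_measure set 'rV[R]_n -> \bar R}).
Local Open Scope ereal_scope.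

Let mu : set 'rV[R]_n.+1 -> \bar R :=
  pushforward (@lebesgue_measure R \x m) (@consrV n).

Let mcons A : measurable A -> measurable (@consrV n @^-1` A).
Proof.
by move=> mA; rewrite -[X in measurable X]setTI; exact: measurable_consrV.
Qed.

Let mu0 : mu set0 = 0.
Proof. by rewrite /mu /pushforward preimage_set0 measure0. Qed.

Let mu_ge0 A : 0 <= mu A.
Proof. by rewrite /mu /pushforward; apply: measure_ge0. Qed.

Let mu_sigma_additive : semi_sigma_additive mu.
Proof.
move=> F mF tF mUF; rewrite /mu /pushforward preimage_bigcup.
apply: measure_semi_sigma_additive.
- by move=> k; exact: mcons.
- apply/trivIsetP => /= i j _ _ ij; rewrite -preimage_setI.
  by move/trivIsetP : tF => /(_ _ _ _ _ ij) ->//; rewrite preimage_set0.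
- by rewrite -preimage_bigcup; exact: mcons.
Qed.

HB.instance Definition _ :=
  isMeasure.Build _ _ _ mu mu0 mu_ge0 mu_sigma_additive.

Let mu_sigma_finite : sigma_finite setT mu.
Proof.
have /sigma_finiteP[F [TF ndF Foo]] := sigma_finiteT (@lebesgue_measure R).
have /sigma_finiteP[G [TG ndG Goo]] := sigma_finiteT m.
have TFG : setT = \bigcup_k (F k `*` G k).
  rewrite -setXTT TF TG predeqE => -[x y]; split; last first.
    by move=> [k _ []/= ? ?]; split; exists k.
  move=> [/= [k _ Fkx] [l _ Gly]]; exists (maxn k l) => //; split.
  - by move: x Fkx; exact/subsetPset/ndF/leq_maxl.
  - by move: y Gly; exact/subsetPset/ndG/leq_maxr.
exists (fun k => @unconsrV n @^-1` (F k `*` G k)).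
  by rewrite -preimage_bigcup -TFG preimage_setT.
move=> k; have [mF Fk] := Foo k; have [mG Gk] := Goo k; split.
  rewrite -[X in measurable X]setTI; apply: measurable_unconsrV => //.
  exact: measurableX.
rewrite /mu /pushforward -comp_preimage.
rewrite (_ : _ \o _ = id); last by apply/funext; exact: consrVK.
by rewrite preimage_id product_measure1E// lte_mul_pinfty// ge0_fin_numE.
Qed.

HB.instance Definition _ := Measure_isSigmaFinite.Build _ _ _ mu mu_sigma_finite.

Definition lebesgue_cons : {sigma_finite_measure set 'rV[R]_n.+1 -> \bar R} :=
  mu.

End lebesgue_cons.

Fixpoint lebesgue_rV n : {sigma_finite_measure set 'rV[R]_n -> \bar R} :=
  if n is n'.+1 then lebesgue_cons (lebesgue_rV n') else \d_(0 : 'rV[R]_0).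

Lemma lebesgue_rV_box n (A : 'I_n -> set R) :
  (forall i, measurable (A i)) ->
  lebesgue_rV n [set x | forall i, A i (x 0 i)] =
  (\prod_(i < n) @lebesgue_measure R (A i))%E.
Proof.
elim: n A => [|n ih] A mA.
  by rewrite big_ord0 /= diracE mem_set//= => -[].
have mbox : measurable [set x : 'rV[R]_n | forall i, A (lift ord0 i) (x 0 i)].
  rewrite (_ : [set x | _] = \bigcap_(i in [set: 'I_n])
      ((fun x : 'rV[R]_n => x 0 i) @^-1` A (lift ord0 i))).
    apply: fin_bigcap_measurable => // i _.
    by rewrite -[X in measurable X]setTI; exact: measurable_coord.
  by apply/seteqP; split=> x /= Ax i; [move=> _; exact: Ax|exact: Ax].
rewrite big_ord_recl -ih; last by move=> i; exact: mA.
rewrite -product_measure1E//=.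
rewrite /lebesgue_cons /= /pushforward; congr (_ _).
apply/seteqP; split=> [[t x] /= Ax|[t x] /= [At Ax] i].
  split; first by have := Ax ord0; rewrite mxE unlift_none.
  by move=> i; have := Ax (lift ord0 i); rewrite mxE liftK.
by case: (unliftP ord0 i) => [j|] ->; rewrite mxE ?liftK ?unlift_none.
exact: mA.
Qed.
End lebesgue_rV.

Definition lebesgue_tx {R : realType} (n : nat) :
    {measure set (measurableTypeR R * 'rV[R]_n)%type -> \bar R} :=
  (@lebesgue_measure R \x lebesgue_rV n)%E.

Section norms.
Context {R : realType}.

Definition eucl (I : finType) (v : I -> R) : R :=
  Num.sqrt (\sum_i v i ^+ 2).

Definition xnorm n (x : 'rV[R]_n) : R := eucl (fun i => x 0 i).

Definition xbracket n (x : 'rV[R]_n) : R := Num.sqrt (1 + xnorm x ^+ 2).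

End norms.

Section differentiation_within.
Context {R : realType} {V : normedModType R}.
Implicit Types (D : set V) (u : V -> R) (v z : V).

(* Directional derivatives along increments that stay in D; they are one-sided
   at the two faces t = 0 and t = T of the slab [0, T] x R^n. *)
Definition derivable_in D u z v : Prop :=
  cvg (h^-1 *: (u (h *: v + z) - u z)
       @[h --> within [set h : R | D (h *: v + z)] 0^']).

Definition derive_in D v u z : R :=
  lim (h^-1 *: (u (h *: v + z) - u z)
       @[h --> within [set h : R | D (h *: v + z)] 0^']).

Fixpoint Ck (I : finType) (e : I -> V) D (k : nat) u : Prop :=
  {within D, continuous u} /\
  if k is k'.+1 then
    forall i, (forall z, D z -> derivable_in D u z (e i)) /\
              Ck e D k' (derive_in D (e i) u)
  else True.

Let within_setT (F : set_system R) : within setT F = F.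
Proof.
apply/funext => P; rewrite /within /=; congr (F _).
by apply/funext => h; rewrite propeqE; split=> // /(_ I).
Qed.

Lemma derivable_inT u z v : derivable_in setT u z v = derivable u z v.
Proof. by rewrite /derivable_in within_setT. Qed.

Lemma derive_inT u z v : derive_in setT v u z = 'D_v u z.
Proof. by rewrite /derive_in within_setT. Qed.

End differentiation_within.

Section sobolev.
Context {R : realType} (n : nat).
Implicit Types (u w f psi : 'rV[R]_n -> R).

Definition ebase (a : 'I_n) : 'rV[R]_n := delta_mx 0 a.

Definition test_function psi : Prop :=
  (forall k, Ck ebase setT k psi) /\ compact (closure [set x | psi x != 0]).

Definition L2 u : Prop := u \in Lfun (lebesgue_rV n) 2%:E.

Definition L2norm u : \bar R := 'N[lebesgue_rV n]_2%:E [EFin \o u].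

Definition weak_partial (a : 'I_n) f w : Prop :=
  forall psi, test_function psi ->
    \int[lebesgue_rV n]_x (f x * 'D_(ebase a) psi x) =
    - \int[lebesgue_rV n]_x (w x * psi x).

Definition H1 f : Prop :=
  L2 f /\ forall a, exists2 w, L2 w & weak_partial a f w.

(* For f in H^1 this is a representative of the a.e. class of weak derivatives;
   only its integrals are used. *)
Definition wpartial (a : 'I_n) f : 'rV[R]_n -> R :=
  xget (cst 0) [set w | L2 w /\ weak_partial a f w].

Definition wgrad_norm f (x : 'rV[R]_n) : R := eucl (fun a => wpartial a f x).

Definition H1norm f : \bar R :=
  sqrte (L2norm f ^+ 2 + L2norm (wgrad_norm f) ^+ 2)%E.

Definition C0H1 (T : R) (U : R -> 'rV[R]_n -> R) : Prop :=
  (forall t, t \in `[0, T] -> H1 (U t)) /\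
  forall t, t \in `[0, T] ->
    H1norm (U s \- U t) @[s --> within `[0, T] (nbhs t)] --> 0%E.

Definition C0L2 (T : R) (U : R -> 'rV[R]_n -> R) : Prop :=
  (forall t, t \in `[0, T] -> L2 (U t)) /\
  forall t, t \in `[0, T] ->
    L2norm (U s \- U t) @[s --> within `[0, T] (nbhs t)] --> 0%E.

Definition C1L2 (T : R) (U : R -> 'rV[R]_n -> R) : Prop :=
  C0L2 T U /\ exists2 U', C0L2 T U' &
  forall t, t \in `[0, T] ->
    L2norm (fun x => h^-1 * (U (t + h) x - U t x) - U' t x)
      @[h --> within [set h | t + h \in `[0, T]] 0^'] --> 0%E.

End sobolev.

Section spacetime.
Context {R : realType} (n : nat).
Implicit Types (T : R) (u : R * 'rV[R]_n -> R).

Definition slab T : set (R * 'rV[R]_n) := [set z | 0 <= z.1 <= T].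

Definition oslab T : set (R * 'rV[R]_n) := [set z | 0 < z.1 < T].

(* The index ord0 is the time direction, lift ord0 a the a-th space one. *)
Definition tx_base (al : 'I_n.+1) : R * 'rV[R]_n :=
  if unlift ord0 al is Some a then (0, ebase a) else (1, 0).

Definition pd T (al : 'I_n.+1) u : R * 'rV[R]_n -> R :=
  derive_in (slab T) (tx_base al) u.

Definition L2norm_tx T u : \bar R :=
  'N[lebesgue_tx n]_2%:E [EFin \o (u \_ (oslab T))].

End spacetime.

(* Main.v *)
(** Contract the energy current of [phi] with a multiplier [Y phi + w phi] and
    integrate its divergence over the slab, against a cutoff whose support
    shrinks faster than the propagation speed.  For [Y = d_t], [w = 0] this
    bounds the energy at each time by the initial energy and the sources.  For
    [Y = k x.grad], [w = (n - 1) k / 2] with [k = u^(mu - 1/2) (L^2 + u)^(- mu)],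
    [u = r^2 + eps], the divergence dominates
    [mu (1 - 2 mu) L^2 / (L^2 + u) k (|d phi|^2 + phi^2 / u)] up to the source
    and perturbation terms, while the flux through [t = 0] and [t = T] is bounded
    by the energy thanks to Hardy's inequality.  Letting the cutoff radius tend to
    infinity and [eps] to [0] gives one bulk estimate for every [L >= 1].  On
    [r <= 1 + T] the choice [L = 1 + T] yields the polynomially weighted norms,
    and the sum over the dyadic [L = 2^j], of which there are [O (log (2 + T))],
    the logarithmically weighted ones; on [r >= 1 + T] the energy integrated in
    time suffices.  The initial energy is that of [(f, g)] because the classical
    gradient of [phi (0, .)] is a weak gradient of [f]. *)
Require Import Defs.
From HB Require Import structures.
From mathcomp Require Import all_boot all_order all_algebra.
From mathcomp Require Import all_classical all_reals all_analysis.
From mathcomp Require Import measurable_realfun.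
From mathcomp Require Import ring lra.
Set Implicit Arguments.
Unset Strict Implicit.
Unset Printing Implicit Defensive.
Import numFieldNormedType.Exports.
Import Order.TTheory GRing.Theory Num.Theory.
Local Open Scope classical_set_scope.
Local Open Scope ring_scope.

(** * Integration over the space and over the slab *)

(** The field [k x] must be bounded, for its flux to be an energy, while its radial derivative must
    be positive. For [u = r ^ 2] one has [r k = (r ^ 2 / (L ^ 2 + r ^ 2)) ^ mu], which grows from 0
    to 1. A bounded increasing function of [r] cannot have a derivative comparable to [1 / r] on
    more than a bounded number of dyadic shells, so one [L] is free of loss only for [r] of the
    order of [L]. Keeping a single scale costs the power of [1 + T]; using all scales costs the
    logarithm. The condition [mu > 0] makes [r k] increase, and [mu < 1 / 2] keeps the term in
    [phi ^ 2] coercive down to the axis in dimension 3. The perturbation terms on the right may have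
    infinite integrals. The estimates are therefore inequalities in [[0, +oo]]: only cut off
    currents, which are integrable, are integrated with a sign, and the limits in the cutoff radius
    and in [eps] are taken by Fatou's lemma. *)

Lemma cvg_mx_entries {K : numFieldType} (T : Type) (G : set_system T)
    (FG : Filter G) m n (f : T -> 'M[K]_(m, n)) (A : 'M[K]_(m, n)) :
  (forall i j, f x i j @[x --> G] --> A i j) -> f x @[x --> G] --> A.
Proof.
move=> fA U [P nP PU]; rewrite /nbhs /=; rewrite /fmap /=.
have H : \forall x \near G, forall ij : 'I_m * 'I_n, P ij.1 ij.2 (f x ij.1 ij.2).
  by apply: filter_forall => -[i j]; exact: (fA i j _ (nP i j)).
by apply: filterS H => x H; apply: PU => i j; exact: (H (i, j)).
Qed.

Section measurable_continuous.
Context {R : realType}.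

(* [f \o e] is a pointwise limit of functions with countably many values. *)
Lemma measurable_countable_approx d (X : measurableType d) (V : topologicalType)
    (C : countType) (v : nat -> C -> V) (q : nat -> X -> C) (e : X -> V)
    (f : V -> R) :
  (forall k c, measurable [set x | q k x = c]) ->
  (forall x, v k (q k x) @[k --> \oo] --> e x) ->
  continuous f -> measurable_fun [set: X] (f \o e).
Proof.
move=> mq qe cf.
apply: (@measurable_fun_cvg _ _ _ _ (fun k x => f (v k (q k x)))) => [k|x _]; last first.
  by apply: (cvg_comp _ _ (qe x)); exact: cf.
move=> _ Y mY; rewrite setTI.
rewrite (_ : _ @^-1` _ =
    \bigcup_(c in [set c | Y (f (v k c))]) [set x | q k x = c]).
  rewrite bigcup_mkcond; apply: countable_bigcupT_measurable => [|c].
    exact: countableP.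
  by case: (c \in _); [exact: mq|exact: measurable0].
by apply/seteqP; split=> [x Yx|x [c /= + qc]]; [exists (q k x)|rewrite -qc].
Qed.

Lemma floor_approx (x : R) :
  (Num.floor (k.+1%:R * x))%:~R / k.+1%:R @[k --> \oo] --> x.
Proof.
apply/cvgrPdist_le => e e0; near=> k.
have k0 : (0 : R) < k.+1%:R by rewrite ltr0n.
have := floor_itv (k.+1%:R * x) => /andP[h1 h2].
have ke : k.+1%:R^-1 <= e by apply/ltW; near: k; exact: (near_infty_natSinv_lt (PosNum e0)).
set z := Num.floor _ in h1 h2 *.
have E : x - z%:~R / k.+1%:R = (k.+1%:R * x - z%:~R) / k.+1%:R.
  by rewrite mulrBl mulrAC divff ?mul1r// lt0r_neq0.
apply: le_trans ke.
rewrite E normrM [X in _ * X]ger0_norm ?invr_ge0 ?ltW//.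
rewrite -[ltRHS]mul1r ltr_pM2r ?invr_gt0// ger0_norm ?subr_ge0//.
by move: h2; rewrite intrD; lra.
Unshelve. all: by end_near. Qed.

Lemma measurable_floor_eq d (X : measurableType d) (u : X -> R) (k : nat)
    (c : int) : measurable_fun setT u ->
  measurable [set x | Num.floor (k.+1%:R * u x) = c].
Proof.
move=> mu.
rewrite (_ : [set _ | _] = setT `&` (fun x => k.+1%:R * u x) @^-1`
    `[c%:~R, (c + 1)%:~R[%classic).
  by apply: measurable_funM => //; exact: measurable_cst.
rewrite setTI; apply/seteqP; split => x /=; rewrite in_itv /=.
  by move=> <-; exact: floor_itv.
by move/floor_def.
Qed.

(** The sigma-algebra is generated by the coordinates, so openness does not give measurability at
    once. Rounding each coordinate down to a multiple of [1 / (k + 1)] takes countably many values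
    and tends to the identity. *)
Lemma continuous_measurable_rV n (f : 'rV[R]_n -> R) :
  continuous f -> measurable_fun setT f.
Proof.
move=> cf.
apply: (@measurable_countable_approx _ 'rV[R]_n 'rV[R]_n 'rV[int]_n
  (fun k c => \row_i ((c 0 i)%:~R / k.+1%:R))
  (fun k x => \row_i Num.floor (k.+1%:R * x 0 i)) id f) => // [k c|x].
- rewrite (_ : [set _ | _] = \bigcap_(i in [set: 'I_n])
    [set x : 'rV[R]_n | Num.floor (k.+1%:R * x 0 i) = c 0 i]).
    apply: fin_bigcap_measurable => // i _.
    by apply: measurable_floor_eq; exact: measurable_coord.
  apply/seteqP; split => [x /= <- i _|x /= H].
    by rewrite mxE.
  by apply/rowP => i; rewrite mxE; exact: H.
- apply: cvg_mx_entries => i j; rewrite (ord1 i).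
  under eq_fun do rewrite !mxE.
  exact: floor_approx.
Qed.

Lemma continuous_measurable_txV n (f : R * 'rV[R]_n -> R) :
  continuous f ->
  measurable_fun [set: (measurableTypeR R * 'rV[R]_n)%type] f.
Proof.
move=> cf.
apply: (@measurable_countable_approx _ (measurableTypeR R * 'rV[R]_n)%type
  (R * 'rV[R]_n)%type
  (int * 'rV[int]_n)%type
  (fun k c => (c.1%:~R / k.+1%:R, \row_i ((c.2 0 i)%:~R / k.+1%:R)))
  (fun k x => (Num.floor (k.+1%:R * x.1), \row_i Num.floor (k.+1%:R * x.2 0 i)))
  id f) => // [k c|x].
- rewrite (_ : [set _ | _] = 
    [set x : measurableTypeR R * 'rV[R]_n | Num.floor (k.+1%:R * (x.1 : R)) = c.1] `&`
    \bigcap_(i in [set: 'I_n])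
    [set x : measurableTypeR R * 'rV[R]_n |
      Num.floor (k.+1%:R * x.2 0 i) = c.2 0 i]).
    apply: measurableI.
      apply: (@measurable_floor_eq _ (measurableTypeR R * 'rV[R]_n)%type fst).
      exact: measurable_fst.
    apply: fin_bigcap_measurable => // i _.
    apply: (@measurable_floor_eq _ (measurableTypeR R * 'rV[R]_n)%type
      (fun x => x.2 0 i)).
    exact: (measurableT_comp (measurable_coord i) measurable_snd).
  case: c => c1 c2; apply/seteqP; split => [x /= [<- <-]|x /= [<- H]].
    by split => // i _; rewrite mxE.
  by congr pair; apply/rowP => i; rewrite mxE; exact: H.
- case: x => t x; apply: (@cvg_pair _ _ _ \oo (nbhs t) (nbhs x)) => /=.
    exact: floor_approx.
  apply: cvg_mx_entries => i j; rewrite (ord1 i).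
  under eq_fun do rewrite !mxE.
  exact: floor_approx.
Qed.

End measurable_continuous.

Section space_integral.
Context {R : realType}.
Local Notation leb := (@lebesgue_measure R).

Definition box n (M : R) : set 'rV[R]_n := [set x | forall i, `|x 0 i| <= M].

Lemma boxE n M : @box n M = [set x | forall i, `[- M, M]%classic (x 0 i)].
Proof.
by apply/seteqP; split => x /= H i; have := H i; rewrite in_itv /= ler_norml.
Qed.

Lemma measurable_rect n (A : 'I_n -> set R) : (forall i, measurable (A i)) ->
  measurable [set x : 'rV[R]_n | forall i, A i (x 0 i)].
Proof.
move=> mA; have -> : [set x : 'rV[R]_n | forall i, A i (x 0 i)] =
    \bigcap_(i in [set: 'I_n]) ((fun x : 'rV[R]_n => x 0 i) @^-1` A i).
  by apply/seteqP; split=> x /= Ax i; [move=> _; exact: Ax|exact: Ax].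
apply: fin_bigcap_measurable => // i _.
by rewrite -[X in measurable X]setTI; exact: measurable_coord.
Qed.

Lemma measurable_box n M : measurable (@box n M).
Proof.
by rewrite boxE; apply: (measurable_rect (A := fun=> _)) => i; exact: measurable_itv.
Qed.

Lemma lebesgue_box_lty n M : (lebesgue_rV n (@box n M) < +oo)%E.
Proof.
have -> : lebesgue_rV n (box M) =
    (\prod_(i < n) leb `[(- M)%R, M]%classic)%E.
  rewrite -(@lebesgue_rV_box R n (fun=> `[(- M)%R, M]%classic)).
    by congr (lebesgue_rV n _); exact: boxE.
  by move=> i; exact: measurable_itv.
suff: (0 <= \prod_(i < n) leb `[(- M)%R, M]%classic < +oo)%E by move=> /andP[].
elim/big_ind : _ => [|x y /andP[x0 xoo] /andP[y0 yoo]|i _].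
- by rewrite lee_fin ler01 ltry.
- by rewrite mule_ge0//= lte_mul_pinfty// ge0_fin_numE.
- by rewrite measure_ge0 /= lebesgue_measure_itv; case: ifPn => // _; rewrite ltry.
Qed.

Lemma compact_box n M : compact (@box n M).
Proof.
rewrite boxE; apply: (@rV_compact R n (fun=> `[- M, M]%classic)) => _.
exact: segment_compact.
Qed.

Lemma integrable_continuous_box n M (u : 'rV[R]_n -> R) : continuous u ->
  (lebesgue_rV n).-integrable (box M) (EFin \o u).
Proof.
move=> cu; apply: measurable_bounded_integrable.
- exact: measurable_box.
- exact: lebesgue_box_lty.
- by apply: measurable_funTS; exact: continuous_measurable_rV.
- have cuM : {within box M, continuous u} by exact: continuous_subspaceT.
  have /compact_bounded[N [rN H]] := continuous_compact cuM (@compact_box n M).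
  by exists N; split => // y Ny x Bx; apply: H => //; exists x.
Qed.

Lemma integrable_box n M (u : 'rV[R]_n -> R) : continuous u ->
  (forall x, u x != 0 -> box M x) -> (lebesgue_rV n).-integrable setT (EFin \o u).
Proof.
move=> cu su; have -> : (EFin \o u) = (EFin \o u) \_ (box M).
  apply/funext => x; rewrite patchE; case: ifPn => // /negP xM.
  rewrite /=; case: (eqVneq (u x) 0) => [->//|/su xM'].
  by exfalso; apply: xM; rewrite inE.
rewrite -integrable_mkcond; last exact: measurable_box.
exact: integrable_continuous_box.
Qed.

Lemma integral_deriveT (M : R) (u du : R -> R) : continuous du ->
  (forall t, is_derive t (1 : R) u (du t)) -> (forall t, u t != 0 -> `|t| <= M) ->
  (\int[leb]_t (du t)%:E = 0)%E.
Proof.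
move=> cdu Du su.
(* [N] is positive and larger than [M], so [u] vanishes at both ends of [[- N, N]] whatever the sign
   of [M]. *)
pose N : R := `|M| + 1.
have [M0 M1] : 0 < N /\ M < N.
  by rewrite /N; have := ler_norm M; have := normr_ge0 M; lra.
have u0 t : M < `|t| -> u t = 0.
  by move=> Mt; apply/eqP/negPn/negP => /su; rewrite leNgt Mt.
have du0 t : M < `|t| -> du t = 0.
  move=> Mt; have <- := @derive_val _ _ _ _ _ _ _ (Du t).
  rewrite (@near_eq_derive _ _ _ _ (cst 0))//; first exact: derive_cst.
  have : \forall s \near t, M < `|s|.
    have : `|s| @[s --> t] --> `|t| by apply: cvg_norm; exact: cvg_id.
    by move/cvgr_gt; apply.
  by apply: filterS => s /u0.
rewrite (_ : \int[leb]_t _ = \int[leb]_(t in `[(- N)%R, N]) (du t)%:E)%E; last first.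
  rewrite [RHS]integral_mkcond; apply: eq_integral => t _; rewrite patchE.
  case: ifPn => // /negP tN; rewrite du0// ltNge; apply/negP => tM; apply: tN.
  by rewrite inE /= in_itv /= -ler_norml; lra.
rewrite (@continuous_FTC2 _ du u); last 4 first.
- by rewrite gtrN.
- exact: continuous_subspaceT.
- have cu : continuous u.
    by move=> t; apply/differentiable_continuous/derivable1_diffP; exact: ex_derive.
  split; first by move=> t _; exact: ex_derive.
    by apply: cvg_at_right_filter; exact: cu.
  by apply: cvg_at_left_filter; exact: cu.
- by move=> t _; rewrite derive1E; exact: derive_val.
by rewrite !u0 ?subee// ?normrN gtr0_norm.
Qed.

(** By construction [lebesgue_rV n.+1] is the image of a product measure under [consrV]. This change
    of variables makes Fubini's theorem available for inductions on the dimension. *)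
Lemma integral_rVS n (u : 'rV[R]_n.+1 -> \bar R) :
  (lebesgue_rV n.+1).-integrable setT u ->
  (leb \x lebesgue_rV n)%E.-integrable setT (u \o @consrV R n) /\
  (\int[lebesgue_rV n.+1]_x u x =
   \int[(leb \x lebesgue_rV n)]_z u (consrV z))%E.
Proof.
move=> iu.
have mc := @measurable_consrV R n.
have mu := measurable_int _ iu.
have iu' : (leb \x lebesgue_rV n)%E.-integrable setT (u \o @consrV R n).
  apply/integrableP; split; first exact: measurableT_comp mu mc.
  move/integrableP : iu => [_]; apply: le_lt_trans.
  rewrite -(@ge0_integral_pushforward _ _ _ _ R _ mc (leb \x lebesgue_rV n)%E setT
    (abse \o u)).
  - exact: lexx.
  - exact: measurableT.
  - exact: measurableT_comp.
  - by move=> x _; exact: abse_ge0.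
split => //.
by rewrite -(@integral_pushforward _ _ _ _ R _ mc (leb \x lebesgue_rV n)%E setT u).
Qed.

Lemma continuous_consrV n : continuous (@consrV R n).
Proof.
move=> [t x]; apply: cvg_mx_entries => i j; rewrite (ord1 i) {i}.
case: (unliftP ord0 j) => [k|] ->.
  under eq_fun do rewrite mxE liftK.
  rewrite mxE liftK /=.
  apply: (@cvg_comp _ _ _ snd (fun y : 'rV[R]_n => y 0 k) _ (nbhs x)).
    exact: cvg_snd.
  exact: coord_continuous.
under eq_fun do rewrite mxE unlift_none.
rewrite mxE unlift_none /=; exact: cvg_fst.
Qed.

Lemma consrV_shift0 n (h t : R) (x : 'rV[R]_n) :
  h *: ebase ord0 + consrV (t, x) = consrV (h + t, x).
Proof.
apply/rowP => j; rewrite !mxE; case: (unliftP ord0 j) => [k|] -> /=.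
  by rewrite mulr0 add0r.
by rewrite mulr1.
Qed.

Lemma consrV_shift_lift n a (h t : R) (x : 'rV[R]_n) :
  h *: ebase (lift ord0 a) + consrV (t, x) = consrV (t, h *: ebase a + x).
Proof.
apply/rowP => j; rewrite !mxE; case: (unliftP ord0 j) => [k|] -> /=.
  by rewrite !mxE (inj_eq lift_inj).
by rewrite mulr0 add0r.
Qed.

(** A directional derivative only sees the function on one line. This transfers it between functions
    on different spaces that agree along two lines, in particular to slices and to functions of one
    real variable. *)
Lemma is_derive_line (V W : normedModType R) (u : V -> R) (w : W -> R) (z v : V)
    (z' v' : W) (d : R) :
  (forall h : R, u (h *: v + z) = w (h *: v' + z')) ->
  is_derive z v u d -> is_derive z' v' w d.
Proof.
move=> uw Du.
have uw0 : u z = w z' by have := uw 0; rewrite !scale0r !add0r.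
have E : (fun h : R => h^-1 *: ((u \o shift z) (h *: v) - u z)) =
         (fun h : R => h^-1 *: ((w \o shift z') (h *: v') - w z')).
  by apply/funext => h /=; rewrite uw uw0.
have := @ex_derive _ _ _ _ _ _ _ Du; have := @derive_val _ _ _ _ _ _ _ Du.
rewrite /derivable /derive E => D1 D2; split => //.
Qed.

(** The complement of the box is open, so outside the box the function vanishes near the point and
    its derivative is 0. *)
Lemma derive_box n (M : R) (v x : 'rV[R]_n) (u : 'rV[R]_n -> R) (d : R) :
  is_derive x v u d -> (forall x, u x != 0 -> box M x) -> d != 0 -> box M x.
Proof.
move=> Du su; apply: contra_neqP => /existsNP[i /negP]; rewrite -ltNge => Mx.
rewrite -(@derive_val _ _ _ _ _ _ _ Du) (@near_eq_derive _ _ _ _ (cst 0))//.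
  exact: derive_cst.
have : `|(y : 'rV[R]_n) 0 i| @[y --> x] --> `|x 0 i|.
  apply: (@continuous_comp _ _ _ (fun y : 'rV[R]_n => y 0 i) Num.norm).
    exact: coord_continuous.
  exact: norm_continuous.
move=> /cvgr_gt /(_ _ Mx); apply: filterS => y My.
apply/eqP/negPn/negP => /su /(_ i).
by rewrite leNgt My.
Qed.

(** Induction on the dimension: derivatives along the first coordinate are handled by the
    one-dimensional case, the others by the induction hypothesis on slices. Compact support makes
    the integrand integrable, so both orders of integration are allowed. *)
Lemma integral_partial n (M : R) (a : 'I_n) (u du : 'rV[R]_n -> R) :
  continuous u -> continuous du ->
  (forall x, is_derive x (ebase a) u (du x)) -> (forall x, u x != 0 -> box M x) ->
  (\int[lebesgue_rV n]_x (du x)%:E = 0)%E.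
Proof.
elim: n a u du => [[]//|n IH] a u du cu cdu Du su.
have sdu x : du x != 0 -> box M x by exact: derive_box (Du x) su.
have pairl (t : R) : continuous (fun x : 'rV[R]_n => (t, x)).
  by move=> x; apply: (@cvg_pair _ _ _ (nbhs x) (nbhs t) (nbhs x));
    [exact: cvg_cst|exact: cvg_id].
have pairr (x : 'rV[R]_n) : continuous (fun t : R => (t, x)).
  by move=> t; apply: (@cvg_pair _ _ _ (nbhs t) (nbhs t) (nbhs x));
    [exact: cvg_id|exact: cvg_cst].
have [idu' ->] := integral_rVS (integrable_box cdu sdu).
have slice (f : 'rV[R]_n.+1 -> R) (t : R) :
    continuous f -> continuous (fun x => f (consrV (t, x))).
  move=> cf x; apply: (@continuous_comp _ _ _ (fun x => consrV (t, x)) f).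
    apply: (@continuous_comp _ _ _ (fun x => (t, x)) (@consrV R n)).
      exact: pairl.
    exact: continuous_consrV.
  exact: cf.
case: (unliftP ord0 a) => [b|] Ea; subst a.
  rewrite -(integral12_prod_meas1 idu').
  apply: integral0_eq => t _ /=.
  apply: (IH b (fun x => u (consrV (t, x)))).
  - exact: slice.
  - exact: slice.
  - move=> x; apply: is_derive_line (Du (consrV (t, x))) => h.
    by rewrite consrV_shift_lift.
  - by move=> x /su H i; have := H (lift ord0 i); rewrite mxE liftK.
rewrite -(integral21_prod_meas1 idu').
apply: integral0_eq => x _ /=.
apply: (@integral_deriveT M (fun t => u (consrV (t, x)))).
- move=> t; apply: (@continuous_comp _ _ _ (fun t => consrV (t, x)) du).
    apply: (@continuous_comp _ _ _ (fun t => (t, x)) (@consrV R n)).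
      exact: pairr.
    exact: continuous_consrV.
  exact: cdu.
- move=> t; apply: is_derive_line (Du (consrV (t, x))) => h.
  by rewrite consrV_shift0 /= scaler1.
- by move=> t /su /(_ ord0); rewrite mxE unlift_none.
Qed.

End space_integral.

Section spacetime_divergence.
Context {R : realType}.
Local Notation leb := (@lebesgue_measure R).

(** [f] may change sign and is therefore taken integrable; [P] and [Q] may have infinite integrals,
    and when that of [P] is infinite the bound is trivial. *)
Lemma integral_le_add d (X : measurableType d)
    (m : {measure set X -> \bar R}) (D : set X) (f P Q : X -> R) :
  measurable D -> m.-integrable D (EFin \o f) ->
  measurable_fun D P -> measurable_fun D Q ->
  (forall x, D x -> 0 <= P x) -> (forall x, D x -> 0 <= Q x) ->
  (forall x, D x -> Q x <= f x + P x) ->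
  (\int[m]_(x in D) (Q x)%:E <=
   \int[m]_(x in D) (f x)%:E + \int[m]_(x in D) (P x)%:E)%E.
Proof.
move=> mD fi mP mQ P0 Q0 QfP.
have fI := integrable_fin_num mD fi.
have [->|Poo] := eqVneq (\int[m]_(x in D) (P x)%:E)%E +oo%E.
  by rewrite addey ?leey// -ltNye ltNye_eq fI.
have Pi : m.-integrable D (EFin \o P).
  apply/integrableP; split; first exact/measurable_EFinP.
  rewrite (@eq_integral _ _ _ m D (EFin \o P)) ?ltey// => x.
  by rewrite inE => Dx /=; rewrite ger0_norm ?P0.
rewrite -integralD//.
apply: ge0_le_integral => //.
- exact/measurable_EFinP.
- by apply: emeasurable_funD; [move/integrableP: fi => []|move/integrableP: Pi => []].
Qed.

Lemma measurable_oslab n (T : R) :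
  measurable (oslab T : set (measurableTypeR R * 'rV[R]_n)%type).
Proof.
rewrite (_ : oslab T = `]0, T[%classic `*` setT); last first.
  by apply/seteqP; split => z /=; rewrite in_itv /=; [|move=> []].
by apply: measurableX.
Qed.

Lemma integrable_slab n (T M : R) (u : R * 'rV[R]_n -> R) : continuous u ->
  (forall z, oslab T z -> u z != 0 -> box M z.2) ->
  (lebesgue_tx n).-integrable (oslab T) (EFin \o u).
Proof.
move=> cu su.
pose K : set (measurableTypeR R * 'rV[R]_n)%type := `]0, T[%classic `*` box M.
have mK : measurable K by apply: measurableX => //; exact: measurable_box.
apply/(integrable_mkcond _ (@measurable_oslab n T)).
have -> : (EFin \o u) \_ (oslab T) = (EFin \o u) \_ K.
  apply/funext => z; rewrite !patchE; case: ifPn => [|/negP] zT.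
    case: ifPn => // /negP zK /=.
    have [->//|uz] := eqVneq (u z) 0; exfalso; apply: zK.
    move: zT; rewrite !inE => zT; split; last exact: su.
    by rewrite /= in_itv.
  case: ifPn => // zK; exfalso; apply: zT; move: zK; rewrite !inE => -[].
  by rewrite /= in_itv.
apply/(integrable_mkcond _ mK).
apply: measurable_bounded_integrable => //.
- have -> : lebesgue_tx n K =
      (leb `]0%R, T[%classic * lebesgue_rV n (box M))%E.
    by apply: product_measure1E => //; exact: measurable_box.
  have := @lebesgue_box_lty R n M => MI.
  rewrite lte_mul_pinfty// ge0_fin_numE//= lebesgue_measure_itv.
  by case: ifPn => // _; rewrite ltry.
- by apply: measurable_funTS; exact: continuous_measurable_txV.
(* The open time interval is not compact; the bound on [u] is taken over its closure. *)
- have cK : compact (`[0, T]%classic `*` @box R n M).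
    by apply: compact_setX; [exact: segment_compact|exact: compact_box].
  have cuK : {within `[0, T]%classic `*` @box R n M, continuous u}.
    exact: continuous_subspaceT.
  have /compact_bounded[N [rN H]] := continuous_compact cuK cK.
  exists N; split => // y Ny z [z1 z2]; apply: H => //; exists z => //.
  split => //; move: z1; rewrite /= !in_itv /= => /andP[? ?].
  by rewrite !ltW.
Qed.

(** The derivative is known in the open interval only; continuity of [u] up to the ends supplies the
    boundary values. *)
Lemma integral_time (T : R) (u du : R -> R) : 0 < T -> continuous u ->
  continuous du -> (forall t, 0 < t < T -> is_derive t (1 : R) u (du t)) ->
  (\int[leb]_(t in `]0%R, T[) (du t)%:E = (u T)%:E - (u 0)%:E)%E.
Proof.
move=> T0 cu cdu Du.
have mdu : measurable_fun setT du by exact: continuous_measurable_fun.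
rewrite integral_itv_bndo_bndc; last by apply/measurable_funTS/measurable_EFinP.
rewrite integral_itv_obnd_cbnd; last by apply/measurable_funTS/measurable_EFinP.
rewrite (@continuous_FTC2 _ du u) //.
- exact: continuous_subspaceT.
- split.
  + by move=> t; rewrite in_itv /= => /Du tD; exact: ex_derive.
  + by apply: cvg_at_right_filter; exact: cu.
  + by apply: cvg_at_left_filter; exact: cu.
- move=> t; rewrite in_itv /= => /Du tD.
  by rewrite derive1E; exact: derive_val.
Qed.

Lemma continuous_pairl n (t : R) : continuous (fun x : 'rV[R]_n => (t, x)).
Proof.
move=> x; apply: (@cvg_pair _ _ _ (nbhs x) (nbhs t) (nbhs x));
  [exact: cvg_cst|exact: cvg_id].
Qed.

Lemma continuous_pairr n (x : 'rV[R]_n) : continuous (fun t : R => (t, x)).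
Proof.
move=> t; apply: (@cvg_pair _ _ _ (nbhs t) (nbhs t) (nbhs x));
  [exact: cvg_id|exact: cvg_cst].
Qed.

Lemma continuous_slice n (u : R * 'rV[R]_n -> R) (t : R) :
  continuous u -> continuous (fun x => u (t, x)).
Proof.
move=> cu x; apply: (@continuous_comp _ _ _ (fun x => (t, x)) u).
  exact: continuous_pairl.
exact: cu.
Qed.

Lemma continuous_slicet n (u : R * 'rV[R]_n -> R) x :
  continuous u -> continuous (fun t => u (t, x)).
Proof.
move=> cu t; apply: (@continuous_comp _ _ _ (fun t => (t, x)) u).
  exact: continuous_pairr.
exact: cu.
Qed.

Lemma tx_base0 n : @tx_base R n ord0 = (1, 0).
Proof. by rewrite /tx_base unlift_none. Qed.

Lemma tx_base_lift n (a : 'I_n) : @tx_base R n (lift ord0 a) = (0, ebase a).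
Proof. by rewrite /tx_base liftK. Qed.

Lemma is_derive_slice n (u : R * 'rV[R]_n -> R) t x a d :
  is_derive (t, x) (tx_base (lift ord0 a)) u d ->
  is_derive x (ebase a) (fun y => u (t, y)) d.
Proof.
rewrite tx_base_lift; apply: is_derive_line => h.
by congr u; apply: injective_projections => //=; rewrite scaler0 add0r.
Qed.

Lemma is_derive_slicet n (u : R * 'rV[R]_n -> R) t x d :
  is_derive (t, x) (tx_base ord0) u d ->
  is_derive t (1 : R) (fun s => u (s, x)) d.
Proof.
rewrite tx_base0; apply: is_derive_line => h.
by congr u; apply: injective_projections => //=; rewrite ?scaler0 ?add0r.
Qed.

Lemma slab_integral n (T : R) (u : R * 'rV[R]_n -> \bar R) :
  (lebesgue_tx n).-integrable (oslab T) u ->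
  (\int[lebesgue_tx n]_(z in oslab T) u z =
   \int[leb]_(t in `]0%R, T[) \int[lebesgue_rV n]_x u (t, x))%E /\
  (\int[lebesgue_tx n]_(z in oslab T) u z =
   \int[lebesgue_rV n]_x \int[leb]_(t in `]0%R, T[) u (t, x))%E.
Proof.
rewrite (integrable_mkcond _ (@measurable_oslab n T)) => iu.
have tT (t : R) (x : 'rV[R]_n) : ((t, x) \in oslab T) = (t \in `]0%R, T[%classic).
  by apply/idP/idP => /set_mem h; apply/mem_set; move: h; rewrite /= in_itv.
split; rewrite integral_mkcond.
  rewrite -(integral12_prod_meas1 iu) [RHS]integral_mkcond.
  apply: eq_integral => t _; rewrite patchE; case: ifPn => tt.
    by apply: eq_integral => x _; rewrite patchE tT tt.
  by apply: integral0_eq => x _; rewrite patchE tT (negbTE tt).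
rewrite -(integral21_prod_meas1 iu).
apply: eq_integral => x _; rewrite [RHS]integral_mkcond.
by apply: eq_integral => t _; rewrite !patchE tT.
Qed.

Lemma ge0_slab_integral n (T : R) (u : R * 'rV[R]_n -> \bar R) :
  measurable_fun (oslab T : set (measurableTypeR R * 'rV[R]_n)%type) u ->
  (forall z, oslab T z -> 0 <= u z)%E ->
  (\int[lebesgue_tx n]_(z in oslab T) u z =
   \int[leb]_(t in `]0%R, T[) \int[lebesgue_rV n]_x u (t, x))%E.
Proof.
move=> mu u0.
have mu' : measurable_fun setT (u \_ (oslab T)).
  by apply/(measurable_restrictT _ (@measurable_oslab n T)).
have tT (t : R) (x : 'rV[R]_n) : ((t, x) \in oslab T) = (t \in `]0%R, T[%classic).
  by apply/idP/idP => /set_mem h; apply/mem_set; move: h; rewrite /= in_itv.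
rewrite integral_mkcond (@fubini_tonelli1 _ _ _ _ _ leb (lebesgue_rV n))//.
  rewrite [RHS]integral_mkcond.
  apply: eq_integral => t _; rewrite patchE; case: ifPn => tt.
    by apply: eq_integral => x _; rewrite patchE tT tt.
  by apply: integral0_eq => x _; rewrite patchE tT (negbTE tt).
by move=> z; rewrite patchE; case: ifPn => //; rewrite inE => /u0.
Qed.

Lemma slab_divergence n (T M : R) (J dJ : 'I_n.+1 -> R * 'rV[R]_n -> R) :
  0 < T -> (forall al, continuous (J al)) -> (forall al, continuous (dJ al)) ->
  (forall al z, oslab T z -> is_derive z (tx_base al) (J al) (dJ al z)) ->
  (forall al z, slab T z -> J al z != 0 -> box M z.2) ->
  [/\ (lebesgue_tx n).-integrable (oslab T) (fun z => (\sum_al dJ al z)%:E),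
      (lebesgue_rV n).-integrable setT (fun x => (J ord0 (0, x))%:E),
      (lebesgue_rV n).-integrable setT (fun x => (J ord0 (T, x))%:E) &
  (\int[lebesgue_tx n]_(z in oslab T) (\sum_al dJ al z)%:E =
   \int[lebesgue_rV n]_x (J ord0 (T, x))%:E -
   \int[lebesgue_rV n]_x (J ord0 (0, x))%:E)%E].
Proof.
move=> T0 cJ cdJ DJ sJ.
have os z : oslab T z -> slab T z by case/andP => *; apply/andP; rewrite !ltW.
have sdJ al z : oslab T z -> dJ al z != 0 -> box M z.2.
  move=> zT; case: (unliftP ord0 al) => [a|] Ea; subst al; case: z zT => t x zT.
    have /is_derive_slice D := DJ (lift ord0 a) _ zT; apply: derive_box D _ => y Jy.
    by apply: (sJ _ (t, y)) Jy; exact: (os _ (t, y) zT).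
  (* In the time direction [derive_box] does not apply, since [J] is known to vanish off the box
     only for times in [[0, T]]. Times near [t] still lie in the open interval, which is enough. *)
  have /is_derive_slicet D := DJ ord0 _ zT.
  apply: contra_neqP => xM.
  have J0 s : 0 < s < T -> J ord0 (s, x) = 0.
    move=> sT; apply/eqP/negPn/negP => /sJ; apply: contra_not (xM) => h.
    exact: (h (os _ (s, x) sT)).
  rewrite -(@derive_val _ _ _ _ _ _ _ D) (@near_eq_derive _ _ _ _ (cst 0))//.
    exact: derive_cst.
  have : \forall s \near t, s \in `]0, T[ by exact: near_in_itvoo.
  by apply: filterS => s; rewrite in_itv /=; exact: J0.
have idJ al : (lebesgue_tx n).-integrable (oslab T) (EFin \o dJ al).
  by apply: (@integrable_slab n T M) => // z; exact: sdJ.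
have iJ t : 0 <= t <= T ->
    (lebesgue_rV n).-integrable setT (fun x => (J ord0 (t, x))%:E).
  move=> tT; apply: (@integrable_box _ n M (fun x => J ord0 (t, x))).
    exact: continuous_slice.
  by move=> x; exact: (sJ _ (t, x)).
have E : (fun z => (\sum_al dJ al z)%:E) = (fun z => \sum_al (dJ al z)%:E)%E.
  by apply/funext => z; rewrite sumEFin.
split.
- rewrite E.
  apply: (@integrable_sum _ _ _ (lebesgue_tx n) _ (@measurable_oslab n T) _
    (index_enum _) xpredT (fun al z => (dJ al z)%:E)) => al _; exact: idJ.
- by apply: iJ; rewrite lexx ltW.
- by apply: iJ; rewrite lexx ltW.
under eq_integral do rewrite -sumEFin.
rewrite integral_sum//; last exact: measurable_oslab.
(* Each space component integrates to zero over every time slice; only the time component leaves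
   boundary terms. *)
rewrite big_ord_recl [X in (_ + X)%E]big1 ?adde0 => [|a _]; last first.
  have [-> _] := slab_integral (idJ (lift ord0 a)).
  apply: integral0_eq => t; rewrite /= in_itv /= => tT.
  apply: (@integral_partial _ n M a (fun x => J (lift ord0 a) (t, x))).
  - exact: continuous_slice.
  - exact: continuous_slice.
  - by move=> x; apply: is_derive_slice; exact: DJ.
  - by move=> x; apply: (sJ _ (t, x)); exact: os.
have [_ ->] := slab_integral (idJ ord0).
rewrite -integralB//; last 2 first.
- by apply: iJ; rewrite lexx ltW.
- by apply: iJ; rewrite lexx ltW.
apply: eq_integral => x _ /=.
apply: (@integral_time T (fun t => J ord0 (t, x))) => //.
- exact: continuous_slicet.
- exact: continuous_slicet.
- by move=> t tT; apply: is_derive_slicet; exact: DJ.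
Qed.

(** The form in which the divergence theorem is used: the current has finite integrals, while the
    nonnegative bounds [W], [P], [A], [B] and [B'] may have infinite ones. *)
Lemma slab_divergence_le n (T M : R) (J dJ : 'I_n.+1 -> R * 'rV[R]_n -> R)
    (W P : R * 'rV[R]_n -> R) (A B B' : 'rV[R]_n -> R) :
  0 < T -> (forall al, continuous (J al)) -> (forall al, continuous (dJ al)) ->
  (forall al z, oslab T z -> is_derive z (tx_base al) (J al) (dJ al z)) ->
  (forall al z, slab T z -> J al z != 0 -> box M z.2) ->
  continuous W -> continuous P -> continuous A -> continuous B -> continuous B' ->
  (forall z, 0 <= W z) -> (forall z, 0 <= P z) ->
  (forall x, 0 <= A x) -> (forall x, 0 <= B x) -> (forall x, 0 <= B' x) ->
  (forall z, oslab T z -> W z + \sum_al dJ al z <= P z) ->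
  (forall x, J ord0 (0, x) <= A x) ->
  (forall x, B' x <= J ord0 (T, x) + B x) ->
  (\int[lebesgue_tx n]_(z in oslab T) (W z)%:E +
     \int[lebesgue_rV n]_x (B' x)%:E <=
   \int[lebesgue_tx n]_(z in oslab T) (P z)%:E +
     \int[lebesgue_rV n]_x (A x)%:E + \int[lebesgue_rV n]_x (B x)%:E)%E.
Proof.
move=> T0 cJ cdJ DJ sJ cW cP cA cB cB' W0 P0 A0 B0 B'0 WP JA JB.
have [iS iJ0 iJT ES] := slab_divergence T0 cJ cdJ DJ sJ.
have mc (u : R * 'rV[R]_n -> R) : continuous u -> measurable_fun
    (oslab T : set (measurableTypeR R * 'rV[R]_n)%type) u.
  by move=> cu; apply: measurable_funTS; exact: continuous_measurable_txV.
have mO := @measurable_oslab n T.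
have iNS := integrableN iS; have iNJ0 := integrableN iJ0.
have h1 := @integral_le_add _ _ (lebesgue_tx n) (oslab T)
  (fun z => - \sum_al dJ al z) P W mO iNS (mc _ cP) (mc _ cW)
  (fun z _ => P0 z) (fun z _ => W0 z).
have h2 := @integral_le_add _ _ (lebesgue_rV n) setT
  (fun x => - J ord0 (0, x)) A (cst 0) measurableT iNJ0
  (continuous_measurable_rV cA) (measurable_cst _) (fun z _ => A0 z)
  (fun z _ => lexx _).
have h3 := @integral_le_add _ _ (lebesgue_rV n) setT
  (fun x => J ord0 (T, x)) B B' measurableT iJT
  (continuous_measurable_rV cB) (continuous_measurable_rV cB') (fun z _ => B0 z)
  (fun z _ => B'0 z) (fun z _ => JB z).
have {}h1 := h1 (fun z zT => ltac:(by rewrite addrC lerBrDr; exact: WP)).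
have {}h2 := h2 (fun z zT => ltac:(by rewrite addrC subr_ge0; exact: JA)).
rewrite /= integral0 in h2.
have E1 : (\int[lebesgue_tx n]_(z in oslab T) (- \sum_al dJ al z)%:E =
    - \int[lebesgue_tx n]_(z in oslab T) (\sum_al dJ al z)%:E)%E.
  by rewrite -integralN //; exact: integrable_add_def.
have E2 : (\int[lebesgue_rV n]_x (- J ord0 (0, x))%:E =
    - \int[lebesgue_rV n]_x (J ord0 (0, x))%:E)%E.
  by rewrite -integralN //; exact: integrable_add_def.
rewrite E1 ES in h1; rewrite E2 in h2.
have f0 := integrable_fin_num measurableT iJ0.
have fT := integrable_fin_num measurableT iJT.
move: h1 h2 h3; rewrite -(fineK f0) -(fineK fT).
set j0 := fine _; set jT := fine _ => h1 h2 h3.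
(* In the sum of the three bounds the integrals [j0] and [jT] of the current cancel; they are
   finite, so this is legitimate in the extended reals. *)
have {h1 h2 h3} := leeD h1 (leeD h2 h3).
rewrite add0e => /le_trans; apply.
have : (0 <= \int[lebesgue_tx n]_(z in oslab T) (P z)%:E)%E.
  by apply: integral_ge0 => z _; rewrite lee_fin.
have : (0 <= \int[lebesgue_rV n]_x (A x)%:E)%E.
  by apply: integral_ge0 => z _; rewrite lee_fin.
have : (0 <= \int[lebesgue_rV n]_x (B x)%:E)%E.
  by apply: integral_ge0 => z _; rewrite lee_fin.
move: (\int[lebesgue_rV n]_x (B x)%:E)%E (\int[lebesgue_rV n]_x (A x)%:E)%E
  (\int[lebesgue_tx n]_(z in oslab T) (P z)%:E)%E.
case=> [b| |]; case=> [a| |]; case=> [p| |] //= _ _ _.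
rewrite -?EFinN -?EFinD -?EFinB -?EFinN -?EFinD lee_fin; lra.
Qed.

End spacetime_divergence.

(** * Calculus along directions *)

Section calculus.
Context {R : realType}.

Section directional.
Context {V : normedModType R}.
Implicit Types (z v : V) (f g : V -> R).

Lemma is_deriveM_fun z v f g a b : is_derive z v f a -> is_derive z v g b ->
  is_derive z v (fun y => f y * g y) (a * g z + f z * b).
Proof.
move=> Df Dg; have := is_deriveM Df Dg => D.
by apply: is_derive_eq D _; rewrite /GRing.scale /= addrC mulrC.
Qed.

Lemma is_deriveD_fun z v f g a b : is_derive z v f a -> is_derive z v g b ->
  is_derive z v (fun y => f y + g y) (a + b).
Proof. by move=> Df Dg; exact: is_deriveD. Qed.

Lemma is_deriveB_fun z v f g a b : is_derive z v f a -> is_derive z v g b ->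
  is_derive z v (fun y => f y - g y) (a - b).
Proof. by move=> Df Dg; exact: is_deriveB. Qed.

Lemma is_deriveMl_fun z v f a c : is_derive z v f a ->
  is_derive z v (fun y => c * f y) (c * a).
Proof.
move=> Df; have := is_deriveM_fun (is_derive_cst c z v) Df.
by rewrite mul0r add0r.
Qed.

Lemma is_derive_sum_fun (I : finType) z v (f : I -> V -> R) (a : I -> R) :
  (forall i, is_derive z v (f i) (a i)) ->
  is_derive z v (fun y => \sum_i f i y) (\sum_i a i).
Proof.
move=> Df.
have -> : (fun y => \sum_i f i y) = (fun y => \sum_(i <- index_enum I) f i y) by [].
elim: (index_enum I) => [|i r IH].
  rewrite big_nil; under eq_fun do rewrite big_nil; exact: is_derive_cst.
rewrite big_cons; under eq_fun do rewrite big_cons; exact: is_deriveD_fun.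
Qed.

(** Only the derivative of [f] along [v] is assumed, so the chain rule is taken from one real
    variable after restricting [f] to the line through [z]. *)
Lemma is_derive_comp_fun z v f a (g : R -> R) b :
  is_derive (f z) (1 : R) g b -> is_derive z v f a ->
  is_derive z v (fun y => g (f y)) (b * a).
Proof.
move=> Dg Df.
have Df0 : is_derive (0 : R) (1 : R) (fun h : R => f (h *: v + z)) a.
  by apply: is_derive_line Df => h; rewrite addr0 /GRing.scale /= mulr1.
have Dg0 : is_derive (f (0 *: v + z)) (1 : R) g b by rewrite scale0r add0r.
have D : is_derive (0 : R) (1 : R) (g \o (fun h : R => f (h *: v + z))) (b * a).
  exact: is_derive1_comp.
apply: is_derive_line D => h /=; by rewrite addr0 /GRing.scale /= mulr1.
Qed.

End directional.

Section continuity.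
Context {V : topologicalType}.
Implicit Types f g : V -> R.

(** This and the next rules are stated for explicit abstractions, the form that the tactic
    [cont_step] matches. *)
Lemma continuousD_fun f g : continuous f -> continuous g ->
  continuous (fun z => f z + g z).
Proof. by move=> cf cg z; exact: (continuousD (cf z) (cg z)). Qed.

Lemma continuousB_fun f g : continuous f -> continuous g ->
  continuous (fun z => f z - g z).
Proof. by move=> cf cg z; exact: (continuousB (cf z) (cg z)). Qed.

Lemma continuousN_fun f : continuous f -> continuous (fun z => - f z).
Proof. by move=> cf z; exact: (continuousN (cf z)). Qed.

Lemma continuousM_fun f g : continuous f -> continuous g ->
  continuous (fun z => f z * g z).
Proof. by move=> cf cg z; exact: (continuousM (cf z) (cg z)). Qed.

Lemma continuousV_fun f : (forall z, f z != 0) -> continuous f ->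
  continuous (fun z => (f z)^-1).
Proof. by move=> f0 cf z; exact: (continuousV (f0 z) (cf z)). Qed.

Lemma continuousX_fun f m : continuous f -> continuous (fun z => f z ^+ m).
Proof.
move=> cf; elim: m => [|m IH]; first by under eq_fun do rewrite expr0; exact: cst_continuous.
by under eq_fun do rewrite exprS; exact: continuousM_fun.
Qed.

Lemma continuous_norm_fun f : continuous f -> continuous (fun z => `|f z|).
Proof.
move=> cf z; apply: (@continuous_comp _ _ _ f Num.norm); first exact: cf.
exact: norm_continuous.
Qed.

Lemma continuous_sqrt_fun f : continuous f -> continuous (fun z => Num.sqrt (f z)).
Proof.
move=> cf z; apply: (@continuous_comp _ _ _ f Num.sqrt); first exact: cf.
exact: sqrt_continuous.
Qed.

Lemma continuous_sum_fun (I : finType) (f : I -> V -> R) :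
  (forall i, continuous (f i)) -> continuous (fun z => \sum_i f i z).
Proof.
move=> cf.
have -> : (fun y => \sum_i f i y) = (fun y => \sum_(i <- index_enum I) f i y) by [].
elim: (index_enum I) => [|i r IH].
  by under eq_fun do rewrite big_nil; exact: cst_continuous.
by under eq_fun do rewrite big_cons; exact: continuousD_fun.
Qed.

Lemma continuous_eucl_fun (I : finType) (f : I -> V -> R) :
  (forall i, continuous (f i)) -> continuous (fun z => eucl (fun i => f i z)).
Proof.
move=> cf; rewrite /eucl; apply: continuous_sqrt_fun; apply: continuous_sum_fun => i.
exact: continuousX_fun.
Qed.

End continuity.

Section eucl_lemmas.
Context (I : finType).
Implicit Type v : I -> R.

Lemma eucl_ge0 v : 0 <= eucl v.
Proof. exact: sqrtr_ge0. Qed.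

Lemma eucl_sqr v : eucl v ^+ 2 = \sum_i v i ^+ 2.
Proof. by rewrite sqr_sqrtr// sumr_ge0// => i _; exact: sqr_ge0. Qed.

Lemma le_eucl v i : `|v i| <= eucl v.
Proof.
rewrite -[leLHS]sqrtr_sqr ler_sqrt; last first.
  by apply: sumr_ge0 => j _; exact: sqr_ge0.
rewrite (bigD1 i) //= ler_wpDr //.
by apply: sumr_ge0 => j _; exact: sqr_ge0.
Qed.

Lemma euclZ (c : R) v : eucl (fun i => c * v i) = `|c| * eucl v.
Proof.
rewrite /eucl; under eq_bigr do rewrite exprMn.
by rewrite -mulr_sumr sqrtrM ?sqr_ge0// sqrtr_sqr.
Qed.

Lemma ler_norm_sum_card (f : I -> R) (b : R) : (forall i, `|f i| <= b) ->
  `|\sum_i f i| <= #|I|%:R * b.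
Proof.
move=> fb; apply: le_trans (ler_norm_sum _ _ _) _.
apply: le_trans (ler_sum _ (fun i _ => fb i)) _.
by rewrite sumr_const mulr_natl.
Qed.

End eucl_lemmas.

(** Squaring the positive part removes its kink: at 0 the difference quotient is at most [|h|]. This
    is the profile of the cutoff. *)
Lemma is_derive_max0_sqr (u : R) :
  is_derive u (1 : R) (fun u => Num.max 0 u ^+ 2) (2 * Num.max 0 u).
Proof.
have D0 : is_derive u (1 : R) (fun _ : R => 0 : R) 0 by exact: is_derive_cst.
have D2 : is_derive u (1 : R) (fun u : R => u ^+ 2) (2 * u).
  have := is_deriveM_fun (is_derive_id u (1 : R)) (is_derive_id u (1 : R)).
  by rewrite mul1r mulr1 => D; apply: is_derive_eq D _; ring.
have [u0|u0|<-] := ltgtP 0 u.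
- apply: near_eq_is_derive D2.
  have idu : y @[y --> u] --> u by exact: cvg_id.
  move: idu => /cvgr_gt /(_ _ u0).
  by apply: filterS => y y0; rewrite max_r// ltW.
- rewrite mulr0; apply: near_eq_is_derive D0.
  have idu : y @[y --> u] --> u by exact: cvg_id.
  move: idu => /cvgr_lt /(_ _ u0).
  by apply: filterS => y y0; rewrite max_l ?expr0n// ltW.
- rewrite mulr0.
  have C : (h^-1 *: (Num.max 0 (h *: (1 : R) + 0 : R) ^+ 2 -
      Num.max 0 (0 : R) ^+ 2) : R) @[h --> (0:R)^'] --> (0 : R).
    apply/cvgr0Pnorm_le => e e0.
    have : \forall h \near (0:R)^', `|h| <= e.
      exact: dnbhs0_le.
    apply: filterS2 (nbhs_dnbhs_neq _) => h he h0.
    rewrite /GRing.scale /= mulr1 addr0 maxxx expr0n subr0 normrM normfV normrX.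
    rewrite ler_pdivrMl ?normr_gt0// expr2 mulrC.
    have m : `|Num.max 0 h| <= `|h|.
      by case: (leP 0 h) => h1; rewrite ?normr0.
    by apply: ler_pM => //; exact: le_trans m h0.
  split; first by apply/cvg_ex; exists 0.
  exact: cvg_lim C.
Qed.

Lemma continuous_max0 : continuous (fun u : R => Num.max 0 u).
Proof.
by move=> u; apply: (@continuous_max _ _ (cst 0) id); [exact: cst_continuous|exact: cvg_id].
Qed.

End calculus.

(** * The energy current of a multiplier *)

Section current_algebra.
Context {R : realType} (I : finType).
Implicit Types (p Y dw e : I -> R) (G H s dY : I -> I -> R) (dG : I -> I -> I -> R).

Definition mxv G p al : R := \sum_be G al be * p be.

Definition qform G p : R := \sum_al p al * mxv G p al.

(** With [e] equal to 1 on the time index and to -1 on the others, this is the coefficient matrix of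
    the perturbed wave operator. *)
Definition mink e G : I -> I -> R := fun al be => (al == be)%:R * e al + G al be.

Lemma mxv_mink e G p al : mxv (mink e G) p al = e al * p al + mxv G p al.
Proof.
rewrite /mxv /mink; under eq_bigr do rewrite mulrDl; rewrite big_split /=.
congr (_ + _); rewrite (bigD1 al) //= eqxx mul1r big1 ?addr0// => be /negbTE.
by rewrite eq_sym => ->; rewrite !mul0r.
Qed.

Lemma qform_mink e G p :
  qform (mink e G) p = \sum_al e al * p al ^+ 2 + qform G p.
Proof.
rewrite /qform -big_split; apply: eq_bigr => al _ /=.
by rewrite mxv_mink; ring.
Qed.

(* The current of the multiplier [Y^ga d_ga phi + w phi], where [p] is the
   gradient of [phi], [dw] that of [w], and [G = diag e + h]; in [dG], [dY],
   [ddw] and [s] (the Hessian of [phi]) the index of differentiation comes first. *)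
Definition current_val G p Y (w phi : R) dw e al : R :=
  mxv G p al * (\sum_ga Y ga * p ga + w * phi) - 2^-1 * (Y al * qform G p)
  - 2^-1 * (phi ^+ 2 * (e al * dw al)).

(** The Leibniz rule for [mxv G p], where [dG] and [dp] are the derivatives of [G] and [p] in one
    fixed direction. *)
Definition mxv1 G (dG : I -> I -> R) p (dp : I -> R) al : R :=
  \sum_be (dG al be * p be + G al be * dp be).

(** The derivative of component [al] of the current in direction [al], so that the sum over [al] is
    the divergence. *)
Definition current1_val G dG p s Y dY (w phi : R) dw (ddw : I -> I -> R) e al : R :=
  (mxv1 G (dG al) p (s al) al * (\sum_ga Y ga * p ga + w * phi) +
   mxv G p al * (\sum_ga (dY al ga * p ga + Y ga * s al ga) +
     (dw al * phi + w * p al)))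
  - 2^-1 * (dY al al * qform G p +
     Y al * \sum_be (s al be * mxv G p be + p be * mxv1 G (dG al) p (s al) be))
  - 2^-1 * ((p al * phi + phi * p al) * (e al * dw al) + phi ^+ 2 * (e al * ddw al al)).

(** The sum [K], which contracts the Hessian with [Y] and [mxv G p], arises both from the multiplier
    and from the quadratic form, and cancels because [G] and [s] are symmetric. The Hessian survives
    only through [G al be * s al be], which the equation determines. *)
Lemma current1_sum G dG p s Y dY (w phi : R) dw ddw e :
  (forall al be, G al be = G be al) -> (forall al be, s al be = s be al) ->
  \sum_al current1_val G dG p s Y dY w phi dw ddw e al =
  (\sum_al \sum_be G al be * s al be + \sum_al mxv (dG al) p al)
    * (\sum_ga Y ga * p ga + w * phi) +
  (\sum_al mxv G p al * \sum_ga dY al ga * p ga) +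
  (\sum_al mxv G p al * dw al) * phi + w * qform G p
  - 2^-1 * ((\sum_al dY al al) * qform G p)
  - 2^-1 * (\sum_al Y al * qform (dG al) p)
  - phi * (\sum_al p al * (e al * dw al))
  - 2^-1 * (phi ^+ 2 * \sum_al e al * ddw al al).
Proof.
move=> Gs ss.
pose K := \sum_al mxv G p al * \sum_ga Y ga * s al ga.
have E1 : \sum_al mxv1 G (dG al) p (s al) al =
    \sum_al \sum_be G al be * s al be + \sum_al mxv (dG al) p al.
  rewrite -big_split; apply: eq_bigr => al _.
  by rewrite /mxv1 /mxv /= -big_split; apply: eq_bigr => be _ /=; rewrite addrC.
have E2 : \sum_al mxv G p al * (\sum_ga (dY al ga * p ga + Y ga * s al ga) +
     (dw al * phi + w * p al)) =
   \sum_al mxv G p al * (\sum_ga dY al ga * p ga) + K +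
   ((\sum_al mxv G p al * dw al) * phi + w * qform G p).
  rewrite /K /qform !mulr_suml mulr_sumr -!big_split /=; apply: eq_bigr => al _.
  by rewrite big_split /=; ring.
have E3 al : \sum_be (s al be * mxv G p be + p be * mxv1 G (dG al) p (s al) be) =
    qform (dG al) p + 2 * \sum_be s al be * mxv G p be.
  rewrite big_split /= /mxv1.
  under [X in _ + X]eq_bigr do rewrite big_split mulrDr /=.
  rewrite big_split /= -/(qform (dG al) p).
  have -> : \sum_i p i * (\sum_i0 G i i0 * s al i0) = \sum_be s al be * mxv G p be.
    under eq_bigr do rewrite mulr_sumr.
    rewrite exchange_big /=; apply: eq_bigr => be _.
    rewrite /mxv mulr_sumr; apply: eq_bigr => ga _.
    by rewrite (Gs ga be); ring.
  by ring.
have E4 : \sum_al Y al * (\sum_be s al be * mxv G p be) = K.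
  rewrite /K; under eq_bigr do rewrite mulr_sumr.
  rewrite exchange_big /=; apply: eq_bigr => be _.
  rewrite mulr_sumr; apply: eq_bigr => al _.
  by rewrite (ss al be); ring.
have E5 : \sum_al Y al * \sum_be (s al be * mxv G p be + p be * mxv1 G (dG al) p (s al) be)
    = \sum_al Y al * qform (dG al) p + 2 * K.
  rewrite -E4 mulr_sumr -big_split /=; apply: eq_bigr => al _.
  by rewrite E3; ring.
rewrite /current1_val !sumrB -!mulr_sumr !big_split /= -!mulr_suml E1 E2 E5.
have -> : \sum_i (p i * phi + phi * p i) * (e i * dw i) =
    2 * phi * \sum_al p al * (e al * dw al).
  by rewrite mulr_sumr; apply: eq_bigr => i _; ring.
by rewrite -mulr_sumr; field.
Qed.

(** All that [h] contributes to the divergence apart from the second order part of the operator; it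
    is linear in [H] and [dH]. *)
Definition current_err H dH p Y dY (w phi : R) dw : R :=
  (\sum_al mxv (dH al) p al) * (\sum_ga Y ga * p ga + w * phi) +
  \sum_al mxv H p al * (\sum_ga dY al ga * p ga) +
  (\sum_al mxv H p al * dw al) * phi +
  (w - 2^-1 * \sum_al dY al al) * qform H p
  - 2^-1 * (\sum_al Y al * qform (dH al) p).

Lemma mink_sym e H : (forall al be, H al be = H be al) ->
  forall al be, mink e H al be = mink e H be al.
Proof.
move=> Hs al be; rewrite /mink Hs; congr (_ + _).
by have [->|/negbTE ab] := eqVneq al be; rewrite ?mul0r // eq_sym ab !mul0r.
Qed.

(** The last term of the current is chosen so that its divergence removes the diagonal part of
    [mxv (mink e H) p al * dw al * phi]. Apart from the factor of the wave operator, every product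
    of [phi] with its gradient then carries [H] or [dH]. *)
Lemma current1_sum_mink H dH p s Y dY (w phi : R) dw ddw e :
  (forall al be, H al be = H be al) -> (forall al be, s al be = s be al) ->
  \sum_al current1_val (mink e H) dH p s Y dY w phi dw ddw e al =
  (\sum_al \sum_be mink e H al be * s al be) * (\sum_ga Y ga * p ga + w * phi) +
  (\sum_al e al * p al * (\sum_ga dY al ga * p ga) +
   (w - 2^-1 * \sum_al dY al al) * (\sum_al e al * p al ^+ 2)
   - 2^-1 * (phi ^+ 2 * \sum_al e al * ddw al al)) +
  current_err H dH p Y dY w phi dw.
Proof.
move=> Hs ss; rewrite current1_sum//; last exact: mink_sym.
rewrite qform_mink /current_err.
have -> : \sum_al mxv (mink e H) p al * (\sum_ga dY al ga * p ga) =
    \sum_al e al * p al * (\sum_ga dY al ga * p ga) +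
    \sum_al mxv H p al * (\sum_ga dY al ga * p ga).
  by rewrite -big_split; apply: eq_bigr => al _ /=; rewrite mxv_mink; ring.
have -> : \sum_al mxv (mink e H) p al * dw al =
    \sum_al p al * (e al * dw al) + \sum_al mxv H p al * dw al.
  by rewrite -big_split; apply: eq_bigr => al _ /=; rewrite mxv_mink; ring.
by ring.
Qed.

Lemma mxv_bound G p (g q : R) al : (forall be, `|G al be| <= g) ->
  (forall be, `|p be| <= q) -> `|mxv G p al| <= #|I|%:R * (g * q).
Proof.
move=> Gg pq; apply: ler_norm_sum_card => be; rewrite normrM.
by apply: ler_pM.
Qed.

Lemma qform_bound G p (g q : R) : (forall al be, `|G al be| <= g) ->
  (forall be, `|p be| <= q) -> `|qform G p| <= #|I|%:R ^+ 2 * (g * q ^+ 2).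
Proof.
move=> Gg pq; rewrite expr2 -mulrA; apply: ler_norm_sum_card => al; rewrite normrM.
have -> : #|I|%:R * (g * q ^+ 2) = q * (#|I|%:R * (g * q)) by ring.
by apply: ler_pM => //; exact: mxv_bound.
Qed.

Lemma current_err_bound H dH p Y dY (w phi : R) dw (hh dh q y y' w0 w' N : R) :
  (forall al be, `|H al be| <= hh) -> (forall al be ga, `|dH al be ga| <= dh) ->
  (forall al, `|p al| <= q) -> (forall al, `|Y al| <= y) ->
  (forall al be, `|dY al be| <= y') -> `|w| <= w0 -> (forall al, `|dw al| <= w') ->
  `|\sum_ga Y ga * p ga + w * phi| <= N ->
  `|current_err H dH p Y dY w phi dw| <=
    #|I|%:R ^+ 2 * (dh * q) * N + #|I|%:R ^+ 3 * (hh * y' * q ^+ 2) +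
    #|I|%:R ^+ 2 * (hh * q * w') * `|phi| +
    (w0 + 2^-1 * (#|I|%:R * y')) * (#|I|%:R ^+ 2 * (hh * q ^+ 2)) +
    2^-1 * (#|I|%:R ^+ 3 * (y * dh * q ^+ 2)).
Proof.
move=> Hh dHh pq Yy dYy ww dww NN.
have c0 : 0 <= #|I|%:R :> R by exact: ler0n.
have h1 : `|(\sum_al mxv (dH al) p al) * (\sum_ga Y ga * p ga + w * phi)| <=
    #|I|%:R ^+ 2 * (dh * q) * N.
  rewrite normrM; apply: ler_pM => //; rewrite expr2 -mulrA.
  by apply: ler_norm_sum_card => al; apply: mxv_bound.
have h2 : `|\sum_al mxv H p al * (\sum_ga dY al ga * p ga)| <=
    #|I|%:R ^+ 3 * (hh * y' * q ^+ 2).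
  have -> : #|I|%:R ^+ 3 * (hh * y' * q ^+ 2) =
    #|I|%:R * ((#|I|%:R * (hh * q)) * (#|I|%:R * (y' * q))) by ring.
  apply: ler_norm_sum_card => al; rewrite normrM; apply: ler_pM => //.
    exact: mxv_bound.
  apply: ler_norm_sum_card => be; rewrite normrM; exact: ler_pM.
have h3 : `|(\sum_al mxv H p al * dw al) * phi| <= #|I|%:R ^+ 2 * (hh * q * w') * `|phi|.
  rewrite normrM; apply: ler_wpM2r => //.
  have -> : #|I|%:R ^+ 2 * (hh * q * w') = #|I|%:R * ((#|I|%:R * (hh * q)) * w').
    by ring.
  apply: ler_norm_sum_card => al; rewrite normrM; apply: ler_pM => //.
  exact: mxv_bound.
have h4 : `|(w - 2^-1 * \sum_al dY al al) * qform H p| <=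
    (w0 + 2^-1 * (#|I|%:R * y')) * (#|I|%:R ^+ 2 * (hh * q ^+ 2)).
  rewrite normrM; apply: ler_pM => //; last exact: qform_bound.
  apply: le_trans (ler_normB _ _) _; apply: lerD => //.
  rewrite normrM ger0_norm ?invr_ge0// ler_wpM2l ?invr_ge0//.
  exact: ler_norm_sum_card.
have h5 : `|2^-1 * (\sum_al Y al * qform (dH al) p)| <=
    2^-1 * (#|I|%:R ^+ 3 * (y * dh * q ^+ 2)).
  rewrite normrM ger0_norm ?invr_ge0// ler_wpM2l ?invr_ge0//.
  have -> : #|I|%:R ^+ 3 * (y * dh * q ^+ 2) =
      #|I|%:R * (y * (#|I|%:R ^+ 2 * (dh * q ^+ 2))) by ring.
  apply: ler_norm_sum_card => al; rewrite normrM; apply: ler_pM => //.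
  exact: qform_bound.
rewrite /current_err; apply: le_trans (ler_normB _ _) _; apply: lerD => //.
by do 3 (apply: le_trans (ler_normD _ _) _; apply: lerD => //).
Qed.

(** A row sum is at most the sum over all entries, so the smallness of [H] is used without a factor
    depending on the dimension. *)
Lemma mxv_half H p (q : R) al : \sum_al \sum_be `|H al be| <= 1 / 2 ->
  (forall be, `|p be| <= q) -> `|mxv H p al| <= 2^-1 * q.
Proof.
move=> Hh pq; have q0 : 0 <= q by apply: le_trans (pq al).
apply: le_trans (ler_norm_sum _ _ _) _.
apply: (@le_trans _ _ (\sum_be `|H al be| * q)).
  by apply: ler_sum => be _; rewrite normrM ler_wpM2l.
rewrite -mulr_suml ler_wpM2r//.
have -> : 2^-1 = 1 / 2 :> R by lra.
apply: le_trans Hh; rewrite [leRHS](bigD1 al)//= lerDl.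
by apply: sumr_ge0 => be _; apply: sumr_ge0.
Qed.

Lemma qform_half H p (q : R) : \sum_al \sum_be `|H al be| <= 1 / 2 ->
  (forall be, `|p be| <= q) -> `|qform H p| <= 2^-1 * q ^+ 2.
Proof.
move=> Hh pq; apply: le_trans (ler_norm_sum _ _ _) _.
apply: (@le_trans _ _ (\sum_al (\sum_be `|H al be|) * q ^+ 2)).
  apply: ler_sum => al _; rewrite normrM mulr_suml.
  apply: le_trans (ler_wpM2l (normr_ge0 _) (ler_norm_sum _ _ _)) _.
  rewrite mulr_sumr; apply: ler_sum => be _; rewrite normrM mulrCA ler_wpM2l//.
  by rewrite expr2; apply: ler_pM.
by rewrite -mulr_suml ler_wpM2r ?sqr_ge0//; apply: le_trans Hh _; lra.
Qed.

(* The density of the energy current; the symmetry of [H] makes each product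
   [p al * p be] enter with a coefficient at most [`|H al be| / 2]. *)
Lemma energy_density_bound H p (q : R) o e :
  (forall al be, H al be = H be al) ->
  \sum_al \sum_be `|H al be| <= 1 / 2 ->
  (forall be, `|p be| <= q) -> q ^+ 2 = \sum_al p al ^+ 2 ->
  (forall al, e al = if al == o then 1 else -1) ->
  `|mxv (mink e H) p o * p o - 2^-1 * qform (mink e H) p - 2^-1 * q ^+ 2|
    <= 4^-1 * q ^+ 2.
Proof.
move=> Hs Hh pq qE eE.
have -> : mxv (mink e H) p o * p o - 2^-1 * qform (mink e H) p - 2^-1 * q ^+ 2 =
   mxv H p o * p o - 2^-1 * qform H p.
  rewrite mxv_mink qform_mink eE eqxx qE.
  have -> : \sum_al e al * p al ^+ 2 = 2 * p o ^+ 2 - \sum_al p al ^+ 2.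
    rewrite (bigD1 o)//= [in RHS](bigD1 o)//= eE eqxx.
    rewrite (eq_bigr (fun i => - p i ^+ 2)) ?sumrN; first by ring.
    by move=> i /negbTE io; rewrite eE io mulN1r.
  by field.
have -> : mxv H p o * p o - 2^-1 * qform H p =
    2^-1 * \sum_al \sum_be ((al == o)%:R + (be == o)%:R - 1) * H al be * p al * p be.
  have A : \sum_al \sum_be (al == o)%:R * H al be * p al * p be = mxv H p o * p o.
    rewrite (bigD1 o)//= [X in _ + X]big1 ?addr0 => [|al /negbTE alo]; last first.
      by rewrite big1// => be _; rewrite alo !mul0r.
    by rewrite /mxv mulr_suml; apply: eq_bigr => be _; rewrite eqxx mul1r; ring.
  have B : \sum_al \sum_be (be == o)%:R * H al be * p al * p be = mxv H p o * p o.
    rewrite exchange_big -A /=; apply: eq_bigr => al _; apply: eq_bigr => be _.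
    by rewrite Hs; ring.
  have C : qform H p = \sum_al \sum_be H al be * p al * p be.
    by apply: eq_bigr => al _; rewrite mulr_sumr; apply: eq_bigr => be _; ring.
  rewrite (_ : \sum_al \sum_be _ = mxv H p o * p o + mxv H p o * p o - qform H p).
    by field.
  rewrite -{1}A -B C -big_split -sumrB /=; apply: eq_bigr => al _.
  by rewrite -big_split -sumrB /=; apply: eq_bigr => be _; ring.
rewrite normrM ger0_norm ?invr_ge0//.
have -> : 4^-1 * q ^+ 2 = 2^-1 * (1 / 2 * q ^+ 2) by field.
rewrite ler_wpM2l ?invr_ge0//; apply: le_trans (ler_wpM2r (sqr_ge0 _) Hh).
apply: le_trans (ler_norm_sum _ _ _) _; rewrite mulr_suml; apply: ler_sum => al _.
apply: le_trans (ler_norm_sum _ _ _) _; rewrite mulr_suml; apply: ler_sum => be _.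
rewrite !normrM -mulrA expr2 ler_pM//; first last.
  by apply: ler_pM.
rewrite -[leRHS]mul1r ler_wpM2r//.
by case: (al == o); case: (be == o); rewrite ?addr0 ?add0r ?subrr ?addrK ?sub0r ?normrN ?normr0 ?normr1.
Qed.

End current_algebra.

(** * Radial weights *)

Section weight.
Context {R : realType} (mu L : R).
Hypotheses (mu_gt0 : 0 < mu) (mu_lt : mu < 1 / 2) (L_ge1 : 1 <= L).
Implicit Types u s : R.

Ltac wlra := have ? := mu_gt0; have ? := mu_lt; have ? := L_ge1; lra.

(* With [u = r ^ 2] this is [f r / r] for the multiplier
   [f r = r ^ (2 mu) / (L ^ 2 + r ^ 2) ^ mu]. *)
Definition kw u : R := u `^ (- (1 / 2 - mu)) * (L ^+ 2 + u) `^ (- mu).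

(** Minus the logarithmic derivative of [kw]. *)
Definition kv u : R := (1 / 2 - mu) / u + mu / (L ^+ 2 + u).

Definition kw1 u : R := - (kw u * kv u).

Definition kw2 u : R :=
  kw u * (kv u ^+ 2 + (1 / 2 - mu) / u ^+ 2 + mu / (L ^+ 2 + u) ^+ 2).

(** The distance of [kw] from the borderline decay: [u * kv u] is [1 / 2 - mu * kdel u]. It is at
    least 1/2 for [u <= L ^ 2] and decays like [L ^ 2 / u] beyond, which localises the bulk estimate
    in [r <= L]. *)
Definition kdel u : R := L ^+ 2 / (L ^+ 2 + u).

Lemma is_derive_powR b u : 0 < u ->
  is_derive u (1 : R) (fun u => u `^ b) (b * u `^ b / u).
Proof.
move=> u0; have ui : u \in `]0, +oo[ by rewrite in_itv /= u0.
have D : derivable (fun u => u `^ b) u 1 by exact: derivable_powR.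
have -> : b * u `^ b / u = 'D_1 (fun u => u `^ b) u.
  rewrite -derive1E powR_derive1// powRB ?powRr1 ?ltW ?mulrA//.
  by apply/implyP => _; rewrite gt_eqF.
exact: derivableP.
Qed.

Let L0 u : 0 <= u -> 0 < L ^+ 2 + u.
Proof. by move=> u0; rewrite ltr_pwDl// exprn_gt0// (lt_le_trans _ L_ge1). Qed.

Lemma kw_gt0 u : 0 < u -> 0 < kw u.
Proof. by move=> u0; rewrite mulr_gt0// powR_gt0// L0// ltW. Qed.

Lemma is_derive_kw u : 0 < u -> is_derive u (1 : R) kw (kw1 u).
Proof.
move=> u0; have Lu := L0 (ltW u0).
have D1 := is_derive_powR (- (1 / 2 - mu)) u0.
have DL : is_derive u (1 : R) (fun u => L ^+ 2 + u) (0 + 1).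
  exact: (is_deriveD_fun (is_derive_cst (L ^+ 2) u 1) (is_derive_id u 1)).
have D2 := is_derive_comp_fun (is_derive_powR (- mu) Lu) DL.
apply: is_derive_eq (is_deriveM_fun D1 D2) _.
rewrite /kw1 /kw /kv; field.
by rewrite !gt_eqF.
Qed.

Lemma is_derive_kw1 u : 0 < u -> is_derive u (1 : R) kw1 (kw2 u).
Proof.
move=> u0; have Lu := L0 (ltW u0).
have Dk := is_derive_kw u0.
have Dinv : is_derive u (1 : R) (fun u : R => u^-1) (- u ^- 2 * 1).
  by apply: is_deriveV; rewrite ?gt_eqF//; exact: is_derive_id.
have DL : is_derive u (1 : R) (fun u => L ^+ 2 + u) (0 + 1).
  exact: (is_deriveD_fun (is_derive_cst (L ^+ 2) u 1) (is_derive_id u 1)).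
have DLinv : is_derive u (1 : R) (fun u : R => (L ^+ 2 + u)^-1)
    (- (L ^+ 2 + u) ^- 2 * (0 + 1)).
  by apply: is_deriveV; rewrite ?gt_eqF.
have Dv := is_deriveD_fun (is_deriveMl_fun (1 / 2 - mu) Dinv)
  (is_deriveMl_fun mu DLinv).
apply: is_derive_eq (is_deriveN (is_deriveM_fun Dk Dv)) _.
rewrite /kw2 /kw1 /kv; field.
by rewrite !gt_eqF.
Qed.

Lemma is_derive_continuous (f : R -> R) u a : is_derive u (1 : R) f a ->
  {for u, continuous f}.
Proof.
by move=> Df; apply/differentiable_continuous/derivable1_diffP; exact: ex_derive.
Qed.

Lemma continuous_kw u : 0 < u -> {for u, continuous kw}.
Proof. by move/is_derive_kw/is_derive_continuous. Qed.

Lemma continuous_kw1 u : 0 < u -> {for u, continuous kw1}.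
Proof. by move/is_derive_kw1/is_derive_continuous. Qed.

Lemma continuous_kw2 u : 0 < u -> {for u, continuous kw2}.
Proof.
move=> u0; have Lu := L0 (ltW u0).
have cid : {for u, continuous (fun u : R => u)} by exact: cvg_id.
have cL : {for u, continuous (fun u : R => L ^+ 2 + u)}.
  by apply: continuousD; [exact: cst_continuous|exact: cvg_id].
have cV (f : R -> R) b : f u != 0 -> {for u, continuous f} ->
    {for u, continuous (fun u => b / f u)}.
  move=> f0 cf; apply: continuousM; first exact: cst_continuous.
  exact: continuousV.
have cM (f g : R -> R) : {for u, continuous f} -> {for u, continuous g} ->
    {for u, continuous (fun u => f u * g u)} by exact: continuousM.
have ckv : {for u, continuous kv}.
  by apply: continuousD; apply: cV => //; rewrite gt_eqF.
apply: (cM kw); first exact: continuous_kw.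
apply: continuousD; first apply: continuousD.
- exact: (cM kv kv).
- apply: (cV (fun u => u ^+ 2)); first by rewrite gt_eqF// exprn_gt0.
  exact: (cM (fun u : R => u) (fun u : R => u)).
- apply: (cV (fun u => (L ^+ 2 + u) ^+ 2)); first by rewrite gt_eqF// exprn_gt0.
  exact: (cM (fun u : R => L ^+ 2 + u) (fun u : R => L ^+ 2 + u)).
Qed.

Lemma kv_gt0 u : 0 < u -> 0 < kv u.
Proof.
move=> u0; have Lu := L0 (ltW u0).
by apply: addr_gt0; apply: divr_gt0 => //; wlra.
Qed.

Lemma kdel_bound u : 0 < u -> 0 < kdel u <= 1.
Proof.
move=> u0; have Lu := L0 (ltW u0).
have LL : 0 < L ^+ 2 by rewrite exprn_gt0//; wlra.
rewrite /kdel divr_gt0//= ler_pdivrMr// mul1r; wlra.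
Qed.

Lemma ukvE u : 0 < u -> u * kv u = 1 / 2 - mu * kdel u.
Proof.
move=> u0; have Lu := L0 (ltW u0).
by rewrite /kv /kdel; field; rewrite !gt_eqF.
Qed.

Lemma ukv_le u : 0 < u -> u * kv u <= 1 / 2.
Proof.
move=> u0; rewrite ukvE// lerBlDr lerDl; have /andP[d0 _] := kdel_bound u0.
by rewrite mulr_ge0// ltW.
Qed.

Lemma kw1_le0 u : 0 < u -> kw1 u <= 0.
Proof. by move=> u0; rewrite oppr_le0 mulr_ge0// ltW// ?kw_gt0 ?kv_gt0. Qed.

Lemma kw1_norm u : 0 < u -> `|kw1 u| <= 2^-1 * kw u / u.
Proof.
move=> u0; rewrite normrN gtr0_norm ?(mulr_gt0 (kw_gt0 u0) (kv_gt0 u0))//.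
rewrite ler_pdivlMr// -mulrA mulrC ler_wpM2r ?(ltW (kw_gt0 u0))//.
by have := ukv_le u0; rewrite mulrC; wlra.
Qed.

(** For [s = r ^ 2] and [u = r ^ 2 + eps] the right side is the radial derivative of [r * k]. The
    bound follows from [s <= u] and the identity [ukvE]. *)
Lemma kw_radial u s : 0 < u -> 0 <= s <= u ->
  2 * mu * (kdel u * kw u) <= kw u + 2 * kw1 u * s.
Proof.
move=> u0 /andP[s0 su].
have k0 := kw_gt0 u0; have v0 := kv_gt0 u0; have E := ukvE u0.
have : kw u * (s * kv u) <= kw u * (1 / 2 - mu * kdel u).
  by rewrite (ler_wpM2l (ltW k0))// -E (ler_wpM2r (ltW v0)).
by rewrite /kw1; wlra.
Qed.

(* [4 s k'' + 2 n k'] is the Laplacian of [k (|x| ^ 2 + eps)]. *)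
Lemma kw_laplacian u s (m : R) : 0 < u -> 0 <= s <= u -> 3 <= m ->
  2 * kw2 u * s + m * kw1 u <= - (mu * (1 - 2 * mu)) * (kdel u * kw u) / u.
Proof.
move=> u0 /andP[s0 su] m3; have Lu := L0 (ltW u0).
have k0 := kw_gt0 u0; have v0 := kv_gt0 u0.
have /andP[d0 d1] := kdel_bound u0.
have k20 : 0 <= kw2 u.
  apply: mulr_ge0; first exact: ltW.
  apply: addr_ge0; last by apply: divr_ge0; rewrite ?sqr_ge0 ?(ltW mu_gt0).
  by apply: addr_ge0; rewrite ?sqr_ge0// divr_ge0 ?sqr_ge0//; wlra.
(* As [kw] is convex and decreasing, the worst case is [s = u] and [m = 3]. *)
have h1 : 2 * kw2 u * s + m * kw1 u <= 2 * kw2 u * u + 3 * kw1 u.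
  apply: lerD; first by rewrite ler_wpM2l// mulr_ge0.
  by rewrite ler_wnM2r// kw1_le0.
apply: le_trans h1 _.
pose d := kdel u.
(* In terms of [d] the bracket is affine, and [d <= 1] gives
   [3 - 2 * mu * d - 2 * d >= 1 - 2 * mu]. *)
have E : 2 * kw2 u * u + 3 * kw1 u =
    kw u / u * (- (mu * d) * (3 - 2 * mu * d - 2 * d)).
  by rewrite /kw2 /kw1 /kv /d /kdel; field; rewrite !gt_eqF.
rewrite E.
have -> : - (mu * (1 - 2 * mu)) * (kdel u * kw u) / u =
    kw u / u * (- (mu * d) * (1 - 2 * mu)) by rewrite /d; ring.
rewrite (ler_wpM2l (divr_ge0 (ltW k0) (ltW u0)))//.
have md : 0 <= mu * d by rewrite mulr_ge0// ltW.
rewrite ler_wnM2l ?oppr_le0//.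
have : mu * d <= mu by rewrite -[leRHS]mulr1 (ler_wpM2l (ltW mu_gt0)).
by rewrite -/d in d1 *; wlra.
Qed.

(** [kw] decreases in [u] and in [L], so its value at [u = s] and [L = 1] bounds it for every scale
    and every regularisation. With [s = r ^ 2] this value is the weight on the right of the
    theorem. *)
Lemma kw_le u s : 0 < s <= u ->
  kw u <= (s `^ (1 / 2 - mu) * (1 + s) `^ mu)^-1.
Proof.
move=> /andP[s0 su]; have u0 := lt_le_trans s0 su.
have LL : 1 <= L ^+ 2 by rewrite exprn_ege1.
have a0 : 0 <= 1 / 2 - mu by wlra.
rewrite /kw !powRN -invfM lef_pV2 ?posrE ?mulr_gt0 ?powR_gt0//; try wlra.
apply: ler_pM; rewrite ?powR_ge0//; apply: ge0_ler_powR; rewrite ?nnegrE; wlra.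
Qed.

(** The field [k x] has length at most 1, which lets its flux be bounded by the energy. It comes
    from [r = s ^ (1 / 2 - mu) * s ^ mu] with [s = r ^ 2]. *)
Lemma kw_sqrt_le u r : 0 < u -> 0 <= r -> r ^+ 2 <= u -> kw u * r <= 1.
Proof.
move=> u0 r0 ru; have [->|rn0] := eqVneq r 0; first by rewrite mulr0.
have {rn0}r0 : 0 < r by rewrite lt_neqAle eq_sym rn0.
have s0 : 0 < r ^+ 2 by rewrite exprn_gt0.
apply: le_trans (ler_wpM2r (ltW r0) (kw_le (u := u) (s := r ^+ 2) _)) _.
  by rewrite s0.
rewrite mulrC ler_pdivrMr ?mul1r ?mulr_gt0 ?powR_gt0//; last wlra.
have rE : r = (r ^+ 2) `^ (2^-1 - mu) * (r ^+ 2) `^ mu.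
  rewrite -powRD; last by apply/implyP => _; rewrite gt_eqF.
  have -> : 2^-1 - mu + mu = 2^-1 :> R by wlra.
  by rewrite powR12_sqrt ?sqr_ge0// sqrtr_sqr gtr0_norm.
rewrite {1}rE ler_wpM2l ?powR_ge0//; apply: ge0_ler_powR; rewrite ?nnegrE; wlra.
Qed.

End weight.

(** * Algebra of the radial multiplier *)

Section multiplier_algebra.
Context {R : realType} (I : finType) (o : I).
Implicit Types (p X e : I -> R) (H s : I -> I -> R) (dH : I -> I -> I -> R).

(** Lagrange's identity: the difference of the two sides is half the sum of the squares
    [(u i * v j - u j * v i) ^ 2]. *)
Lemma cauchy_schwarz_sum (J : finType) (u v : J -> R) :
  (\sum_i u i * v i) ^+ 2 <= (\sum_i u i ^+ 2) * (\sum_i v i ^+ 2).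
Proof.
have : 0 <= \sum_i \sum_j (u i * v j - u j * v i) ^+ 2.
  by apply: sumr_ge0 => i _; apply: sumr_ge0 => j _; exact: sqr_ge0.
have -> : \sum_i \sum_j (u i * v j - u j * v i) ^+ 2 =
    2 * ((\sum_i u i ^+ 2) * (\sum_i v i ^+ 2) - (\sum_i u i * v i) ^+ 2).
  pose a := \sum_i \sum_j u i ^+ 2 * v j ^+ 2.
  pose b := \sum_i \sum_j (u i * v i) * (u j * v j).
  have -> : (\sum_i u i ^+ 2) * (\sum_i v i ^+ 2) = a.
    by rewrite mulr_suml; apply: eq_bigr => i _; rewrite mulr_sumr.
  have -> : (\sum_i u i * v i) ^+ 2 = b.
    by rewrite expr2 mulr_suml; apply: eq_bigr => i _; rewrite mulr_sumr.
  have a' : a = \sum_i \sum_j u j ^+ 2 * v i ^+ 2 by rewrite /a exchange_big.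
  rewrite (_ : 2 * (a - b) = a + a - (b + b)); last by ring.
  rewrite {2}a' /a /b -!big_split -sumrB /=; apply: eq_bigr => i _.
  by rewrite -!big_split -sumrB /=; apply: eq_bigr => j _; ring.
by rewrite pmulr_rge0// subr_ge0.
Qed.

(** The Jacobian of [X = (0, x)]: a Kronecker symbol that vanishes on the time index [o]. *)
Definition dlt (al be : I) : R := (al == be)%:R * (al != o)%:R.

Definition mul_Y X (k : R) al : R := k * X al.

Definition mul_dY X (k k1 : R) al be : R := 2 * k1 * X al * X be + k * dlt al be.

(** There are [n + 1] indices, so this is [n - 1]. *)
Definition mul_m : R := #|I|%:R - 2.

Definition mul_w (k : R) : R := mul_m / 2 * k.

Definition mul_dw X (k1 : R) al : R := mul_m * k1 * X al.

Definition mul_ddw X (k1 k2 : R) al be : R :=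
  mul_m * (2 * k2 * X al * X be + k1 * dlt al be).

Lemma sum_dlt al (f : I -> R) : \sum_be dlt al be * f be = (al != o)%:R * f al.
Proof.
rewrite (bigD1 al)//= /dlt eqxx mul1r big1 ?addr0// => be /negbTE.
by rewrite eq_sym => ->; rewrite !mul0r.
Qed.

Lemma sum_dlt_diag (k : R) : \sum_al k * dlt al al = (#|I|%:R - 1) * k.
Proof.
rewrite (bigD1 o)//= /dlt eqxx /= mulr0 mulr0 add0r.
rewrite (eq_bigr (fun=> k)) => [|i io]; last by rewrite eqxx io !mulr1.
rewrite sumr_const -[LHS]mulr_natl; congr (_ * _).
have -> : #|[pred i | i != o]| = #|I|.-1 by rewrite -(cardC1 o); apply: eq_card.
by rewrite -subn1 natrB//; apply/card_gt0P; exists o.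
Qed.

(** The weight [(n - 1) k / 2] is the one for which [w - div Y / 2] loses its dependence on the
    dimension: it becomes [- k / 2 - k1 * |X| ^ 2]. *)
Lemma mul_main p X e (phi k k1 k2 : R) : X o = 0 ->
  (forall al, e al = if al == o then 1 else -1) ->
  (\sum_al e al * p al * (\sum_ga mul_dY X k k1 al ga * p ga) +
   (mul_w k - 2^-1 * \sum_al mul_dY X k k1 al al) * (\sum_al e al * p al ^+ 2)
   - 2^-1 * (phi ^+ 2 * \sum_al e al * mul_ddw X k1 k2 al al)) =
  - 2 * k1 * (\sum_al X al * p al) ^+ 2
  - k * (\sum_al p al ^+ 2 - p o ^+ 2)
  - (2^-1 * k + k1 * \sum_al X al ^+ 2) * (2 * p o ^+ 2 - \sum_al p al ^+ 2)
  + 2^-1 * mul_m * phi ^+ 2 *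
     (2 * k2 * (\sum_al X al ^+ 2) + (#|I|%:R - 1) * k1).
Proof.
move=> Xo eE.
have eX al : e al * X al = - X al.
  by rewrite eE; case: eqP => [->|_]; rewrite ?Xo ?mulr0 ?oppr0 ?mulN1r.
have ed al : e al * (al != o)%:R = - (al != o)%:R :> R.
  by rewrite eE; case: eqP => _; rewrite /= ?mulr0 ?oppr0 ?mulN1r.
have A al : \sum_ga mul_dY X k k1 al ga * p ga =
    2 * k1 * X al * (\sum_ga X ga * p ga) + k * ((al != o)%:R * p al).
  rewrite -sum_dlt !mulr_sumr -big_split /=; apply: eq_bigr => ga _.
  by rewrite /mul_dY; ring.
have S (f : I -> R) : \sum_al (al != o)%:R * f al = \sum_al f al - f o.
  rewrite (bigD1 o)//= eqxx mul0r add0r [in RHS](bigD1 o)//= addrAC subrr add0r.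
  by apply: eq_bigr => i ->; rewrite mul1r.
have -> : \sum_al e al * p al * (\sum_ga mul_dY X k k1 al ga * p ga) =
    - 2 * k1 * (\sum_al X al * p al) ^+ 2 - k * (\sum_al p al ^+ 2 - p o ^+ 2).
  rewrite -(S (fun al => p al ^+ 2)) [_ ^+ 2]expr2 mulrA !mulr_sumr -sumrB.
  rewrite [X in _ = X](eq_bigr (fun al => - 2 * k1 * (\sum_al X al * p al) * (X al * p al) -
    k * ((al != o)%:R * p al ^+ 2))); last first.
    by move=> i _; congr (_ - _); rewrite mulr_sumr.
  apply: eq_bigr => al _; rewrite A.
  transitivity (2 * k1 * (\sum_ga X ga * p ga) * p al * (e al * X al) +
    k * p al ^+ 2 * (e al * (al != o)%:R)); first by ring.
  by rewrite eX ed; ring.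
have -> : \sum_al mul_dY X k k1 al al =
    2 * k1 * (\sum_al X al ^+ 2) + (#|I|%:R - 1) * k.
  rewrite -sum_dlt_diag mulr_sumr -big_split /=.
  by apply: eq_bigr => i _; rewrite /mul_dY; ring.
have -> : \sum_al e al * p al ^+ 2 = 2 * p o ^+ 2 - \sum_al p al ^+ 2.
  have -> : 2 * p o ^+ 2 - \sum_al p al ^+ 2 =
    p o ^+ 2 - (\sum_al p al ^+ 2 - p o ^+ 2) by ring.
  rewrite -(S (fun al => p al ^+ 2)) (bigD1 o)//= [in RHS](bigD1 o)//= eE eqxx.
  rewrite mul0r add0r mul1r -sumrN; congr (_ + _); apply: eq_bigr => i io.
  by rewrite eE (negbTE io) mulN1r mul1r.
have -> : \sum_al e al * mul_ddw X k1 k2 al al =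
    - mul_m * (2 * k2 * (\sum_al X al ^+ 2) + (#|I|%:R - 1) * k1).
  rewrite -sum_dlt_diag mulr_sumr -big_split mulr_sumr /=.
  apply: eq_bigr => i _; rewrite /mul_ddw.
  transitivity (mul_m * (2 * k2 * X i * (e i * X i) +
     k1 * (i == i)%:R * (e i * (i != o)%:R))); first by rewrite /dlt; ring.
  by rewrite eX ed /dlt; ring.
by rewrite /mul_w /mul_m; field.
Qed.

Section coercive.
Variables (mu L u : R).
Hypotheses (mu_gt0 : 0 < mu) (mu_lt : mu < 1 / 2) (L_ge1 : 1 <= L) (u_gt0 : 0 < u).
Hypothesis card_ge4 : (4 <= #|I|)%N.

Let k := kw mu L u.
Let k1 := kw1 mu L u.
Let k2 := kw2 mu L u.
Let c : R := #|I|%:R.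

(** As [k1 <= 0], Cauchy-Schwarz bounds the radial derivative by the spatial gradient. The
    coefficients of [p o ^ 2] then cancel, leaving [- (k + 2 k1 s) / 2] times the whole of
    [|p| ^ 2], to which [kw_radial] applies. The term in [phi ^ 2] is estimated by [kw_laplacian],
    where [n >= 3] enters. *)
Lemma mul_coercive p X e (phi q : R) : X o = 0 ->
  (forall al, e al = if al == o then 1 else -1) ->
  \sum_al X al ^+ 2 <= u -> q ^+ 2 = \sum_al p al ^+ 2 ->
  \sum_al e al * p al * (\sum_ga mul_dY X k k1 al ga * p ga) +
   (mul_w k - 2^-1 * \sum_al mul_dY X k k1 al al) * (\sum_al e al * p al ^+ 2)
   - 2^-1 * (phi ^+ 2 * \sum_al e al * mul_ddw X k1 k2 al al) <=
  - (mu * (1 - 2 * mu) * (kdel L u * k) * (q ^+ 2 + phi ^+ 2 / u)).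
Proof.
move=> Xo eE Xu qE; rewrite mul_main//.
set s := \sum_al X al ^+ 2 in Xu *.
have s0 : 0 <= s by apply: sumr_ge0 => i _; exact: sqr_ge0.
have su : 0 <= s <= u by rewrite s0.
have k0 : 0 < k by exact: kw_gt0.
have k1le : k1 <= 0 by exact: kw1_le0.
have /andP[d0 d1] := kdel_bound mu_gt0 mu_lt L_ge1 u_gt0.
have c4 : 4 <= c by rewrite /c ler_nat.
have rad := kw_radial mu_gt0 mu_lt L_ge1 u_gt0 su.
have c3 : 3 <= c - 1 by lra.
have lap := kw_laplacian mu_gt0 mu_lt L_ge1 u_gt0 su c3.
rewrite -/k -/k1 -/k2 in rad lap.
set p0 := p o ^+ 2; set P := \sum_al p al ^+ 2; set xp := \sum_al X al * p al.
rewrite qE -/P.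
have p0P : p0 <= P.
  rewrite /P (bigD1 o)//= lerDl; apply: sumr_ge0 => i _; exact: sqr_ge0.
have CS : xp ^+ 2 <= s * (P - p0).
  pose v al := if al == o then 0 else p al.
  have -> : xp = \sum_al X al * v al.
    by apply: eq_bigr => al _; rewrite /v; case: eqP => // ->; rewrite Xo !mul0r.
  have -> : P - p0 = \sum_al v al ^+ 2.
    rewrite /P (bigD1 o)//= [in RHS](bigD1 o)//= /v eqxx expr0n /= add0r.
    rewrite addrAC subrr add0r; apply: eq_bigr => i /negbTE -> //.
  exact: cauchy_schwarz_sum.
have A1 : - 2 * k1 * xp ^+ 2 <= - 2 * k1 * (s * (P - p0)).
  by apply: ler_wpM2l => //; lra.
have dk : 0 <= kdel L u * k by rewrite mulr_ge0// ltW.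
have dkP : 0 <= kdel L u * k * P.
  by rewrite mulr_ge0// (le_trans (sqr_ge0 (p o)) p0P).
have f0 : 0 <= phi ^+ 2 by exact: sqr_ge0.
have A2 : 2^-1 * mul_m * phi ^+ 2 * (2 * k2 * s + (c - 1) * k1) <=
    - (mu * (1 - 2 * mu) * (kdel L u * k) * (phi ^+ 2 / u)).
  (* Equality holds for [n = 3]. *)
  have m2 : 1 <= 2^-1 * mul_m by rewrite /mul_m -/c; lra.
  have lapneg : 2 * k2 * s + (c - 1) * k1 <= 0.
    apply: le_trans lap _.
    rewrite !mulNr oppr_le0 divr_ge0 ?(ltW u_gt0)//; apply: mulr_ge0 => //.
    by apply: mulr_ge0; have := mu_gt0; have := mu_lt; lra.
  apply: (@le_trans _ _ (phi ^+ 2 * (2 * k2 * s + (c - 1) * k1))).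
    by rewrite -mulrA ler_neMl// mulr_ge0_le0.
  have -> : - (mu * (1 - 2 * mu) * (kdel L u * k) * (phi ^+ 2 / u)) =
    phi ^+ 2 * (- (mu * (1 - 2 * mu)) * (kdel L u * k) / u) by ring.
  exact: ler_wpM2l.
have A3 : (2 * mu * (kdel L u * k)) * P <= (k + 2 * k1 * s) * P.
  by apply: ler_wpM2r rad; exact: le_trans (sqr_ge0 (p o)) p0P.
have A4 : 0 <= mu ^+ 2 * (kdel L u * k * P) by rewrite mulr_ge0// sqr_ge0.
have -> : - (mu * (1 - 2 * mu) * (kdel L u * k) * (P + phi ^+ 2 / u)) =
   - (mu * (1 - 2 * mu) * (kdel L u * k) * (phi ^+ 2 / u)) -
   mu * (kdel L u * k * P) + 2 * (mu ^+ 2 * (kdel L u * k * P)) by ring.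
apply: (@le_trans _ _ (- 2 * k1 * (s * (P - p0)) - k * (P - p0) -
  (2^-1 * k + k1 * s) * (2 * p0 - P) +
  - (mu * (1 - 2 * mu) * (kdel L u * k) * (phi ^+ 2 / u)))).
  by apply: lerD => //; apply: lerD => //; apply: lerD.
rewrite addrC -[leRHS]addrA lerD2l.
have -> : - 2 * k1 * (s * (P - p0)) - k * (P - p0) -
  (2^-1 * k + k1 * s) * (2 * p0 - P) = - (2^-1 * ((k + 2 * k1 * s) * P)).
  by field.
lra.
Qed.

Variables (p X e : I -> R) (H : I -> I -> R) (phi q hh dh : R).
Variables (dH : I -> I -> I -> R).
Hypotheses (Xo : X o = 0) (eE : forall al, e al = if al == o then 1 else -1).
Hypotheses (Xu : \sum_al X al ^+ 2 <= u) (qE : q ^+ 2 = \sum_al p al ^+ 2).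
Hypothesis q_ge0 : 0 <= q.
Hypotheses (Hhh : forall al be, `|H al be| <= hh).
Hypotheses (dHdh : forall al be ga, `|dH al be ga| <= dh).
Hypothesis H_half : \sum_al \sum_be `|H al be| <= 1 / 2.

Let r := Num.sqrt (\sum_al X al ^+ 2).
Let th := k * r / u.

Let r0 : 0 <= r. Proof. exact: sqrtr_ge0. Qed.
Let k0 : 0 < k. Proof. exact: kw_gt0. Qed.
Let c1 : 1 <= c. Proof. by rewrite ler1n (leq_trans _ card_ge4). Qed.
Let th0 : 0 <= th. Proof. by rewrite divr_ge0 ?(ltW u_gt0)// mulr_ge0 ?(ltW k0). Qed.
Let r2 : r ^+ 2 <= u.
Proof. by rewrite sqr_sqrtr// sumr_ge0// => i _; exact: sqr_ge0. Qed.
Let m0 : 0 <= mul_m <= c.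
Proof.
have : 4 <= c by rewrite ler_nat.
by rewrite /mul_m -/c => ?; apply/andP; split; lra.
Qed.

Let Xr al : `|X al| <= r. Proof. exact: (le_eucl X al). Qed.

Let pq al : `|p al| <= q.
Proof.
have -> : q = eucl p by rewrite /eucl -qE sqrtr_sqr ger0_norm.
exact: le_eucl.
Qed.

Let kr : k * r <= 1. Proof. exact: kw_sqrt_le. Qed.

Let k1n : `|k1| <= 2^-1 * k / u. Proof. exact: kw1_norm. Qed.

Let Yb al : `|mul_Y X k al| <= k * r.
Proof. by rewrite normrM gtr0_norm// ler_wpM2l// ltW. Qed.

Let dlt1 al be : `|dlt al be| <= 1.
Proof. by rewrite /dlt; case: (al == be); case: (al != o);
  rewrite /= ?mulr0 ?mul0r ?mulr1 ?normr0 ?normr1. Qed.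

Let dYb al be : `|mul_dY X k k1 al be| <= 2 * k.
Proof.
apply: le_trans (ler_normD _ _) _.
have -> : 2 * k = k + k by ring.
apply: lerD; last by rewrite normrM gtr0_norm// ger_pMr.
rewrite !normrM ger0_norm//.
apply: (@le_trans _ _ (2 * (2^-1 * k / u) * r * r)).
  by apply: ler_pM => //; apply: ler_pM => //; rewrite ?mulr_ge0// ler_wpM2l.
have -> : 2 * (2^-1 * k / u) * r * r = k * (r ^+ 2 / u) by field; rewrite gt_eqF.
by rewrite ger_pMr// ler_pdivrMr// mul1r.
Qed.

Let wb : `|mul_w k| <= c / 2 * k.
Proof.
case/andP: m0 => m00 mc.
rewrite /mul_w ger0_norm; last by rewrite mulr_ge0 ?(ltW k0)// divr_ge0.
by rewrite ler_wpM2r ?(ltW k0)// ler_wpM2r// invr_ge0.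
Qed.

Let dwb al : `|mul_dw X k1 al| <= c * th.
Proof.
case/andP: m0 => m00 mc.
rewrite /mul_dw !normrM (ger0_norm m00) -mulrA; apply: ler_pM => //.
apply: (@le_trans _ _ (2^-1 * k / u * r)); first exact: ler_pM.
have -> : 2^-1 * k / u * r = 2^-1 * th by rewrite /th; ring.
by rewrite ler_piMl//; lra.
Qed.

Lemma mul_N_bound : `|\sum_ga mul_Y X k ga * p ga + mul_w k * phi| <=
  c * (q + k * `|phi|).
Proof.
apply: le_trans (ler_normD _ _) _; rewrite mulrDr; apply: lerD.
  apply: ler_norm_sum_card => al; rewrite normrM -[leRHS]mul1r; apply: ler_pM => //.
  exact: le_trans (Yb al) kr.
rewrite normrM mulrA; apply: ler_wpM2r => //; apply: le_trans wb _.
by apply: ler_wpM2r; [exact: ltW|have := c1; lra].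
Qed.

(** In the unweighted term [Y] is bounded by 1; where [h] itself occurs a factor [k] or [th] is
    kept, as these become the weights of the theorem. The coefficients found are 3/2, 1, 7/2 and 1,
    all below 4. *)
Lemma mul_err_bound :
  `|current_err H dH p (mul_Y X k) (mul_dY X k k1) (mul_w k) phi (mul_dw X k1)| <=
  4 * c ^+ 3 * (dh * q ^+ 2 + dh * (`|phi| * q) * k + hh * q ^+ 2 * k +
    hh * (`|phi| * q) * th).
Proof.
have Y1 al : `|mul_Y X k al| <= 1 by exact: le_trans (Yb al) kr.
apply: le_trans (current_err_bound Hhh dHdh pq Y1 dYb wb dwb mul_N_bound) _.
have hh0 : 0 <= hh by apply: le_trans (Hhh o o).
have dh0 : 0 <= dh by apply: le_trans (dHdh o o o).
have c0 : 0 <= c by apply: le_trans c1.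
have t1 : 0 <= c ^+ 3 * (dh * q ^+ 2).
  by apply: mulr_ge0; [exact: exprn_ge0|rewrite mulr_ge0// !mulr_ge0].
have t2 : 0 <= c ^+ 3 * (dh * (`|phi| * q) * k).
  by rewrite !mulr_ge0 ?exprn_ge0 ?powR_ge0.
have t3 : 0 <= c ^+ 3 * (hh * q ^+ 2 * k).
  by rewrite !mulr_ge0 ?exprn_ge0 ?powR_ge0.
have t4 : 0 <= c ^+ 3 * (hh * (`|phi| * q) * th).
  by apply: mulr_ge0; [exact: exprn_ge0|rewrite mulr_ge0// !mulr_ge0].
rewrite -/c.
have -> : c ^+ 2 * (dh * q) * (c * (q + k * `|phi|)) + c ^+ 3 * (hh * (2 * k) * q ^+ 2) +
  c ^+ 2 * (hh * q * (c * th)) * `|phi| +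
  (c / 2 * k + 2^-1 * (c * (2 * k))) * (c ^+ 2 * (hh * q ^+ 2)) +
  2^-1 * (c ^+ 3 * (1 * dh * q ^+ 2)) =
  3 / 2 * (c ^+ 3 * (dh * q ^+ 2)) + c ^+ 3 * (dh * (`|phi| * q) * k) +
  7 / 2 * (c ^+ 3 * (hh * q ^+ 2 * k)) + c ^+ 3 * (hh * (`|phi| * q) * th).
  by field.
have -> : 4 * c ^+ 3 * (dh * q ^+ 2 + dh * (`|phi| * q) * k + hh * q ^+ 2 * k +
    hh * (`|phi| * q) * th) =
  4 * (c ^+ 3 * (dh * q ^+ 2)) + 4 * (c ^+ 3 * (dh * (`|phi| * q) * k)) +
  4 * (c ^+ 3 * (hh * q ^+ 2 * k)) + 4 * (c ^+ 3 * (hh * (`|phi| * q) * th)) by ring.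
lra.
Qed.

(** By [kw_sqrt_le] with [r = sqrt u], [k * |phi|] is at most [|phi| / sqrt u], and [th] is at most
    [1 / u]. The flux is thus controlled by a density that the energy and Hardy's inequality
    bound. *)
Lemma mul_current_bound al :
  `|current_val (mink e H) p (mul_Y X k) (mul_w k) phi (mul_dw X k1) e al| <=
  3 * c * (q ^+ 2 + phi ^+ 2 / u).
Proof.
have e1 be : `|e be| = 1 by rewrite eE; case: ifP; rewrite ?normrN normr1.
have gb : `|mxv (mink e H) p al| <= 3 / 2 * q.
  rewrite mxv_mink; apply: le_trans (ler_normD _ _) _.
  rewrite normrM e1 mul1r; have := pq al; have := mxv_half al H_half pq; lra.
have Qb : `|qform (mink e H) p| <= 3 / 2 * q ^+ 2.
  rewrite qform_mink; apply: le_trans (ler_normD _ _) _.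
  have : `|\sum_al e al * p al ^+ 2| <= q ^+ 2.
    rewrite qE; apply: le_trans (ler_norm_sum _ _ _) _; apply: ler_sum => be _.
    by rewrite normrM e1 mul1r ger0_norm ?sqr_ge0.
  have := qform_half H_half pq; lra.
pose v := `|phi| / Num.sqrt u.
have su : 0 < Num.sqrt u by rewrite sqrtr_gt0.
have v0 : 0 <= v by rewrite divr_ge0// ltW.
have v2 : phi ^+ 2 / u = v ^+ 2.
  by rewrite /v expr_div_n sqr_sqrtr ?(ltW u_gt0)// -normrX ger0_norm ?sqr_ge0.
have kv' : k * `|phi| <= v.
  rewrite /v ler_pdivlMr// mulrAC ler_piMl//; apply: kw_sqrt_le => //.
  by rewrite sqr_sqrtr// ltW.
have qv : q * v <= 2^-1 * (q ^+ 2 + v ^+ 2).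
  by have := sqr_ge0 (q - v); rewrite sqrrB; lra.
have thu : th <= u^-1 by rewrite /th -[leRHS]mul1r ler_wpM2r// invr_ge0 ltW.
have c0 : 0 <= c by apply: le_trans c1.
have b1 : `|mxv (mink e H) p al * (\sum_ga mul_Y X k ga * p ga + mul_w k * phi)| <=
    c * (3 / 2 * q ^+ 2 + 3 / 4 * (q ^+ 2 + v ^+ 2)).
  rewrite normrM; apply: le_trans (ler_pM _ _ gb mul_N_bound) _ => //.
  rewrite mulrCA ler_wpM2l// mulrDr; apply: lerD; first by rewrite expr2 mulrA.
  apply: le_trans (_ : 3 / 2 * (q * v) <= _); last by lra.
  rewrite -[leLHS]mulrA; apply: ler_wpM2l; first lra.
  exact: ler_wpM2l.
have b2 : `|2^-1 * (mul_Y X k al * qform (mink e H) p)| <= c * (3 / 4 * q ^+ 2).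
  have q2 : 0 <= q ^+ 2 by exact: sqr_ge0.
  apply: (@le_trans _ _ (1 * (3 / 4 * q ^+ 2))); last by rewrite ler_wpM2r//; lra.
  rewrite normrM ger0_norm ?invr_ge0// normrM mul1r.
  apply: (@le_trans _ _ (2^-1 * (1 * (3 / 2 * q ^+ 2)))); last by lra.
  rewrite ler_wpM2l ?invr_ge0//; apply: ler_pM => //.
  exact: le_trans (Yb al) kr.
have b3 : `|2^-1 * (phi ^+ 2 * (e al * mul_dw X k1 al))| <= c * (2^-1 * v ^+ 2).
  have -> : 2^-1 * (phi ^+ 2 * (e al * mul_dw X k1 al)) =
    (2^-1 * phi ^+ 2) * (e al * mul_dw X k1 al) by ring.
  have -> : c * (2^-1 * v ^+ 2) = (2^-1 * phi ^+ 2) * (c * u^-1) by rewrite -v2; ring.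
  have p2 : 0 <= 2^-1 * phi ^+ 2 by rewrite mulr_ge0 ?invr_ge0 ?sqr_ge0.
  rewrite [leLHS]normrM (ger0_norm p2) [X in _ * X <= _]normrM e1 mul1r.
  apply: ler_wpM2l => //.
  by apply: le_trans (dwb al) _; rewrite ler_wpM2l.
rewrite /current_val v2; apply: le_trans (ler_normB _ _) _.
apply: le_trans (lerD (ler_normB _ _) (lexx _)) _.
apply: le_trans (lerD (lerD b1 b2) b3) _.
have -> : 3 * c * (q ^+ 2 + v ^+ 2) = c * (3 * (q ^+ 2 + v ^+ 2)) by ring.
rewrite -!mulrDr ler_wpM2l//.
have := sqr_ge0 q; have := sqr_ge0 v; lra.
Qed.

End coercive.
End multiplier_algebra.

(** * Currents, coordinates and cutoffs *)

Ltac cont_step := lazymatch goal with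
  | |- continuous (fun z => (@?f z + @?g z)%R) => apply: (@continuousD_fun _ _ f g)
  | |- continuous (fun z => (- @?f z)%R) => apply: (@continuousN_fun _ _ f)
  | |- continuous (fun z => (@?f z * @?g z)%R) => apply: (@continuousM_fun _ _ f g)
  | |- continuous (fun z => (@?f z ^+ ?m)%R) => apply: (@continuousX_fun _ _ f m)
  | |- continuous (fun z => `|@?f z|%R) => apply: (@continuous_norm_fun _ _ f)
  | |- continuous (fun z => eucl _) => apply: continuous_eucl_fun => ?
  | |- continuous (fun z => (\sum_i _)%R) => apply: continuous_sum_fun => ?
  | |- continuous (fun _ => ?c) => exact: cst_continuous
  | |- _ => match goal with
    | H : continuous _ |- _ => exact: H
    | H : forall _, continuous _ |- _ => exact: H
    | H : forall _ _, continuous _ |- _ => exact: H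
    | H : forall _ _ _, continuous _ |- _ => exact: H
    end
  end.
Ltac cont := repeat cont_step.

Section current_fields.
Context {R : realType} {V : normedModType R} (I : finType).
Variables (G : I -> I -> V -> R) (p Y : I -> V -> R) (w phi : V -> R).
Variables (dw : I -> V -> R) (e : I -> R).

Let J al z := current_val (fun i j => G i j z) (p^~ z) (Y^~ z) (w z) (phi z)
  (dw^~ z) e al.

Lemma is_derive_current (dG : I -> I -> I -> R) (s dY ddw : I -> I -> R) al z v :
  (forall i j, is_derive z v (G i j) (dG al i j)) ->
  (forall i, is_derive z v (p i) (s al i)) ->
  (forall i, is_derive z v (Y i) (dY al i)) ->
  is_derive z v w (dw al z) -> is_derive z v phi (p al z) ->
  is_derive z v (dw al) (ddw al al) ->
  is_derive z v (J al) (current1_val (fun i j => G i j z) dG (p^~ z) s (Y^~ z) dY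
    (w z) (phi z) (dw^~ z) ddw e al).
Proof.
move=> DG Dp DY Dw Dphi Ddw.
have Dm i : is_derive z v (fun z => mxv (fun i j => G i j z) (p^~ z) i)
    (mxv1 (fun i j => G i j z) (dG al) (p^~ z) (s al) i).
  by apply: is_derive_sum_fun => j; exact: is_deriveM_fun.
have DN : is_derive z v (fun z => \sum_ga Y ga z * p ga z + w z * phi z)
    (\sum_ga (dY al ga * p ga z + Y ga z * s al ga) + (dw al z * phi z + w z * p al z)).
  apply: is_deriveD_fun; last exact: is_deriveM_fun.
  by apply: is_derive_sum_fun => j; exact: is_deriveM_fun.
have DQ : is_derive z v (fun z => qform (fun i j => G i j z) (p^~ z))
    (\sum_be (s al be * mxv (fun i j => G i j z) (p^~ z) be +
      p be z * mxv1 (fun i j => G i j z) (dG al) (p^~ z) (s al) be)).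
  by apply: is_derive_sum_fun => j; exact: is_deriveM_fun.
have D2 : is_derive z v (fun z => phi z ^+ 2) (p al z * phi z + phi z * p al z).
  have -> : (fun z => phi z ^+ 2) = (fun z => phi z * phi z).
    by apply/funext => y; rewrite expr2.
  exact: is_deriveM_fun.
rewrite /J /current_val /current1_val.
apply: is_deriveB_fun; first apply: is_deriveB_fun.
- exact: is_deriveM_fun.
- by apply: is_deriveMl_fun; exact: is_deriveM_fun.
- apply: is_deriveMl_fun; apply: is_deriveM_fun => //.
Qed.

Lemma continuous_current al :
  (forall i j, continuous (G i j)) -> (forall i, continuous (p i)) ->
  (forall i, continuous (Y i)) -> continuous w -> continuous phi ->
  (forall i, continuous (dw i)) -> continuous (J al).
Proof. by move=> cG cp cY cw cphi cdw; rewrite /J /current_val /qform /mxv; cont. Qed.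

Lemma continuous_current1 (dG : I -> I -> I -> V -> R)
    (s dY ddw : I -> I -> V -> R) al :
  (forall i j, continuous (G i j)) -> (forall i, continuous (p i)) ->
  (forall i, continuous (Y i)) -> continuous w -> continuous phi ->
  (forall i, continuous (dw i)) -> (forall k i j, continuous (dG k i j)) ->
  (forall i j, continuous (s i j)) -> (forall i j, continuous (dY i j)) ->
  (forall i j, continuous (ddw i j)) ->
  continuous (fun z => current1_val (fun i j => G i j z) (fun k i j => dG k i j z)
    (p^~ z) (fun i j => s i j z) (Y^~ z) (fun i j => dY i j z) (w z) (phi z)
    (dw^~ z) (fun i j => ddw i j z) e al).
Proof.
move=> cG cp cY cw cphi cdw cdG cs cdY cddw.
have cm i : continuous (fun z => mxv (fun i j => G i j z) (p^~ z) i).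
  by rewrite /mxv; cont.
have cm1 k i : continuous (fun z => mxv1 (fun i j => G i j z) (fun i j => dG k i j z)
    (p^~ z) ((fun i j => s i j z) k) i) by rewrite /mxv1; cont.
have cQ : continuous (fun z => qform (fun i j => G i j z) (p^~ z)).
  by rewrite /qform; cont.
by rewrite /current1_val; cont.
Qed.

End current_fields.

Section cutoff.
Context {R : realType} (n : nat).
Local Notation tx := (R * 'rV[R]_n)%type.

(** The time component is 0, so this is the field [X] of the multiplier, which must vanish on the
    time index. *)
Definition xcoord (al : 'I_n.+1) (z : tx) : R :=
  if unlift ord0 al is Some a then z.2 0 a else 0.

Definition xsq (z : tx) : R := \sum_al xcoord al z ^+ 2.

Lemma xcoord0 z : xcoord ord0 z = 0.
Proof. by rewrite /xcoord unlift_none. Qed.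

Lemma xcoord_lift a z : xcoord (lift ord0 a) z = z.2 0 a.
Proof. by rewrite /xcoord liftK. Qed.

Lemma xsqE z : xsq z = xnorm z.2 ^+ 2.
Proof.
rewrite /xsq big_ord_recl xcoord0 expr0n add0r /xnorm eucl_sqr.
by apply: eq_bigr => a _; rewrite xcoord_lift.
Qed.

Lemma xsq_ge0 z : 0 <= xsq z.
Proof. by rewrite xsqE sqr_ge0. Qed.

Lemma is_derive_affine (V : normedModType R) (f : V -> R) (z v : V) (d : R) :
  (forall h : R, f (h *: v + z) = f z + h * d) -> is_derive z v f d.
Proof.
move=> fE.
have D : is_derive (0 : R) (1 : R) (fun h : R => f z + h * d) (0 + (1 * d + 0 * 0)).
  by apply: is_deriveD_fun; apply: is_deriveM_fun.
have D' : is_derive (0 : R) (1 : R) (fun h : R => f z + h * d) d.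
  by apply: is_derive_eq D _; ring.
apply: is_derive_line D' => h.
by rewrite fE /GRing.scale /= mulr1 addr0.
Qed.

Lemma is_derive_xcoord al be z :
  is_derive z (tx_base be) (xcoord al) (dlt ord0 be al).
Proof.
apply: is_derive_affine => h.
rewrite /xcoord /dlt; case: (unliftP ord0 al) => [a|] ->.
  case: (unliftP ord0 be) => [b|] ->.
    rewrite tx_base_lift /= !mxE /= (inj_eq lift_inj) mulr1 [b == a]eq_sym.
    by rewrite addrC.
  by rewrite tx_base0 /= !mxE mulr0 add0r mul0r mulr0 addr0.
by case: eqP => _; rewrite /= ?mulr0 ?mul0r ?mulr0 ?addr0.
Qed.

Lemma is_derive_time al (z : tx) : is_derive z (tx_base al) fst ((al == ord0)%:R : R).
Proof.
apply: is_derive_affine => h; case: (unliftP ord0 al) => [a|] ->.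
  by rewrite tx_base_lift /= scaler0 add0r mulr0 addr0.
by rewrite tx_base0 /= addrC.
Qed.

Lemma continuous_xcoord al : continuous (xcoord al).
Proof.
case: (unliftP ord0 al) => [a|] ->; last first.
  have -> : xcoord ord0 = cst 0 by apply/funext => z; rewrite xcoord0.
  exact: cst_continuous.
have -> : xcoord (lift ord0 a) = (fun z : tx => z.2 0 a).
  by apply/funext => z; rewrite xcoord_lift.
move=> z; apply: (@continuous_comp _ _ _ snd (fun x : 'rV[R]_n => x 0 a)).
  exact: cvg_snd.
exact: coord_continuous.
Qed.

Lemma continuous_time : continuous (fst : tx -> R).
Proof. by move=> z; exact: cvg_fst. Qed.

Lemma is_derive_xsq al z : is_derive z (tx_base al) xsq (2 * xcoord al z).
Proof.
have D : is_derive z (tx_base al) (fun z => \sum_be xcoord be z * xcoord be z)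
    (\sum_be (dlt ord0 al be * xcoord be z + xcoord be z * dlt ord0 al be)).
  by apply: is_derive_sum_fun => be; apply: is_deriveM_fun; exact: is_derive_xcoord.
have -> : xsq = (fun z => \sum_be xcoord be z * xcoord be z).
  by apply/funext => y; apply: eq_bigr => be _; rewrite expr2.
apply: is_derive_eq D _.
rewrite (eq_bigr (fun be => 2 * (dlt ord0 al be * xcoord be z))) => [|be _]; last by ring.
rewrite -mulr_sumr sum_dlt; congr (_ * _).
by case: eqP => [->|_]; rewrite ?xcoord0 ?mulr0 ?mul1r.
Qed.

Lemma continuous_xsq : continuous xsq.
Proof. have cx := continuous_xcoord; rewrite /xsq; cont. Qed.

(** In [cutoff_flux] the loss [cspeed / rho * b / 4] has to cover [n + 1] fluxes of size
    [2 / rho * 3 / 2 * b], hence [12 (n + 1)]. *)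
Definition cspeed : R := 12 * n.+1%:R.

Section fixed_radius.
Variable rho : R.
Hypothesis rho_gt0 : 0 < rho.

Definition cutarg (z : tx) : R := xsq z / rho ^+ 2 + cspeed * z.1 / rho.

(* The support shrinks with speed at least [cspeed / 2], faster than the
   propagation speed of the equation. *)
Definition cutoff (z : tx) : R := Num.max 0 (1 - cutarg z) ^+ 2.

Definition dcutoff al (z : tx) : R := - (2 * Num.max 0 (1 - cutarg z)) *
  (2 * xcoord al z / rho ^+ 2 + cspeed * (al == ord0)%:R / rho).

Lemma cspeed_gt0 : 0 < cspeed.
Proof. by rewrite mulr_gt0. Qed.

Lemma is_derive_cutoff al z : is_derive z (tx_base al) cutoff (dcutoff al z).
Proof.
have D1 : is_derive z (tx_base al) (fun z => 1 - (rho ^- 2 * xsq z + cspeed / rho * z.1))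
    (0 - (rho ^- 2 * (2 * xcoord al z) + cspeed / rho * (al == ord0)%:R)).
  apply: is_deriveB_fun; apply: is_deriveD_fun; apply: is_deriveMl_fun; first exact: is_derive_xsq.
  exact: is_derive_time.
have E : (fun z => 1 - (rho ^- 2 * xsq z + cspeed / rho * z.1)) = (fun z => 1 - cutarg z).
  by apply/funext => y; rewrite /cutarg; congr (1 - _); ring.
rewrite E in D1.
apply: is_derive_eq (is_derive_comp_fun (is_derive_max0_sqr _) D1) _.
by rewrite /dcutoff; ring.
Qed.

Lemma continuous_cutarg : continuous cutarg.
Proof. have c1 := continuous_xsq; have c2 := continuous_time; rewrite /cutarg; cont. Qed.

Let cmax : continuous (fun z => Num.max 0 (1 - cutarg z)).
Proof.
have c1 := continuous_cutarg => z.
apply: (@continuous_comp _ _ _ (fun z => 1 - cutarg z) (Num.max 0)).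
  apply: (@continuousB_fun _ _ (fun=> 1) cutarg) => //.
  exact: cst_continuous.
exact: continuous_max0.
Qed.

Lemma continuous_cutoff : continuous cutoff.
Proof. have c1 := cmax; rewrite /cutoff; cont. Qed.

Lemma continuous_dcutoff al : continuous (dcutoff al).
Proof. have c1 := cmax; have c2 := continuous_xcoord; rewrite /dcutoff; cont. Qed.

Lemma cutarg_ge0 z : 0 <= z.1 -> 0 <= cutarg z.
Proof.
move=> z0; rewrite addr_ge0 ?divr_ge0 ?xsq_ge0 ?sqr_ge0 ?(ltW rho_gt0)//.
by rewrite mulr_ge0// ltW// cspeed_gt0.
Qed.

Lemma cutoff_ge0 z : 0 <= cutoff z.
Proof. exact: sqr_ge0. Qed.

Lemma max01 z : 0 <= z.1 -> 0 <= Num.max 0 (1 - cutarg z) <= 1.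
Proof.
move=> /cutarg_ge0 y0; rewrite le_max lexx /= ge_max ler01 /=; lra.
Qed.

Lemma cutoff_le1 z : 0 <= z.1 -> cutoff z <= 1.
Proof. by move=> /max01 /andP[h0 h1]; rewrite exprn_ile1. Qed.

(** Stated for the positive part rather than its square, because the former is also a factor of
    [dcutoff]. *)
Lemma cutoff_supp z : 0 <= z.1 -> Num.max 0 (1 - cutarg z) != 0 ->
  forall al, `|xcoord al z| <= rho.
Proof.
move=> z0; have [y1|y1] := leP (1 - cutarg z) 0; first by rewrite eqxx.
move=> _ al; rewrite -ler_sqr ?nnegrE ?(ltW rho_gt0)//.
have r2 : 0 < rho ^+ 2 by rewrite exprn_gt0.
have h : xsq z / rho ^+ 2 <= 1.
  have : 0 <= cspeed * z.1 / rho.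
    by rewrite divr_ge0 ?mulr_ge0 ?(ltW rho_gt0)// ltW// cspeed_gt0.
  by move: y1; rewrite /cutarg; lra.
rewrite ler_pdivrMr// mul1r in h; apply: le_trans h.
rewrite real_normK ?num_real// /xsq (bigD1 al)//= lerDl.
by apply: sumr_ge0 => i _; exact: sqr_ge0.
Qed.

Lemma cutoff_box z : 0 <= z.1 -> cutoff z != 0 -> box rho z.2.
Proof.
move=> z0; rewrite /cutoff expf_eq0 /= => /(cutoff_supp z0) h a.
by rewrite -xcoord_lift.
Qed.

(** For the radial multiplier and in Hardy's inequality the flux through the cutoff has no sign, and
    only its smallness of order [1 / rho] helps. *)
Lemma dcutoff_bound al z : 0 <= z.1 -> `|dcutoff al z| <= 2 * (2 + cspeed) / rho.
Proof.
move=> z0; have /andP[m0 m1] := max01 z0.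
have c0 := ltW cspeed_gt0.
rewrite /dcutoff; set m := Num.max 0 _ in m0 m1 *.
have [E|mn0] := eqVneq m 0.
  by rewrite E mulr0 oppr0 mul0r normr0 divr_ge0 ?mulr_ge0 ?addr_ge0 ?(ltW rho_gt0).
have h := cutoff_supp z0 mn0 al.
rewrite normrM normrN normrM (ger0_norm m0) (ger0_norm (ler0n R 2)).
have -> : 2 * (2 + cspeed) / rho = 2 * 1 * (2 * rho / rho ^+ 2 + cspeed / rho).
  by field; rewrite gt_eqF.
apply: ler_pM; rewrite ?mulr_ge0 ?ler_wpM2l//.
apply: le_trans (ler_normD _ _) _; apply: lerD.
  rewrite !normrM normfV normrX (gtr0_norm rho_gt0) ger0_norm//.
  by rewrite ler_wpM2r ?invr_ge0 ?sqr_ge0// ler_wpM2l.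
rewrite normrM [X in X * _ <= _]normrM normfV (gtr0_norm rho_gt0) (ger0_norm c0).
rewrite ler_wpM2r ?invr_ge0 ?(ltW rho_gt0)// ger_pMr ?cspeed_gt0//.
by case: eqP => _; rewrite ?normr0 ?normr1.
Qed.

(* On the support the outward flux through the cutoff is dominated by the
   energy lost through its shrinking. *)
Lemma cutoff_flux (j : 'I_n.+1 -> R) (b : R) z : 0 <= z.1 -> 0 <= b ->
  4^-1 * b <= j ord0 -> (forall al, `|j al| <= 3 / 2 * b) ->
  \sum_al dcutoff al z * j al <= 0.
Proof.
move=> z0 b0 j0 jb; have /andP[m0 m1] := max01 z0.
have c0 := cspeed_gt0.
rewrite /dcutoff; set m := Num.max 0 _ in m0 m1 *.
have [E|mn0] := eqVneq m 0.
  by rewrite big1// => al _; rewrite E mulr0 oppr0 !mul0r.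
have h := cutoff_supp z0 mn0.
have -> : \sum_al - (2 * m) * (2 * xcoord al z / rho ^+ 2 +
    cspeed * (al == ord0)%:R / rho) * j al =
   - (2 * m) * (cspeed / rho * j ord0 +
     \sum_al 2 * xcoord al z / rho ^+ 2 * j al).
  rewrite mulrDr mulr_sumr big_ord_recl [in RHS]big_ord_recl xcoord0 /=.
  have -> : - (2 * m) * (2 * 0 / rho ^+ 2 + cspeed * 1 / rho) * j ord0 =
    - (2 * m) * (cspeed / rho * j ord0) by ring.
  rewrite (_ : - (2 * m) * (2 * 0 / rho ^+ 2 * j ord0) = 0); last by ring.
  rewrite add0r; congr (_ + _).
  by apply: eq_bigr => a _; rewrite mulr0 mul0r addr0 -mulrA.
rewrite mulNr oppr_le0 mulr_ge0 ?mulr_ge0//.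
have : `|\sum_al 2 * xcoord al z / rho ^+ 2 * j al| <= n.+1%:R * (2 / rho * (3 / 2 * b)).
  rewrite -[n.+1 in leRHS]card_ord; apply: ler_norm_sum_card => al.
  rewrite normrM; apply: ler_pM => //.
  have -> : 2 / rho = 2 * rho / rho ^+ 2 by field; rewrite gt_eqF.
  rewrite !normrM normfV normrX (gtr0_norm rho_gt0) ger0_norm//.
  by rewrite ler_wpM2r ?invr_ge0 ?sqr_ge0// ler_wpM2l.
have : cspeed / rho * (4^-1 * b) <= cspeed / rho * j ord0.
  by rewrite ler_wpM2l// divr_ge0// ltW.
have -> : cspeed / rho * (4^-1 * b) = n.+1%:R * (2 / rho * (3 / 2 * b)).
  by rewrite /cspeed; field; rewrite gt_eqF.
by move=> h1; rewrite ler_norml => /andP[h2 _]; lra.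
Qed.

End fixed_radius.
End cutoff.

(** * The energy estimate *)

(** A bound uniform in [k] passes to the limit without domination, and [C] may be infinite. *)
Lemma fatou_le {R : realType} d (X : measurableType d)
    (m : {measure set X -> \bar R}) (D : set X) (g_ : nat -> X -> R) (g : X -> R)
    (C : \bar R) :
  measurable D -> (forall k, measurable_fun D (g_ k)) ->
  (forall k x, D x -> 0 <= g_ k x) ->
  (forall x, D x -> g_ k x @[k --> \oo] --> g x) ->
  (forall k, \int[m]_(x in D) (g_ k x)%:E <= C)%E ->
  (\int[m]_(x in D) (g x)%:E <= C)%E.
Proof.
move=> mD mg g0 gg gC.
have E x : D x -> limn_einf (fun k => (g_ k x)%:E) = (g x)%:E.
  move=> Dx; have : (g_ k x)%:E @[k --> \oo] --> (g x)%:E.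
    by apply: cvg_EFin; [exact: nearW|exact: gg].
  by move/cvg_limn_einf_sup => [-> _].
have -> : (\int[m]_(x in D) (g x)%:E =
    \int[m]_(x in D) limn_einf (fun k => (g_ k x)%:E))%E.
  by apply: eq_integral => x; rewrite inE => Dx; rewrite E.
apply: le_trans (fatou m mD (f := fun k x => (g_ k x)%:E) _ _) _.
- by move=> k; apply/measurable_EFinP; exact: mg.
- by move=> k x Dx; rewrite lee_fin g0.
rewrite limn_einf_lim; apply: lime_le; first exact: is_cvg_einfs.
apply: nearW => k; apply: le_trans (gC k).
by apply: ereal_inf_lbound; exists k => /=.
Qed.

Lemma cvg_cutoff_scaled {R : realType} n (z : R * 'rV[R]_n) (a : R) : 0 < a ->
  cutoff (a * k.+1%:R) z @[k --> \oo] --> (1 : R).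
Proof.
move=> a0.
(* As a function of the inverse radius the cutoff extends continuously to 0, with value 1. *)
pose G (r : R) : R := Num.max 0 (1 - (xsq z / a ^+ 2 * r ^+ 2 + cspeed n * z.1 / a * r)) ^+ 2.
have cG : continuous G.
  have cid : continuous (fun r : R => r) by move=> r; exact: cvg_id.
  have cm : continuous (fun r : R =>
      Num.max 0 (1 - (xsq z / a ^+ 2 * r ^+ 2 + cspeed n * z.1 / a * r))).
    have c1 : continuous (fun r : R =>
      1 - (xsq z / a ^+ 2 * r ^+ 2 + cspeed n * z.1 / a * r)) by cont.
    move=> r; apply: (@continuous_comp _ _ _
      (fun r : R => 1 - (xsq z / a ^+ 2 * r ^+ 2 + cspeed n * z.1 / a * r)) (Num.max 0)).
      exact: c1.
    exact: continuous_max0.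
  by rewrite /G; cont.
have -> : (fun k => cutoff (a * k.+1%:R) z) = G \o (@harmonic R).
  apply/funext => k /=; rewrite /G /cutoff /cutarg /harmonic /=.
  congr (Num.max 0 (1 - _) ^+ 2); field.
  by rewrite (gt_eqF a0) andbT addrC natr1 pnatr_eq0.
have -> : (1 : R) = G 0.
  by rewrite /G expr0n /= !mulr0 addr0 subr0 max_r// expr1n.
by apply: (cvg_comp _ _ (@cvg_harmonic R)); exact: cG.
Qed.

Lemma cvg_cutoff {R : realType} n (z : R * 'rV[R]_n) :
  cutoff k.+1%:R z @[k --> \oo] --> (1 : R).
Proof.
have := @cvg_cutoff_scaled R n z 1 ltr01.
by under eq_fun do rewrite mul1r.
Qed.

Section wave.
Context {R : realType} (n : nat).
Local Notation I := 'I_n.+1.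
Local Notation tx := (R * 'rV[R]_n)%type.
Local Notation N := (n.+1%:R : R).

Definition esgn (al : I) : R := if al == ord0 then 1 else -1.

(* [wphi], [wp], [ws], [wH], [wdH] stand for phi, its first and second
   derivatives, h and its first derivatives, all extended continuously from the
   slab to [R * 'rV_n], so that one-sided derivatives at [t = 0] and [t = T] are
   never needed. *)
Record wave_data (T : R) := WaveData {
  wphi : tx -> R;
  wp : I -> tx -> R;
  ws : I -> I -> tx -> R;
  wH : I -> I -> tx -> R;
  wdH : I -> I -> I -> tx -> R;
  wT : 0 < T;
  wcphi : continuous wphi;
  wcp : forall i, continuous (wp i);
  wcs : forall i j, continuous (ws i j);
  wcH : forall i j, continuous (wH i j);
  wcdH : forall i j k, continuous (wdH i j k);
  wDphi : forall al z, oslab T z -> is_derive z (tx_base al) wphi (wp al z);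
  wDp : forall al be z, oslab T z -> is_derive z (tx_base al) (wp be) (ws al be z);
  wDH : forall al i j z, oslab T z ->
    is_derive z (tx_base al) (wH i j) (wdH al i j z);
  wDphix : forall a t x, 0 <= t <= T ->
    is_derive x (ebase a) (fun y => wphi (t, y)) (wp (lift ord0 a) (t, x));
  wHsym : forall i j z, wH i j z = wH j i z;
  wssym : forall i j z, oslab T z -> ws i j z = ws j i z;
  wHhalf : forall z, \sum_i \sum_j `|wH i j z| <= 1 / 2;
  wL2 : forall t, 0 <= t <= T ->
    (\int[lebesgue_rV n]_x (wphi (t, x) ^+ 2)%:E < +oo)%E }.

Arguments wcphi {T} _ _ _.
Arguments wcp {T} _ _ _ _.
Arguments wcs {T} _ _ _ _ _.
Arguments wcH {T} _ _ _ _ _.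
Arguments wcdH {T} _ _ _ _ _ _.
Arguments wDphi {T} _ _ _ _.
Arguments wDp {T} _ _ _ _ _.
Arguments wDH {T} _ _ _ _ _ _.
Arguments wDphix {T} _ _ _ _ _.
Arguments wHsym {T} _ _ _ _.
Arguments wssym {T} _ _ _ _ _.
Arguments wHhalf {T} _ _.
Arguments wL2 {T} _ _ _.

Variables (T : R) (D : wave_data T).
Local Notation phi := (wphi D).
Local Notation p := (wp D).
Local Notation s := (ws D).
Local Notation H := (wH D).
Local Notation dH := (wdH D).

Definition wq (z : tx) : R := eucl (fun i => p i z).
Definition whh (z : tx) : R := eucl (fun ij : I * I => H ij.1 ij.2 z).
Definition wdh (z : tx) : R := eucl (fun ijk : I * I * I => dH ijk.2 ijk.1.1 ijk.1.2 z).
Definition wG (i j : I) (z : tx) : R := mink esgn (fun i j => H i j z) i j.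
Definition wF (z : tx) : R := \sum_i \sum_j wG i j z * s i j z.

Lemma wq_ge0 z : 0 <= wq z. Proof. exact: eucl_ge0. Qed.
Lemma wq_sqr z : wq z ^+ 2 = \sum_i p i z ^+ 2. Proof. exact: eucl_sqr. Qed.
Lemma wp_le i z : `|p i z| <= wq z. Proof. exact: (le_eucl (fun i => p i z)). Qed.
Lemma wH_le i j z : `|H i j z| <= whh z.
Proof. exact: (le_eucl (fun ij : I * I => H ij.1 ij.2 z) (i, j)). Qed.
Lemma wdH_le k i j z : `|dH k i j z| <= wdh z.
Proof.
exact: (le_eucl (fun ijk : I * I * I => dH ijk.2 ijk.1.1 ijk.1.2 z) ((i, j), k)).
Qed.

Lemma continuous_wq : continuous wq.
Proof. by have c1 := wcp D; rewrite /wq; cont. Qed.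
Lemma continuous_whh : continuous whh.
Proof. by have c1 := wcH D; rewrite /whh; cont. Qed.
Lemma continuous_wdh : continuous wdh.
Proof. by have c1 := wcdH D; rewrite /wdh; cont. Qed.
Lemma continuous_wG i j : continuous (wG i j).
Proof. by have c1 := wcH D; rewrite /wG /mink; cont. Qed.
Lemma continuous_wF : continuous wF.
Proof. by have c1 := continuous_wG; have c2 := wcs D; rewrite /wF; cont. Qed.

Lemma is_derive_wG al i j z : oslab T z -> is_derive z (tx_base al) (wG i j) (dH al i j z).
Proof.
move=> zT; rewrite /wG /mink.
have := is_deriveD_fun (is_derive_cst ((i == j)%:R * esgn i) z (tx_base al))
  (wDH D al i j z zT).
by rewrite add0r.
Qed.

Definition wenergy (t : R) : \bar R := (\int[lebesgue_rV n]_x (wq (t, x) ^+ 2)%:E)%E.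

(** For the multiplier [d_t], [current_err_bound] gives [N ^ 2 + N ^ 3 / 2] as the coefficient of
    [wdh * wq ^ 2], which [2 * N ^ 3] covers. *)
Definition energy_src (z : tx) : R := `|wF z| * wq z + 2 * N ^+ 3 * (wdh z * wq z ^+ 2).

Lemma energy_src_ge0 z : 0 <= energy_src z.
Proof.
by rewrite addr_ge0 ?mulr_ge0 ?wq_ge0 ?eucl_ge0 ?sqr_ge0 ?exprn_ge0 ?normr_ge0.
Qed.

Lemma continuous_energy_src : continuous energy_src.
Proof.
have c1 := continuous_wF; have c2 := continuous_wq; have c3 := continuous_wdh.
by rewrite /energy_src; cont.
Qed.

Let Yt (al : I) : R := (al == ord0)%:R.
Let Jt al (z : tx) : R := current_val (fun i j => wG i j z) (p^~ z) Yt 0 (phi z)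
  (fun=> 0) esgn al.
Let dJt al (z : tx) : R := current1_val (fun i j => wG i j z)
  (fun k i j => dH k i j z) (p^~ z) (fun i j => s i j z) Yt (fun _ _ => 0) 0 (phi z)
  (fun=> 0) (fun _ _ => 0) esgn al.

Let YtE z : \sum_ga Yt ga * p ga z + 0 * phi z = p ord0 z.
Proof.
rewrite mul0r addr0 (bigD1 ord0)//= /Yt eqxx mul1r big1 ?addr0// => i /negbTE ->.
by rewrite mul0r.
Qed.

(** The flat energy density is [wq ^ 2 / 2], and the smallness of [h] changes it by at most half of
    itself; hence 1/4 and 3/4. *)
Let Jt_bound al z : `|Jt al z| <= 3 / 2 * wq z ^+ 2 /\
  (4^-1 * wq z ^+ 2 <= Jt ord0 z <= 3 / 4 * wq z ^+ 2).
Proof.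
have e1 be : `|esgn be| = 1 by rewrite /esgn; case: ifP; rewrite ?normrN normr1.
have E0 : Jt ord0 z = mxv (fun i j => wG i j z) (p^~ z) ord0 * p ord0 z -
    2^-1 * qform (fun i j => wG i j z) (p^~ z).
  by rewrite /Jt /current_val YtE /Yt eqxx mul1r !mulr0 subr0.
have ED := energy_density_bound (e := esgn) (o := ord0) (fun i j => wHsym D i j z) (wHhalf D z)
  (fun i => wp_le i z) (wq_sqr z) (fun al => erefl).
have {}ED : 4^-1 * wq z ^+ 2 <= Jt ord0 z <= 3 / 4 * wq z ^+ 2.
  by move: ED; rewrite E0 ler_norml => /andP[h1 h2]; apply/andP; split; lra.
split => //.
have q2 : 0 <= wq z ^+ 2 by exact: sqr_ge0.
case: (unliftP ord0 al) => [a|] ->; last first.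
  by case/andP: ED => h1 h2; rewrite ler_norml; apply/andP; split; lra.
rewrite /Jt /current_val YtE /Yt [_ == _]eq_sym (negbTE (neq_lift _ _)).
rewrite mul0r !mulr0 !subr0 normrM expr2 mulrA; apply: ler_pM => //; last exact: wp_le.
rewrite mxv_mink; apply: le_trans (ler_normD _ _) _; rewrite normrM e1 mul1r.
have := wp_le (lift ord0 a) z.
have := mxv_half (lift ord0 a) (wHhalf D z) (fun i => wp_le i z); lra.
Qed.

Let dJt_sum z : oslab T z -> \sum_al dJt al z <= energy_src z.
Proof.
move=> zT; rewrite /dJt (current1_sum_mink _ _ _ _ _ _ _ _ _
  (fun i j => wHsym D i j z) (fun i j => wssym D i j z zT)) YtE.
have -> : \sum_al esgn al * p al z * (\sum_ga 0 * p ga z) = 0.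
  by rewrite big1// => al _; rewrite big1 ?mulr0// => be _; rewrite mul0r.
have -> : \sum_al esgn al * (0 : R) = 0 by rewrite big1// => al _; rewrite mulr0.
have -> : \sum_(al : I) (0 : R) = 0 by rewrite big1.
rewrite !mulr0 !subr0 mul0r addr0 addr0.
have b := @current_err_bound R I (fun i j => H i j z) (fun k i j => dH k i j z)
  (p^~ z) Yt (fun _ _ => 0) 0 (phi z) (fun=> 0) (whh z) (wdh z) (wq z) 1 0 0 0 (wq z)
  (fun i j => wH_le i j z) (fun k i j => wdH_le k i j z) (fun i => wp_le i z).
have := b _ _ _ _ _; rewrite YtE normr0 => {}b.
apply: le_trans (lerD (ler_norm _) (ler_norm _)) _; rewrite /energy_src; apply: lerD.
  by rewrite normrM ler_wpM2l//; exact: wp_le.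
apply: le_trans (b _ _ _ _ _) _ => //.
- by move=> al; rewrite /Yt; case: eqP => _; rewrite ?normr0 ?normr1.
- exact: wp_le.
rewrite card_ord.
have d0 : 0 <= wdh z * wq z ^+ 2 by rewrite mulr_ge0 ?eucl_ge0 ?sqr_ge0.
have N1 : 1 <= N by rewrite ler1n.
have : N ^+ 2 * (wdh z * wq z ^+ 2) <= N ^+ 3 * (wdh z * wq z ^+ 2).
  by rewrite ler_wpM2r// ler_weXn2l.
have : 0 <= N ^+ 3 * (wdh z * wq z ^+ 2) by rewrite mulr_ge0// exprn_ge0.
rewrite (_ : N ^+ 3 * (whh z * 0 * wq z ^+ 2) = 0); last by ring.
rewrite (_ : N ^+ 2 * (whh z * wq z * 0) * `|phi z| = 0); last by ring.
rewrite (_ : (0 + 2^-1 * (N * 0)) * _ = 0); last by ring.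
rewrite !addr0.
have -> : N ^+ 2 * (wdh z * wq z) * wq z = N ^+ 2 * (wdh z * wq z ^+ 2) by ring.
clear b; lra.
Qed.

Lemma energy_estimate t : 0 <= t <= T ->
  (wenergy t <= 4%:E * (\int[lebesgue_tx n]_(z in oslab T) (energy_src z)%:E +
    wenergy 0))%E.
Proof.
case/andP => t0 tT.
have src0 : (0 <= \int[lebesgue_tx n]_(z in oslab T) (energy_src z)%:E)%E.
  by apply: integral_ge0 => z _; rewrite lee_fin energy_src_ge0.
have E0 u : (0 <= wenergy u)%E by apply: integral_ge0 => x _; rewrite lee_fin sqr_ge0.
(* The divergence theorem needs a slab of positive height; at [t = 0] the claim is immediate. *)
have [->|tn0] := eqVneq t 0.
  apply: (@le_trans _ _ (1%:E * wenergy 0)%E); first by rewrite mul1e.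
  by apply: lee_pmul => //; rewrite ?lee_fin ?ler1n// leeDr.
have {tn0}t0 : 0 < t by rewrite lt_neqAle eq_sym tn0.
have cq := continuous_wq.
have mS (u : tx -> R) v : continuous u -> measurable_fun setT (fun x => u (v, x)).
  by move=> cu; apply: continuous_measurable_rV; exact: continuous_slice.
rewrite -lee_pdivrMl// /wenergy -ge0_integralZl_EFin ?invr_ge0//; last 2 first.
- by move=> x _; rewrite lee_fin sqr_ge0.
- by apply/measurable_EFinP; apply: (mS (fun z => wq z ^+ 2)); cont.
under eq_integral do rewrite -EFinM.
apply: (@fatou_le _ _ _ (lebesgue_rV n) setT
  (fun k x => cutoff k.+1%:R (t, x) * (4^-1 * wq (t, x) ^+ 2))) => //.
- move=> k; apply: (mS (fun z => cutoff k.+1%:R z * (4^-1 * wq z ^+ 2))).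
  have c2 := @continuous_cutoff R n k.+1%:R; cont.
- by move=> k x _; apply: mulr_ge0; [exact: cutoff_ge0|rewrite mulr_ge0 ?invr_ge0 ?sqr_ge0].
- move=> x _; rewrite -[X in _ --> X]mul1r; apply: cvgM; first exact: cvg_cutoff.
  exact: cvg_cst.
move=> k; pose rho : R := k.+1%:R; have rho0 : 0 < rho by [].
have ccut := @continuous_cutoff R n rho; have cdcut := @continuous_dcutoff R n rho.
have ct (z : tx) : slab t z -> 0 <= z.1 by case/andP.
have os (z : tx) : oslab t z -> oslab T z.
  by case/andP => h1 h2; apply/andP; split => //; exact: lt_le_trans tT.
have ost (z : tx) : oslab t z -> 0 <= z.1 by case/andP => h1 h2; exact: ltW.
have c1 := continuous_wG; have c2 := wcp D; have c3 := wcphi D.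
have c4 := wcs D; have c5 := wcdH D.
have cJ al : continuous (Jt al).
  by apply: (@continuous_current _ _ _ wG p (fun al z => Yt al) (fun=> 0) phi
    (fun _ _ => 0)) => //; move=> *; exact: cst_continuous.
have cdJ al : continuous (dJt al).
  by apply: (@continuous_current1 _ _ _ wG p (fun al z => Yt al) (fun=> 0) phi
    (fun _ _ => 0) _ dH s (fun _ _ _ => 0) (fun _ _ _ => 0)) => //; move=> *;
    exact: cst_continuous.
have csrc := continuous_energy_src.
have DJt al z : oslab T z -> is_derive z (tx_base al) (Jt al) (dJt al z).
  move=> zT.
  apply: (@is_derive_current _ _ _ wG p (fun al z => Yt al) (fun=> 0) phi (fun _ _ => 0)
    esgn (fun k i j => dH k i j z) (fun i j => s i j z) (fun _ _ => 0) (fun _ _ => 0)).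
  - by move=> i j; exact: is_derive_wG.
  - by move=> i; exact: (wDp D).
  - exact: (wDphi D).
have := @slab_divergence_le R n t rho (fun al z => cutoff rho z * Jt al z)
  (fun al z => dcutoff rho al z * Jt al z + cutoff rho z * dJt al z)
  (fun=> 0) energy_src (fun x => 3 / 4 * wq (0, x) ^+ 2) (fun=> 0)
  (fun x => cutoff rho (t, x) * (4^-1 * wq (t, x) ^+ 2)) t0.
rewrite !integral0 add0e adde0 => M.
have cS (u : tx -> R) v : continuous u -> continuous (fun x => u (v, x)).
  exact: continuous_slice.
apply: le_trans (M _ _ _ _ _ _ _ _ _ _ _ _ _ _ _ _ _) _.
- by move=> al; cont.
- by move=> al; cont.
- move=> al z zt; apply: is_deriveM_fun; first exact: is_derive_cutoff.
  by apply: DJt; exact: os.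
- by move=> al z zt; rewrite mulf_eq0 negb_or => /andP[h _]; apply: cutoff_box h; auto.
- exact: cst_continuous.
- by [].
- by apply: (cS (fun z => 3 / 4 * wq z ^+ 2)); cont.
- exact: cst_continuous.
- by apply: (cS (fun z => cutoff rho z * (4^-1 * wq z ^+ 2))); cont.
- by [].
- exact: energy_src_ge0.
- by move=> x; rewrite mulr_ge0 ?sqr_ge0.
- by [].
- by move=> x; apply: mulr_ge0; [exact: cutoff_ge0|rewrite mulr_ge0 ?invr_ge0 ?sqr_ge0].
- move=> z zt; rewrite add0r big_split /= -mulr_sumr.
  have zT := os _ zt; have z0 := ost _ zt.
  apply: (@le_trans _ _ (0 + cutoff rho z * energy_src z)).
    apply: lerD; last by rewrite ler_wpM2l ?cutoff_ge0// dJt_sum.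
    apply: (cutoff_flux rho0 z0 (sqr_ge0 (wq z))).
      by have [_ /andP[]] := Jt_bound ord0 z.
    by move=> al; have [] := Jt_bound al z.
  by rewrite add0r ler_piMl ?energy_src_ge0// cutoff_le1.
- move=> x; have [_ /andP[_ h]] := Jt_bound ord0 (0, x).
  apply: le_trans h; rewrite ler_piMl ?cutoff_le1//.
  have [_ /andP[h _]] := Jt_bound ord0 (0, x).
  by apply: le_trans h; rewrite mulr_ge0 ?invr_ge0 ?sqr_ge0.
- move=> x; rewrite addr0 ler_wpM2l ?cutoff_ge0//.
  by have [_ /andP[h _]] := Jt_bound ord0 (t, x).
clear M; apply: leeD.
  apply: ge0_subset_integral => //.
  - exact: measurable_oslab.
  - exact: measurable_oslab.
  - apply: measurable_funTS; apply/measurable_EFinP; exact: continuous_measurable_txV.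
  - by move=> z _; rewrite lee_fin energy_src_ge0.
apply: ge0_le_integral => //.
- by move=> x _; rewrite lee_fin mulr_ge0 ?sqr_ge0.
- by apply/measurable_EFinP; apply: (mS (fun z => 3 / 4 * wq z ^+ 2)); cont.
- by apply/measurable_EFinP; apply: (mS (fun z => wq z ^+ 2)); cont.
- by move=> x _; rewrite lee_fin ler_piMl ?sqr_ge0//; lra.
Qed.

End wave.

Arguments wcphi {R n T} _ _ _.
Arguments wcp {R n T} _ _ _ _.
Arguments wcs {R n T} _ _ _ _ _.
Arguments wcH {R n T} _ _ _ _ _.
Arguments wcdH {R n T} _ _ _ _ _ _.
Arguments wDphi {R n T} _ _ _ _.
Arguments wDp {R n T} _ _ _ _ _.
Arguments wDH {R n T} _ _ _ _ _ _.
Arguments wDphix {R n T} _ _ _ _ _.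
Arguments wHsym {R n T} _ _ _ _.
Arguments wssym {R n T} _ _ _ _ _.
Arguments wHhalf {R n T} _ _.
Arguments wL2 {R n T} _ _ _.

(** * Hardy's inequality *)

(** Here the bounds carry an error [M / (k + 1)]; dropping the first [j] terms makes it smaller than
    any given [e]. *)
Lemma fatou_le_harmonic {R : realType} d (X : measurableType d)
    (m : {measure set X -> \bar R}) (D : set X) (g_ : nat -> X -> R) (g : X -> R)
    (C : \bar R) (M : R) :
  measurable D -> (forall k, measurable_fun D (g_ k)) ->
  (forall k x, D x -> 0 <= g_ k x) ->
  (forall x, D x -> g_ k x @[k --> \oo] --> g x) -> (0 <= C)%E -> 0 <= M ->
  (forall k, \int[m]_(x in D) (g_ k x)%:E <= C + (M / k.+1%:R)%:E)%E ->
  (\int[m]_(x in D) (g x)%:E <= C)%E.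
Proof.
move=> mD mg g0 gg C0 M0 gC.
apply/lee_addgt0Pr => e e0.
have [j je] : exists j : nat, M / j.+1%:R <= e.
  have Me : M / e < (Num.truncn (M / e)).+1%:R by exact: truncnS_gt.
  exists (Num.truncn (M / e)); rewrite ler_pdivrMr// mulrC -ler_pdivrMr// ltW//.
apply: (@fatou_le _ _ _ m D (fun k => g_ (k + j)%N)) => //.
- by move=> k x; exact: g0.
- by move=> x Dx; have := gg x Dx; rewrite -(@cvg_shiftn j).
move=> k; apply: le_trans (gC _) _; apply: leeD2l; rewrite lee_fin.
apply: le_trans je; apply: ler_wpM2l => //.
by rewrite lef_pV2 ?posrE// ler_nat ltnS leq_addl.
Qed.

Lemma space_divergence_le {R : realType} n (M : R) (v dv : 'I_n -> 'rV[R]_n -> R)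
    (W P : 'rV[R]_n -> R) :
  (forall a, continuous (v a)) -> (forall a, continuous (dv a)) ->
  (forall a x, is_derive x (ebase a) (v a) (dv a x)) ->
  (forall a x, v a x != 0 -> box M x) ->
  continuous W -> continuous P -> (forall x, 0 <= W x) -> (forall x, 0 <= P x) ->
  (forall x, W x <= \sum_a dv a x + P x) ->
  (\int[lebesgue_rV n]_x (W x)%:E <= \int[lebesgue_rV n]_x (P x)%:E)%E.
Proof.
move=> cv cdv Dv sv cW cP W0 P0 WP.
have idv a : (lebesgue_rV n).-integrable setT (EFin \o dv a).
  apply: (@integrable_box _ n M) => // x; exact: (derive_box (Dv a x) (sv a)).
have E : (\int[lebesgue_rV n]_x (\sum_a dv a x)%:E = 0)%E.
  under eq_integral do rewrite -sumEFin.
  rewrite integral_sum// big1// => a _.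
  exact: (integral_partial (cv a) (cdv a) (Dv a) (sv a)).
have iS : (lebesgue_rV n).-integrable setT (EFin \o (fun x => \sum_a dv a x)).
  have -> : EFin \o (fun x => \sum_a dv a x) = (fun x => \sum_a (dv a x)%:E)%E.
    by apply/funext => x; rewrite /= sumEFin.
  apply: (@integrable_sum _ _ _ (lebesgue_rV n) _ measurableT _
    (index_enum _) xpredT (fun a x => (dv a x)%:E)) => a _; exact: idv.
have := @integral_le_add R _ _ (lebesgue_rV n) setT (fun x => \sum_a dv a x) P W
  measurableT iS (continuous_measurable_rV cP) (continuous_measurable_rV cW)
  (fun x _ => P0 x) (fun x _ => W0 x) (fun x _ => WP x).
by rewrite E add0e.
Qed.

Section hardy.
Context {R : realType} (n : nat).
Hypothesis n_ge3 : (3 <= n)%N.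
Local Notation tx := (R * 'rV[R]_n)%type.
Variables (T : R) (D : wave_data n T).
Local Notation phi := (wphi D).
Local Notation p := (wp D).

Section pointwise.
Variables (eps : R) (t : R).
Hypotheses (eps_gt0 : 0 < eps) (tT : 0 <= t <= T).
Let u (x : 'rV[R]_n) : R := xsq (0, x) + eps.
Let X (a : 'I_n) (x : 'rV[R]_n) : R := xcoord (lift ord0 a) (0, x).
Let f x := phi (t, x).
Let q x := wq D (t, x).

Let u_gt0 x : 0 < u x.
Proof. by rewrite ltr_wpDl// xsq_ge0. Qed.

(** The field [x f ^ 2 / u], whose divergence yields Hardy's inequality. The cutoff is frozen at
    time 0, so that it is a function of space. *)
Let hcur rho a x : R := cutoff rho (0, x) * (X a x * ((u x)^-1 * (f x * f x))).

Let dhcur rho a x : R := dcutoff rho (lift ord0 a) (0, x) * (X a x * ((u x)^-1 * (f x * f x))) +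
  cutoff rho (0, x) * (1 * ((u x)^-1 * (f x * f x)) +
    X a x * (- (u x) ^- 2 * (2 * X a x) * (f x * f x) +
      (u x)^-1 * (p (lift ord0 a) (t, x) * f x + f x * p (lift ord0 a) (t, x)))).

Let cu : continuous u.
Proof.
have c1 : continuous (fun x : 'rV[R]_n => xsq (0, x)).
  exact: (@continuous_slice _ _ (@xsq R n) 0 (@continuous_xsq R n)).
by rewrite /u; cont.
Qed.

Let cX a : continuous (X a).
Proof.
exact: (@continuous_slice _ _ (xcoord (lift ord0 a)) 0 (@continuous_xcoord R n (lift ord0 a))).
Qed.

Let cf : continuous f. Proof. exact: (@continuous_slice _ _ phi t (wcphi D)). Qed.

Let cuV : continuous (fun x => (u x)^-1).
Proof. by apply: continuousV_fun => // x; rewrite lt0r_neq0. Qed.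

(** The divergence of [x f ^ 2 / u] is at least [(n - 2) f ^ 2 / u + 2 f (x.grad f) / u]. For
    [n >= 3] the first term provides one [f ^ 2 / u]; completing the square in the second spends
    half of it and [2 q ^ 2]. The gradient of the cutoff contributes an error of order [1 / rho],
    since [|x_a| / u <= 1 + 1 / eps]. *)
Let dhcur_sum rho x : 0 < rho ->
  2^-1 * (cutoff rho (0, x) * (f x ^+ 2 / u x)) <= \sum_a dhcur rho a x +
   (2 * q x ^+ 2 +
    n%:R * (2 * (2 + cspeed n) / rho * ((1 + eps^-1) * f x ^+ 2))).
Proof.
move=> rho0; have ux := u_gt0 x.
have uE : \sum_a X a x ^+ 2 = u x - eps.
  by rewrite /u addrK /xsq big_ord_recl xcoord0 expr0n add0r.
have f2 : 0 <= f x ^+ 2 / u x by rewrite divr_ge0 ?sqr_ge0 ?ltW.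
pose xp := \sum_a X a x * p (lift ord0 a) (t, x).
have E : \sum_a dhcur rho a x =
   \sum_a dcutoff rho (lift ord0 a) (0, x) * (X a x * ((u x)^-1 * f x ^+ 2)) +
   cutoff rho (0, x) * (n%:R * (f x ^+ 2 / u x) - 2 * ((u x - eps) / u x) * (f x ^+ 2 / u x)
     + 2 * (f x / u x) * xp).
  rewrite /dhcur big_split -mulr_sumr /= big_split /=.
  congr (_ + _ * _).
  rewrite sumr_const card_ord -addrA; congr (_ + _).
    by rewrite mul1r -[LHS]mulr_natl; ring.
  have -> : - (2 * ((u x - eps) / u x) * (f x ^+ 2 / u x)) + 2 * (f x / u x) * xp =
     (u x - eps) * (- (2 * (u x)^-1 * (f x ^+ 2 / u x))) + xp * (2 * (f x / u x)) by ring.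
  rewrite -uE /xp !mulr_suml -big_split /=.
  apply: eq_bigr => a _; field; exact: lt0r_neq0.
have CS : xp ^+ 2 <= (u x - eps) * q x ^+ 2.
  rewrite -uE; apply: le_trans (cauchy_schwarz_sum _ _) _.
  rewrite ler_wpM2l ?sumr_ge0// => [a _|]; first exact: sqr_ge0.
  by rewrite /q wq_sqr big_ord_recl lerDr sqr_ge0.
have A1 : - (2^-1 * (f x ^+ 2 / u x)) - 2 * q x ^+ 2 <= 2 * (f x / u x) * xp.
  have h : (xp ^+ 2) / u x <= q x ^+ 2.
    rewrite ler_pdivrMr// mulrC; apply: le_trans CS _.
    by rewrite ler_wpM2r ?sqr_ge0// gerBl ltW.
  have : 0 <= (f x + 2 * xp) ^+ 2 / u x by rewrite divr_ge0 ?sqr_ge0 ?ltW.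
  have -> : (f x + 2 * xp) ^+ 2 / u x = f x ^+ 2 / u x + 2 * (2 * (f x / u x) * xp)
     + 4 * (xp ^+ 2 / u x) by ring.
  lra.
have A2 : f x ^+ 2 / u x <= n%:R * (f x ^+ 2 / u x) - 2 * ((u x - eps) / u x) * (f x ^+ 2 / u x).
  rewrite -mulrBl -[leLHS]mul1r ler_wpM2r//.
  have : (3 : R) <= n%:R by rewrite ler_nat.
  have : (u x - eps) / u x <= 1 by rewrite ler_pdivrMr// mul1r gerBl ltW.
  lra.
have A3 : - (n%:R * (2 * (2 + cspeed n) / rho * ((1 + eps^-1) * f x ^+ 2))) <=
    \sum_a dcutoff rho (lift ord0 a) (0, x) * (X a x * ((u x)^-1 * f x ^+ 2)).
  rewrite lerNl -[leLHS]opprK lerNl opprK.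
  suff : `|\sum_a dcutoff rho (lift ord0 a) (0, x) * (X a x * ((u x)^-1 * f x ^+ 2))| <=
      #|'I_n|%:R * (2 * (2 + cspeed n) / rho * ((1 + eps^-1) * f x ^+ 2)).
    by rewrite card_ord ler_norml => /andP[].
  apply: ler_norm_sum_card => a; rewrite normrM; apply: ler_pM => //.
    exact: dcutoff_bound.
  rewrite mulrA normrM [X in _ * X <= _]ger0_norm ?sqr_ge0// ler_wpM2r ?sqr_ge0//.
  rewrite normrM normfV (gtr0_norm ux) ler_pdivrMr//.
  have Xu : X a x ^+ 2 <= u x - eps.
    rewrite -uE (bigD1 a)//= lerDl; apply: sumr_ge0 => i _; exact: sqr_ge0.
  have s0 : 0 <= u x - eps by apply: le_trans Xu; exact: sqr_ge0.
  have : `|X a x| <= 1 + (u x - eps).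
    have := sqr_ge0 (`|X a x| - 1); rewrite sqrrB real_normK ?num_real//.
    have := sqr_ge0 (X a x); lra.
  move/le_trans; apply.
  rewrite mulrDl mul1r.
  have : 1 <= eps^-1 * u x by rewrite mulrC ler_pdivlMr// mul1r -subr_ge0.
  have := eps_gt0; lra.
have c0 := cutoff_ge0 rho (0, x); have c1 := cutoff_le1 (z := (0, x)) rho0 (lexx 0).
have A4 : cutoff rho (0, x) * (2^-1 * (f x ^+ 2 / u x) - 2 * q x ^+ 2) <=
   cutoff rho (0, x) * (n%:R * (f x ^+ 2 / u x) - 2 * ((u x - eps) / u x) * (f x ^+ 2 / u x)
     + 2 * (f x / u x) * xp).
  by apply: ler_wpM2l => //; lra.
have A5 : cutoff rho (0, x) * (2 * q x ^+ 2) <= 2 * q x ^+ 2.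
  by rewrite ler_piMl// mulr_ge0 ?sqr_ge0.
rewrite E.
move: A4; rewrite mulrBr.
have -> : cutoff rho (0, x) * (2^-1 * (f x ^+ 2 / u x)) =
  2^-1 * (cutoff rho (0, x) * (f x ^+ 2 / u x)) by ring.
lra.
Qed.

Lemma hardy : (\int[lebesgue_rV n]_x (phi (t, x) ^+ 2 / (xsq (t, x) + eps))%:E <=
  4%:E * wenergy D t)%E.
Proof.
have cq : continuous q by exact: (@continuous_slice _ _ (wq D) t (@continuous_wq _ _ _ D)).
have ccut (rho : R) : continuous (fun x : 'rV[R]_n => cutoff rho (0, x)).
  by apply: continuous_slice; exact: continuous_cutoff.
have cdcut (rho : R) (al : 'I_n.+1) : continuous (fun x : 'rV[R]_n => dcutoff rho al (0, x)).
  by apply: continuous_slice; exact: continuous_dcutoff.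
have cp al : continuous (fun x => p al (t, x)) by exact: (@continuous_slice _ _ (p al) t (wcp D al)).
have mE (g : 'rV[R]_n -> R) : continuous g -> measurable_fun setT (fun x => (g x)%:E).
  by move=> cg; apply/measurable_EFinP; exact: continuous_measurable_rV.
have E0 : (0 <= wenergy D t)%E by apply: integral_ge0 => x _; rewrite lee_fin sqr_ge0.
(* Twice the coefficient of [1 / rho] in the integrated error, finite because [phi (t, .)] is square
   integrable. *)
pose K := 2 * (n%:R * (2 * (2 + cspeed n) * (1 + eps^-1))) *
  fine (\int[lebesgue_rV n]_x (f x ^+ 2)%:E)%E.
have cs0 : 0 <= 2 + cspeed n :> R by apply: addr_ge0 => //; exact/ltW/cspeed_gt0.
have e0 : 0 <= 1 + eps^-1 by apply: addr_ge0 => //; rewrite invr_ge0 ltW.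
apply: (@fatou_le_harmonic _ _ _ (lebesgue_rV n) setT
  (fun k x => cutoff k.+1%:R (0, x) * (f x ^+ 2 / u x)) _ _ K) => //.
- by move=> k; apply: continuous_measurable_rV; have ck := ccut k.+1%:R; cont.
- move=> k x _; apply: mulr_ge0; first exact: cutoff_ge0.
  by rewrite divr_ge0 ?sqr_ge0 ?(ltW (u_gt0 x)).
- move=> x _; rewrite -[X in _ --> X]mul1r; apply: cvgM; first exact: cvg_cutoff.
  exact: cvg_cst.
- exact: mule_ge0.
- rewrite /K !mulr_ge0//; apply: fine_ge0; apply: integral_ge0 => x _.
  by rewrite lee_fin sqr_ge0.
move=> k; pose rho : R := k.+1%:R; have rho0 : 0 < rho by [].
have cc := ccut rho; have cd := cdcut rho; have ck := ccut k.+1%:R.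
have := @space_divergence_le R n rho (hcur rho) (dhcur rho)
  (fun x => 2^-1 * (cutoff rho (0, x) * (f x ^+ 2 / u x)))
  (fun x => 2 * q x ^+ 2 +
    n%:R * (2 * (2 + cspeed n) / rho * ((1 + eps^-1) * f x ^+ 2))).
move=> M; rewrite -(@lee_pmul2l _ 2^-1%:E) ?lte_fin ?invr_gt0//.
rewrite -ge0_integralZl_EFin ?invr_ge0//; last 2 first.
- move=> x _; rewrite lee_fin; apply: mulr_ge0; first exact: cutoff_ge0.
  by rewrite divr_ge0 ?sqr_ge0 ?(ltW (u_gt0 x)).
- by apply: mE; cont.
under eq_integral do rewrite -EFinM.
have f20 x : 0 <= (1 + eps^-1) * f x ^+ 2 by rewrite mulr_ge0 ?sqr_ge0.
have cr0 : 0 <= 2 * (2 + cspeed n) / rho.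
  by rewrite divr_ge0 ?(ltW rho0)// mulr_ge0.
apply: le_trans (M _ _ _ _ _ _ _ _ _) _; clear M.
- by move=> a; rewrite /hcur; cont.
- have cuV2 : continuous (fun x => - (u x) ^- 2).
    have -> : (fun x => - (u x) ^- 2) = (fun x => - ((u x)^-1 * (u x)^-1)).
      by apply/funext => x; rewrite -exprVn expr2.
    by cont.
  move=> a; have cpa := cp (lift ord0 a); have cda := cd (lift ord0 a).
  rewrite /dhcur; repeat first [exact: cuV2 | exact: cpa | exact: cda | cont_step].
- move=> a x; apply: is_deriveM_fun.
    exact: is_derive_slice (is_derive_cutoff rho (lift ord0 a) (0, x)).
  have DX : is_derive x (ebase a) (X a) 1.
    have := is_derive_slice (is_derive_xcoord (lift ord0 a) (lift ord0 a) (0, x)).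
    by rewrite /dlt eqxx mulr1.
  have Du : is_derive x (ebase a) u (2 * X a x).
    have := is_derive_slice (is_derive_xsq (lift ord0 a) (0, x)) => Ds.
    have := is_deriveD_fun Ds (is_derive_cst eps x (ebase a)).
    by rewrite addr0.
  have DuV : is_derive x (ebase a) (fun x => (u x)^-1) (- (u x) ^- 2 * (2 * X a x)).
    apply: is_derive_comp_fun Du.
    have Dv : is_derive (u x) (1 : R) (fun y : R => y^-1) (- (u x) ^- 2 *: 1).
      by apply: is_deriveV; rewrite ?lt0r_neq0//; exact: is_derive_id.
    by apply: is_derive_eq Dv _; rewrite /GRing.scale /= mulr1.
  apply: is_deriveM_fun => //; apply: is_deriveM_fun => //.
  by apply: is_deriveM_fun; exact: (wDphix D).
- move=> a x; rewrite mulf_eq0 negb_or => /andP[h _].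
  exact: (cutoff_box rho0 (z := (0, x))) h.
- by cont.
- by cont.
- move=> x; apply: mulr_ge0; first by rewrite invr_ge0.
  apply: mulr_ge0; first exact: cutoff_ge0.
  by rewrite divr_ge0 ?sqr_ge0 ?(ltW (u_gt0 x)).
- by move=> x; apply: addr_ge0; [rewrite mulr_ge0 ?sqr_ge0|rewrite mulr_ge0// mulr_ge0].
- by move=> x; exact: dhcur_sum.
under eq_integral do rewrite EFinD.
rewrite ge0_integralD//; last 4 first.
- by move=> x _; rewrite lee_fin mulr_ge0 ?sqr_ge0.
- by apply: mE; cont.
- by move=> x _; rewrite lee_fin mulr_ge0// mulr_ge0.
- by apply: mE; cont.
have fE : (\int[lebesgue_rV n]_x (f x ^+ 2)%:E =
    (fine (\int[lebesgue_rV n]_x (f x ^+ 2)%:E))%:E)%E.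
  rewrite fineK// ge0_fin_numE ?(wL2 D)//.
  by apply: integral_ge0 => x _; rewrite lee_fin sqr_ge0.
have -> : (\int[lebesgue_rV n]_x (n%:R * (2 * (2 + cspeed n) / rho *
    ((1 + eps^-1) * f x ^+ 2)))%:E = (2^-1 * (K / rho))%:E)%E.
  have -> : (2^-1 * (K / rho))%:E = ((n%:R * (2 * (2 + cspeed n) / rho * (1 + eps^-1)))%:E *
     \int[lebesgue_rV n]_x (f x ^+ 2)%:E)%E.
    rewrite fE -EFinM; congr EFin; rewrite /K; field.
    by rewrite lt0r_neq0//= addrC natr1 pnatr_eq0.
  rewrite -ge0_integralZl_EFin//.
  - by apply: eq_integral => x _; rewrite -EFinM; congr EFin; ring.
  - by move=> x _; rewrite lee_fin sqr_ge0.
  - by apply: mE; cont.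
  - by rewrite mulr_ge0// mulr_ge0.
have -> : (\int[lebesgue_rV n]_x (2 * q x ^+ 2)%:E = 2%:E * wenergy D t)%E.
  rewrite -ge0_integralZl_EFin//.
  - by move=> x _; rewrite lee_fin sqr_ge0.
  - by apply: mE; cont.
have K0 : 0 <= K.
  rewrite /K !mulr_ge0//; apply: fine_ge0; apply: integral_ge0 => x _.
  by rewrite lee_fin sqr_ge0.
rewrite [leRHS]ge0_muleDr ?mule_ge0 ?lee_fin ?divr_ge0//.
by rewrite muleA -!EFinM (_ : 2^-1 * 4 = 2 :> R)//; field.
Qed.

End pointwise.
End hardy.

(** * The radial multiplier *)

Section multiplier.
Context {R : realType} (n : nat).
Hypothesis n_ge3 : (3 <= n)%N.
Local Notation I := 'I_n.+1.
Local Notation tx := (R * 'rV[R]_n)%type.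
Local Notation N := (n.+1%:R : R).
Variables (T : R) (D : wave_data n T) (mu : R).
Hypotheses (mu_gt0 : 0 < mu) (mu_lt : mu < 1 / 2).
Local Notation phi := (wphi D).
Local Notation p := (wp D).
Local Notation s := (ws D).
Local Notation H := (wH D).
Local Notation dH := (wdH D).

(** The weights are parameters: the estimate is proved with the regularised ones, which are then
    compared with their limits by monotonicity. *)
Definition mul_src (k th : R) (z : tx) : R :=
  N * (`|wF D z| * (wq D z + k * `|phi z|)) +
  4 * N ^+ 3 * (wdh D z * wq D z ^+ 2 + wdh D z * (`|phi z| * wq D z) * k +
    whh D z * wq D z ^+ 2 * k + whh D z * (`|phi z| * wq D z) * th).

Lemma mul_src_ge0 k th z : 0 <= k -> 0 <= th -> 0 <= mul_src k th z.
Proof.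
move=> k0 th0; have q0 := wq_ge0 D z.
have h0 : 0 <= whh D z by exact: eucl_ge0.
have d0 : 0 <= wdh D z by exact: eucl_ge0.
have p0 := normr_ge0 (phi z); have F0 := normr_ge0 (wF D z).
by rewrite addr_ge0// mulr_ge0// ?mulr_ge0 ?addr_ge0 ?exprn_ge0 ?mulr_ge0 ?exprn_ge0.
Qed.

Lemma le_mul_src k th k' th' z : k <= k' -> th <= th' ->
  mul_src k th z <= mul_src k' th' z.
Proof.
move=> kk' tt'; have q0 := wq_ge0 D z.
have h0 : 0 <= whh D z by exact: eucl_ge0.
have d0 : 0 <= wdh D z by exact: eucl_ge0.
have p0 := normr_ge0 (phi z); have F0 := normr_ge0 (wF D z).
rewrite /mul_src; apply: lerD.
  by do 2 apply: ler_wpM2l => //; rewrite lerD2l ler_wpM2r.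
apply: ler_wpM2l; first by rewrite mulr_ge0 ?exprn_ge0.
by rewrite lerD ?lerD ?ler_wpM2l ?mulr_ge0 ?exprn_ge0.
Qed.

Section regularized.
Variables (L eps : R).
Hypotheses (L_ge1 : 1 <= L) (eps_gt0 : 0 < eps).

Let u (z : tx) : R := xsq z + eps.
Let k (z : tx) : R := kw mu L (u z).
Let k1 (z : tx) : R := kw1 mu L (u z).
Let k2 (z : tx) : R := kw2 mu L (u z).
Let th (z : tx) : R := k z * Num.sqrt (xsq z) / u z.
Let hq (z : tx) : R := wq D z ^+ 2 + phi z ^+ 2 / u z.

Let u_gt0 z : 0 < u z. Proof. by rewrite ltr_wpDl// xsq_ge0. Qed.

Let cu : continuous u.
Proof. by have c1 := @continuous_xsq R n; rewrite /u; cont. Qed.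

Let comp_u (g : R -> R) : (forall y, 0 < y -> {for y, continuous g}) ->
  continuous (fun z => g (u z)).
Proof.
move=> cg z; apply: (@continuous_comp _ _ _ u g); first exact: cu.
exact: cg.
Qed.

Let ck : continuous k.
Proof. by apply: comp_u => y y0; exact: continuous_kw. Qed.

Let ck1 : continuous k1.
Proof. by apply: comp_u => y y0; exact: continuous_kw1. Qed.

Let ck2 : continuous k2.
Proof. by apply: comp_u => y y0; exact: continuous_kw2. Qed.

Let cuV : continuous (fun z => (u z)^-1).
Proof. by apply: continuousV_fun => // z; rewrite lt0r_neq0. Qed.

Let ckdel : continuous (fun z => kdel L (u z)).
Proof.
have c1 : continuous (fun z => (L ^+ 2 + u z)^-1).
  apply: continuousV_fun => [z|]; last by cont.
  by rewrite lt0r_neq0// ltr_wpDl ?sqr_ge0.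
by rewrite /kdel; cont.
Qed.

Let csq : continuous (fun z : tx => Num.sqrt (xsq z)).
Proof. by apply: continuous_sqrt_fun; exact: continuous_xsq. Qed.

Let chq : continuous hq.
Proof.
by have c1 := @continuous_wq _ _ _ D; have c2 := wcphi D; rewrite /hq; cont.
Qed.

Let hq_ge0 z : 0 <= hq z.
Proof. by rewrite addr_ge0 ?sqr_ge0// divr_ge0 ?sqr_ge0 ?(ltW (u_gt0 z)). Qed.

Let k_ge0 z : 0 <= k z.
Proof. by apply/ltW/kw_gt0. Qed.

Let th_ge0 z : 0 <= th z.
Proof. by rewrite divr_ge0 ?(ltW (u_gt0 z))// mulr_ge0// sqrtr_ge0. Qed.

Let csrc : continuous (fun z => mul_src (k z) (th z) z).
Proof.
have c1 := @continuous_wF _ _ _ D; have c2 := @continuous_wq _ _ _ D.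
have c3 := @continuous_wdh _ _ _ D; have c4 := @continuous_whh _ _ _ D.
have c5 := wcphi D; have cth : continuous th by rewrite /th; cont.
by rewrite /mul_src; cont.
Qed.

Let Y al z := mul_Y (fun i : I => xcoord i z) (k z) al.
Let dY al be z := mul_dY ord0 (fun i : I => xcoord i z) (k z) (k1 z) al be.
Let w z := mul_w I (k z).
Let dw al z := mul_dw (fun i : I => xcoord i z) (k1 z) al.
Let ddw al be z := mul_ddw ord0 (fun i : I => xcoord i z) (k1 z) (k2 z) al be.

Let J al z := current_val (fun i j => wG D i j z) (p^~ z) (Y^~ z) (w z) (phi z)
  (dw^~ z) (@esgn R n) al.
Let dJ al z := current1_val (fun i j => wG D i j z) (fun k i j => dH k i j z)
  (p^~ z) (fun i j => s i j z) (Y^~ z) (fun i j => dY i j z) (w z) (phi z)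
  (dw^~ z) (fun i j => ddw i j z) (@esgn R n) al.

Let DJ al z : oslab T z -> is_derive z (tx_base al) (J al) (dJ al z).
Proof.
move=> zT.
have Dk (g g' : R -> R) : (forall y : R, 0 < y -> is_derive y (1 : R) g (g' y)) ->
    is_derive z (tx_base al) (fun z => g (u z)) (g' (u z) * (2 * xcoord al z)).
  move=> Dg; apply: is_derive_comp_fun; first exact: Dg.
  have := is_deriveD_fun (is_derive_xsq al z) (is_derive_cst eps z (tx_base al)).
  by rewrite addr0.
have Dk0 := Dk _ _ (fun y => @is_derive_kw R mu L L_ge1 y).
have Dk1 := Dk _ _ (fun y => @is_derive_kw1 R mu L L_ge1 y).
have DX be := is_derive_xcoord be al z.
apply: (@is_derive_current _ _ _ (wG D) p Y w phi dw (@esgn R n)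
  (fun k i j => dH k i j z) (fun i j => s i j z) (fun i j => dY i j z)
  (fun i j => ddw i j z)).
- by move=> i j; exact: is_derive_wG.
- by move=> i; exact: (wDp D).
- move=> be; apply: is_derive_eq (is_deriveM_fun Dk0 (DX be)) _.
  by rewrite /dY /mul_dY /k1 /k; ring.
- apply: is_derive_eq (is_deriveMl_fun _ Dk0) _.
  by rewrite /dw /mul_dw /k1; field.
- exact: (wDphi D).
- apply: is_derive_eq (is_deriveM_fun (is_deriveMl_fun _ Dk1) (DX al)) _.
  by rewrite /ddw /mul_ddw /k1 /k2; ring.
Qed.

Let card4 : (4 <= #|I|)%N. Proof. by rewrite card_ord. Qed.

Let xsum z : \sum_(al : I) xcoord al z ^+ 2 <= u z.
Proof. by rewrite /u -/(xsq z) lerDl ltW. Qed.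

Let dJ_sum z : oslab T z ->
  mu * (1 - 2 * mu) * (kdel L (u z) * k z * hq z) + \sum_al dJ al z <=
  mul_src (k z) (th z) z.
Proof.
move=> zT; have uz := u_gt0 z.
rewrite /dJ (current1_sum_mink _ _ _ _ _ _ _ _ _
  (fun i j => wHsym D i j z) (fun i j => wssym D i j z zT)).
have eE (al : I) : @esgn R n al = if al == ord0 then 1 else -1 by [].
have coer := mul_coercive mu_gt0 mu_lt L_ge1 uz card4 (phi z) (xcoord0 z)
  eE (xsum z) (wq_sqr D z).
have err := mul_err_bound ord0 mu_gt0 mu_lt L_ge1 uz card4 (phi z) (xsum z)
  (wq_sqr D z) (wq_ge0 D z) (fun i j => wH_le D i j z) (fun k i j => wdH_le D k i j z).
have Nb := mul_N_bound mu_gt0 mu_lt L_ge1 uz card4 (phi z) (xsum z) (wq_sqr D z)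
  (wq_ge0 D z).
rewrite card_ord -/(xsq z) -/(k z) -/(k1 z) -/(k2 z) in err Nb coer.
apply: (@le_trans _ _ (`|wF D z| * (N * (wq D z + k z * `|phi z|)) +
  4 * N ^+ 3 * (wdh D z * wq D z ^+ 2 + wdh D z * (`|phi z| * wq D z) * k z +
    whh D z * wq D z ^+ 2 * k z + whh D z * (`|phi z| * wq D z) * th z))); last first.
  by rewrite /mul_src mulrCA.
have {}Nb := ler_wpM2l (normr_ge0 (wF D z)) Nb; rewrite -normrM in Nb.
have {}Nb := le_trans (ler_norm _) Nb.
have {}err := le_trans (ler_norm _) err.
have -> : mu * (1 - 2 * mu) * (kdel L (u z) * k z * hq z) =
  mu * (1 - 2 * mu) * (kdel L (u z) * k z) * (wq D z ^+ 2 + phi z ^+ 2 / u z).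
  by rewrite /hq !mulrA.
apply: le_trans (_ : _ <= _) (lerD Nb err).
rewrite addrA lerD2r addrCA; rewrite gerDl; move: coer.
move=> h; rewrite addrC -lerBrDr sub0r; exact: h.
Qed.

Let J_bound al z : `|J al z| <= 3 * N * hq z.
Proof.
have := mul_current_bound mu_gt0 mu_lt L_ge1 (u_gt0 z) card4 (phi z)
  (fun al => erefl : @esgn R n al = if al == ord0 then 1 else -1) (xsum z)
  (wq_sqr D z) (wq_ge0 D z) (wHhalf D z) al.
by rewrite card_ord.
Qed.

Local Notation S := (\int[lebesgue_tx n]_(z in oslab T) (energy_src D z)%:E)%E.
Local Notation E0 := (wenergy D 0).
Local Notation cs := (cspeed n : R).

Let SE_ge0 : (0 <= S + E0)%E.
Proof.
apply: adde_ge0; apply: integral_ge0 => z _; rewrite lee_fin ?energy_src_ge0//.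
exact: sqr_ge0.
Qed.

Let mS (g : tx -> R) t : continuous g ->
  measurable_fun setT (fun x : 'rV[R]_n => (g (t, x))%:E).
Proof.
move=> cg; apply/measurable_EFinP; apply: continuous_measurable_rV.
exact: continuous_slice.
Qed.

Let hq_int t : 0 <= t <= T ->
  (\int[lebesgue_rV n]_x (hq (t, x))%:E <= 20%:E * (S + E0))%E.
Proof.
move=> tT; have cq := @continuous_wq _ _ _ D; have cp := wcphi D.
have q0 : (0 <= wenergy D t)%E.
  by apply: integral_ge0 => x _; rewrite lee_fin sqr_ge0.
rewrite /hq; under eq_integral do rewrite EFinD.
rewrite ge0_integralD//; last 4 first.
- by move=> x _; rewrite lee_fin sqr_ge0.
- by apply: (mS (g := fun z => wq D z ^+ 2)); cont.
- by move=> x _; rewrite lee_fin divr_ge0 ?sqr_ge0 ?(ltW (u_gt0 _)).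
- by apply: (mS (g := fun z => phi z ^+ 2 / u z)); cont.
apply: (@le_trans _ _ (wenergy D t + 4%:E * wenergy D t)%E).
  apply: leeD => //; exact: (hardy n_ge3 D eps_gt0 tT).
have -> : (wenergy D t + 4%:E * wenergy D t = 5%:E * wenergy D t)%E.
  rewrite -{1}(mul1e (wenergy D t)) -ge0_muleDl ?lee_fin//.
have -> : 20 = 5 * 4 :> R by ring.
rewrite EFinM -muleA; apply: lee_wpmul2l; first by rewrite lee_fin.
exact: energy_estimate.
Qed.

(** The factor 20 is 4 from the energy estimate times 1 + 4 from Hardy's inequality. This controls
    the error of the cutoff below and, with [eps = 1], the region far from the axis. *)
Lemma energy_hardy_slab :
  (\int[lebesgue_tx n]_(z in oslab T) (hq z)%:E <= T%:E * (20%:E * (S + E0)))%E.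
Proof.
have T0 := wT D.
have mh : measurable_fun setT (fun z : measurableTypeR R * 'rV[R]_n => (hq z)%:E).
  by apply/measurable_EFinP; exact: continuous_measurable_txV.
rewrite (ge0_slab_integral (u := fun z => (hq z)%:E)); last 2 first.
- exact: measurable_funTS.
- by move=> z _; rewrite lee_fin.
have -> : (T%:E * (20%:E * (S + E0)) =
    \int[lebesgue_measure]_(t in `]0%R, T[) (20%:E * (S + E0)))%E.
  rewrite integral_cst//= lebesgue_measure_itv /= lte_fin T0 sube0 muleC//.
apply: ge0_le_integral => //.
- by move=> t _; apply: integral_ge0 => x _; rewrite lee_fin.
- apply: measurable_funTS.
  apply: (@measurable_fun_fubini_tonelli_F _ _ _ _ _ (lebesgue_rV n)
    (fun z : measurableTypeR R * 'rV[R]_n => (hq z)%:E)); first exact: mh.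
  by move=> z; rewrite lee_fin.
- by move=> t; rewrite /= in_itv /= => /andP[t0 t1]; apply: hq_int; rewrite !ltW.
Qed.

(** The first term bounds the gradient of the cutoff, [6 N ^ 2 (2 + cs) / rho] times [20 T] with
    [T <= rho]; the second one the two faces of the slab, [3 N * 20] each. *)
Definition mul_const : R := 120 * N ^+ 2 * (2 + cs) + 120 * N.

Lemma mul_estimate :
  (\int[lebesgue_tx n]_(z in oslab T)
     (mu * (1 - 2 * mu) * (kdel L (u z) * k z * hq z))%:E <=
   \int[lebesgue_tx n]_(z in oslab T) (mul_src (k z) (th z) z)%:E +
   mul_const%:E * (S + E0))%E.
Proof.
have T0 := wT D.
have W0 z : 0 <= mu * (1 - 2 * mu) * (kdel L (u z) * k z * hq z).
  have /andP[d0 _] := kdel_bound mu_gt0 mu_lt L_ge1 (u_gt0 z).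
  apply: mulr_ge0; first by apply: mulr_ge0; have := mu_gt0; have := mu_lt; lra.
  by apply: mulr_ge0 => //; apply: mulr_ge0 => //; exact: ltW.
have cW : continuous (fun z => mu * (1 - 2 * mu) * (kdel L (u z) * k z * hq z)).
  by cont.
have cs0 : 0 < 2 + cs by rewrite ltr_wpDl// cspeed_gt0.
(* Radii that are multiples of [T] keep the error of the cutoff, of order [T / rho] times the energy
   bound, below a multiple of that bound depending on [n] only. *)
apply: (@fatou_le _ _ _ (lebesgue_tx n) (oslab T) (fun i z =>
  cutoff (T * i.+1%:R) z * (mu * (1 - 2 * mu) * (kdel L (u z) * k z * hq z)))).
- exact: measurable_oslab.
- move=> i; apply: measurable_funTS; apply: continuous_measurable_txV.
  by have cc := @continuous_cutoff R n (T * i.+1%:R); cont.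
- by move=> i z _; apply: mulr_ge0 => //; exact: cutoff_ge0.
- move=> z _; rewrite -[X in _ --> X]mul1r; apply: cvgM; last exact: cvg_cst.
  exact: cvg_cutoff_scaled.
move=> i; pose rho : R := T * i.+1%:R; rewrite -/rho.
have rho0 : 0 < rho by rewrite mulr_gt0.
have Trho : T <= rho by rewrite ler_peMr ?ler1n// ltW.
pose fl : R := 6 * N ^+ 2 * (2 + cs) / rho.
have fl0 : 0 <= fl.
  by apply: divr_ge0; [apply: mulr_ge0; [rewrite mulr_ge0 ?exprn_ge0|exact: ltW]|exact: ltW].
have ccut := @continuous_cutoff R n rho; have cdcut := @continuous_dcutoff R n rho.
have ct (z : tx) : slab T z -> 0 <= z.1 by case/andP.
have ost (z : tx) : oslab T z -> 0 <= z.1 by case/andP => h1 h2; exact: ltW.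
have c1 := @continuous_wG _ _ _ D; have c2 := wcp D; have c3 := wcphi D.
have c4 := wcs D; have c5 := wcdH D.
have cX := @continuous_xcoord R n.
have cY al : continuous (Y al) by rewrite /Y /mul_Y; cont.
have cw : continuous w by rewrite /w /mul_w; cont.
have cdw al : continuous (dw al) by rewrite /dw /mul_dw; cont.
have cdY al be : continuous (dY al be) by rewrite /dY /mul_dY; cont.
have cddw al be : continuous (ddw al be) by rewrite /ddw /mul_ddw; cont.
have cJ al : continuous (J al).
  exact: (@continuous_current _ _ _ (wG D) p Y w phi dw).
have cdJ al : continuous (dJ al).
  exact: (@continuous_current1 _ _ _ (wG D) p Y w phi dw _ dH s dY ddw).
have N0 : 0 <= 3 * N by rewrite mulr_ge0.
have := @slab_divergence_le R n T rho (fun al z => cutoff rho z * J al z)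
  (fun al z => dcutoff rho al z * J al z + cutoff rho z * dJ al z)
  (fun z => cutoff rho z * (mu * (1 - 2 * mu) * (kdel L (u z) * k z * hq z)))
  (fun z => mul_src (k z) (th z) z + fl * hq z)
  (fun x => 3 * N * hq (0, x)) (fun x => 3 * N * hq (T, x)) (fun=> 0) T0.
rewrite integral0 adde0 => M.
have cS (g : tx -> R) v : continuous g -> continuous (fun x => g (v, x)).
  exact: continuous_slice.
apply: le_trans (M _ _ _ _ _ _ _ _ _ _ _ _ _ _ _ _ _) _; clear M.
- by move=> al; cont.
- by move=> al; cont.
- move=> al z zt; apply: is_deriveM_fun; first exact: is_derive_cutoff.
  exact: DJ.
- by move=> al z zt; rewrite mulf_eq0 negb_or => /andP[h _]; apply: cutoff_box h; auto.
- by cont.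
- by cont.
- by apply: (cS (fun z => 3 * N * hq z)); cont.
- by apply: (cS (fun z => 3 * N * hq z)); cont.
- exact: cst_continuous.
- by move=> z; apply: mulr_ge0 => //; exact: cutoff_ge0.
- by move=> z; apply: addr_ge0; [exact: mul_src_ge0|exact: mulr_ge0].
- by move=> x; exact: mulr_ge0.
- by move=> x; exact: mulr_ge0.
- by [].
- move=> z zt; rewrite big_split /= -mulr_sumr addrCA addrC; apply: lerD.
    rewrite -mulrDr; apply: le_trans (ler_wpM2l (cutoff_ge0 _ _) (dJ_sum zt)) _.
    rewrite ler_piMl ?mul_src_ge0// cutoff_le1//; exact: ost.
  apply: le_trans (ler_norm _) _.
  have := @ler_norm_sum_card R _ (fun al => dcutoff rho al z * J al z)
    (2 * (2 + cs) / rho * (3 * N * hq z)).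
  rewrite card_ord => /(_ _)/le_trans; apply.
    move=> al; rewrite normrM; apply: ler_pM => //; apply: dcutoff_bound => //.
    exact: ost.
  by rewrite le_eqVlt; apply/orP; left; apply/eqP; rewrite /fl; ring.
- move=> x; apply: le_trans (ler_norm _) _; rewrite normrM -[leRHS]mul1r.
  apply: ler_pM => //; rewrite ger0_norm ?cutoff_ge0//; exact: cutoff_le1.
- move=> x; rewrite -lerBlDr sub0r lerNl; apply: le_trans (ler_norm _) _.
  rewrite normrN normrM -[leRHS]mul1r.
  apply: ler_pM => //; rewrite ger0_norm ?cutoff_ge0//; apply: cutoff_le1 => //.
  exact: ltW.
have mO := @measurable_oslab R n T.
have mtx (g : tx -> R) : continuous g ->
    measurable_fun (oslab T : set (measurableTypeR R * 'rV[R]_n)) (fun z => (g z)%:E).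
  move=> cg; apply: measurable_funTS; apply/measurable_EFinP.
  exact: continuous_measurable_txV.
under eq_integral do rewrite EFinD.
rewrite ge0_integralD//; last 4 first.
- by move=> z _; rewrite lee_fin; exact: mul_src_ge0.
- exact: mtx.
- by move=> z _; rewrite lee_fin; exact: mulr_ge0.
- by apply: mtx; cont.
rewrite -addeA -addeA; apply: leeD => //.
have -> : (\int[lebesgue_tx n]_(z in oslab T) (fl * hq z)%:E =
    fl%:E * \int[lebesgue_tx n]_(z in oslab T) (hq z)%:E)%E.
  rewrite -ge0_integralZl_EFin//.
  - by move=> x _; rewrite lee_fin.
  - exact: mtx.
have hint t : (\int[lebesgue_rV n]_x (3 * N * hq (t, x))%:E =
    (3 * N)%:E * \int[lebesgue_rV n]_x (hq (t, x))%:E)%E.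
  rewrite -ge0_integralZl_EFin//.
  - by move=> x _; rewrite lee_fin.
  - exact: mS.
rewrite !hint.
apply: (@le_trans _ _ (fl%:E * (T%:E * (20%:E * (S + E0))) +
  ((3 * N)%:E * (20%:E * (S + E0)) + (3 * N)%:E * (20%:E * (S + E0))))%E).
  apply: leeD; first by apply: lee_wpmul2l => //; exact: energy_hardy_slab.
  by apply: leeD; apply: lee_wpmul2l => //; apply: hq_int; rewrite lexx ltW.
have b1 : 0 <= fl * T * 20 by rewrite mulr_ge0// mulr_ge0// ltW.
have b2 : 0 <= 3 * N * 20 by rewrite mulr_ge0.
rewrite !muleA -!EFinM -!ge0_muleDl ?lee_fin ?addr_ge0//.
apply: lee_wpmul2r => //; rewrite lee_fin /mul_const.
have : fl * T * 20 <= 120 * N ^+ 2 * (2 + cs).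
  rewrite /fl (_ : _ * 20 = 120 * N ^+ 2 * (2 + cs) * (T / rho)); last by ring.
  rewrite ger_pMr ?ler_pdivrMr ?mul1r// mulr_gt0// mulr_gt0// exprn_gt0//.
lra.
Qed.

End regularized.
End multiplier.

(** * Removal of the regularisation *)

Lemma powR_sqrt {R : realType} (s x : R) : 0 <= s -> Num.sqrt s `^ x = s `^ (x / 2).
Proof. by move=> s0; rewrite -powR12_sqrt// -powRrM mulrC. Qed.

Lemma sqr_powR {R : realType} (s x : R) : (s `^ x) ^+ 2 = s `^ (2 * x).
Proof. by rewrite -powR_mulrn ?powR_ge0// -powRrM mulrC. Qed.

(** A point of space is a box with sides of length 0, so the axis [x = 0] is a null set. The
    comparison of the singular weights has to avoid it. *)
Lemma lebesgue_tx_axis {R : realType} n (P : set (R * 'rV[R]_n)) : (0 < n)%N ->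
  (forall z, z.2 != 0 -> P z) -> {ae lebesgue_tx n, forall z, P z}.
Proof.
case: n P => // n P _ zP.
pose A : set 'rV[R]_n.+1 := [set x | forall i, [set 0] (x 0 i)].
have A0 : lebesgue_rV n.+1 A = 0%E.
  by rewrite (lebesgue_rV_box (A := fun=> [set 0]))// big_ord_recl lebesgue_measure_set1 mul0e.
have AE : A = [set 0].
  apply/seteqP; split => [x /= Ax|x /= -> i]; last by rewrite mxE.
  by apply/rowP => i; rewrite Ax mxE.
have mA : measurable A.
  by apply: (measurable_rect (A := fun=> [set 0])) => i; exact: measurable_set1.
exists (setT `*` A); split.
- exact: measurableX.
- have := @product_measure1E _ _ _ _ _ (@lebesgue_measure R) (lebesgue_rV n.+1) setT A
    measurableT mA.
  by rewrite A0 mule0.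
- move=> z /= nP; split => //; rewrite AE; apply/eqP; apply: contra_notT nP.
  exact: zP.
Qed.

Section slab_measurability.
Context {R : realType} (n : nat).
Local Notation mtx := (measurableTypeR R * 'rV[R]_n)%type.

Lemma measurable_EFin_oslab T (g : mtx -> R) : measurable_fun setT g ->
  measurable_fun (oslab T : set mtx) (fun z => (g z)%:E).
Proof. by move=> mg; apply/measurable_EFinP; exact: measurable_funTS. Qed.

Lemma measurable_xsq_powR x : measurable_fun setT ((fun z => xsq z `^ x) : mtx -> R).
Proof.
apply: (measurableT_comp (measurable_powR x)); apply: continuous_measurable_txV.
exact: continuous_xsq.
Qed.

Lemma measurable_kw_xsq mu L :
  measurable_fun setT ((fun z => kw mu L (xsq z)) : mtx -> R).
Proof.
apply: measurable_funM; first exact: measurable_xsq_powR.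
apply: (measurableT_comp (measurable_powR (- mu))).
apply: measurable_funD; first exact: measurable_cst.
by apply: continuous_measurable_txV; exact: continuous_xsq.
Qed.

Lemma measurable_div_xsq (g : R * 'rV[R]_n -> R) : continuous g ->
  measurable_fun setT ((fun z => g z / xsq z) : mtx -> R).
Proof.
(* Inversion is not continuous at 0, but real powers are measurable, and the power -1 has the same
   value 0 there. *)
move=> cg; have -> : (fun z : mtx => g z / xsq z) = (fun z => g z * xsq z `^ (-1)).
  by apply/funext => z; rewrite powR_inv1 ?xsq_ge0.
apply: measurable_funM; last exact: measurable_xsq_powR.
exact: continuous_measurable_txV.
Qed.

End slab_measurability.

Section limit.
Context {R : realType} (n : nat).
Hypothesis n_ge3 : (3 <= n)%N.
Local Notation I := 'I_n.+1.
Local Notation tx := (R * 'rV[R]_n)%type.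
Local Notation mtx := (measurableTypeR R * 'rV[R]_n)%type.
Local Notation N := (n.+1%:R : R).
Variables (T : R) (D : wave_data n T) (mu : R).
Hypotheses (mu_gt0 : 0 < mu) (mu_lt : mu < 1 / 2).
Local Notation phi := (wphi D).
Local Notation q := (wq D).
Local Notation dh := (wdh D).
Local Notation hh := (whh D).
Local Notation F := (wF D).

(* [1 / (r ^ (1 - 2 mu) <r> ^ (2 mu))] and [1 / (r ^ (2 - 2 mu) <r> ^ (2 mu))]. *)
Definition wK (z : tx) : R := kw mu 1 (xsq z).
Definition wTH (z : tx) : R := wK z / Num.sqrt (xsq z).

(** The integrand on the right of the theorem, with the perturbed wave operator applied to [phi] in
    the place of [F]. *)
Definition rhs_src (z : tx) : R :=
  q z * `|F z| + `|phi z| * `|F z| * wK z + dh z * q z ^+ 2 +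
  dh z * (`|phi z| * q z) * wK z + hh z * q z ^+ 2 * wK z +
  hh z * (`|phi z| * q z) * wTH z.

Let wK_ge0 z : 0 <= wK z.
Proof. by apply: mulr_ge0; exact: powR_ge0. Qed.

Let wTH_ge0 z : 0 <= wTH z.
Proof. by rewrite divr_ge0// sqrtr_ge0. Qed.

Let hh0 z : 0 <= hh z. Proof. exact: eucl_ge0. Qed.
Let dh0 z : 0 <= dh z. Proof. exact: eucl_ge0. Qed.
Let q0 z : 0 <= q z. Proof. exact: eucl_ge0. Qed.

Lemma rhs_src_ge0 z : 0 <= rhs_src z.
Proof.
have := hh0 z; have := dh0 z; have := q0 z; have := wK_ge0 z; have := wTH_ge0 z.
move=> t0 k0 qq0 d0 h0; have p0 := normr_ge0 (phi z); have f0 := normr_ge0 (F z).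
by rewrite /rhs_src; repeat apply: addr_ge0; repeat apply: mulr_ge0 => //;
  rewrite ?exprn_ge0.
Qed.

Let N1 : 1 <= N. Proof. by rewrite ler1n. Qed.

Let N3 : N <= N ^+ 3 /\ 1 <= N ^+ 3.
Proof. by split; [rewrite -[leLHS]expr1 ler_weXn2l|rewrite exprn_ege1]. Qed.

Lemma mul_src_rhs z : mul_src D (wK z) (wTH z) z <= 4 * N ^+ 3 * rhs_src z.
Proof.
have [h1 h2] := N3.
have a0 : 0 <= `|F z| * (q z + wK z * `|phi z|).
  by rewrite mulr_ge0 ?addr_ge0// mulr_ge0.
apply: (@le_trans _ _ (4 * N ^+ 3 * (`|F z| * (q z + wK z * `|phi z|)) +
  4 * N ^+ 3 * (dh z * q z ^+ 2 + dh z * (`|phi z| * q z) * wK z +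
    hh z * q z ^+ 2 * wK z + hh z * (`|phi z| * q z) * wTH z))).
  by rewrite lerD2r ler_wpM2r//; lra.
by rewrite -mulrDr ler_wpM2l ?mulr_ge0 ?exprn_ge0//; rewrite /rhs_src le_eqVlt;
  apply/orP; left; apply/eqP; ring.
Qed.

Lemma energy_src_rhs z : energy_src D z <= 2 * N ^+ 3 * rhs_src z.
Proof.
have [h1 h2] := N3.
apply: (@le_trans _ _ (2 * N ^+ 3 * (q z * `|F z| + dh z * q z ^+ 2))).
  rewrite mulrDr /energy_src mulrA lerD2r mulrC -[leLHS]mul1r ler_wpM2r ?mulr_ge0//.
  lra.
rewrite ler_wpM2l ?mulr_ge0 ?exprn_ge0// /rhs_src.
have k1 := wK_ge0 z; have t1 := wTH_ge0 z; have d1 := dh0 z; have e1 := hh0 z.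
have q1 := q0 z.
have x1 : 0 <= `|phi z| * `|F z| * wK z by apply: mulr_ge0 => //; exact: mulr_ge0.
have x2 : 0 <= dh z * (`|phi z| * q z) * wK z by do 2 apply: mulr_ge0 => //; exact: mulr_ge0.
have x3 : 0 <= hh z * q z ^+ 2 * wK z by apply: mulr_ge0 => //; apply: mulr_ge0 => //; exact: exprn_ge0.
have x4 : 0 <= hh z * (`|phi z| * q z) * wTH z by do 2 apply: mulr_ge0 => //; exact: mulr_ge0.
lra.
Qed.

Let mc (g : tx -> R) : continuous g -> measurable_fun setT (g : mtx -> R).
Proof. exact: continuous_measurable_txV. Qed.

Let mwTH : measurable_fun setT (wTH : mtx -> R).
Proof.
apply: measurable_funM; first exact: measurable_kw_xsq.
have -> : (fun z : mtx => (Num.sqrt (xsq z))^-1) = (fun z => xsq z `^ (- 2^-1)).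
  by apply/funext => z; rewrite powRN powR12_sqrt// xsq_ge0.
exact: measurable_xsq_powR.
Qed.

Lemma measurable_rhs_src : measurable_fun setT (rhs_src : mtx -> R).
Proof.
have c1 := @continuous_wF _ _ _ D; have c2 := @continuous_wq _ _ _ D.
have c3 := @continuous_wdh _ _ _ D; have c4 := @continuous_whh _ _ _ D.
have c5 := wcphi D.
have mk : measurable_fun setT (wK : mtx -> R) by exact: measurable_kw_xsq.
have mt := mwTH.
rewrite /rhs_src.
apply: measurable_funD; last first.
  by apply: measurable_funM => //; apply: mc; cont.
apply: measurable_funD; last first.
  by apply: measurable_funM => //; apply: mc; cont.
apply: measurable_funD; last first.
  by apply: measurable_funM => //; apply: mc; cont.
apply: measurable_funD; last by apply: mc; cont.
apply: measurable_funD; first by apply: mc; cont.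
by apply: measurable_funM => //; apply: mc; cont.
Qed.

Local Notation II := (\int[lebesgue_tx n]_(z in oslab T) (rhs_src z)%:E)%E.
Local Notation S := (\int[lebesgue_tx n]_(z in oslab T) (energy_src D z)%:E)%E.
Local Notation E0 := (wenergy D 0).

Lemma rhs_src_int_ge0 : (0 <= II)%E.
Proof. by apply: integral_ge0 => z _; rewrite lee_fin rhs_src_ge0. Qed.

Let E0_ge0 : (0 <= E0)%E.
Proof. by apply: integral_ge0 => x _; rewrite lee_fin sqr_ge0. Qed.

Let B_ge0 : (0 <= II + E0)%E. Proof. by apply: adde_ge0 => //; exact: rhs_src_int_ge0. Qed.

Let mE (g : tx -> R) : measurable_fun setT (g : mtx -> R) ->
  measurable_fun (oslab T : set mtx) (fun z => (g z)%:E).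
Proof. exact: measurable_EFin_oslab. Qed.

Lemma energy_src_int_le : (S + E0 <= (2 * N ^+ 3)%:E * (II + E0))%E.
Proof.
have [h1 h2] := N3.
have c0 : 0 <= 2 * N ^+ 3 by lra.
have i0 := rhs_src_int_ge0; rewrite ge0_muleDr//; apply: leeD; last first.
  by rewrite -[leLHS]mul1e; apply: lee_wpmul2r => //; rewrite lee_fin; lra.
rewrite -ge0_integralZl_EFin//; last 3 first.
- exact: measurable_oslab.
- by move=> z _; rewrite lee_fin rhs_src_ge0.
- exact: (mE measurable_rhs_src).
apply: ge0_le_integral.
- exact: measurable_oslab.
- by move=> z _; rewrite lee_fin energy_src_ge0.
- by apply: mE; apply: mc; exact: continuous_energy_src.
- have := emeasurable_funM (@measurable_cst _ _ _ _ (oslab T : set mtx) (2 * N ^+ 3)%:E)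
    (mE measurable_rhs_src); exact.
- by move=> z _; rewrite -EFinM lee_fin energy_src_rhs.
Qed.

Definition bulk (L : R) (z : tx) : R :=
  kdel L (xsq z) * kw mu L (xsq z) * (q z ^+ 2 + phi z ^+ 2 / xsq z).

Lemma bulk_ge0 L z : 0 <= bulk L z.
Proof.
have s0 := xsq_ge0 z.
apply: mulr_ge0; last by rewrite addr_ge0 ?sqr_ge0 ?divr_ge0 ?sqr_ge0.
apply: mulr_ge0; first by rewrite divr_ge0 ?addr_ge0 ?sqr_ge0.
by apply: mulr_ge0; exact: powR_ge0.
Qed.

Lemma measurable_bulk L : measurable_fun setT (bulk L : mtx -> R).
Proof.
have c2 := @continuous_wq _ _ _ D; have c5 := wcphi D; have cx := @continuous_xsq R n.
have lx z : 0 <= L ^+ 2 + xsq z by rewrite addr_ge0 ?sqr_ge0 ?xsq_ge0.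
apply: measurable_funM.
  apply: measurable_funM; last exact: measurable_kw_xsq.
  apply: measurable_funM; first exact: measurable_cst.
  have -> : (fun z : mtx => (L ^+ 2 + xsq z)^-1) = (fun z => (L ^+ 2 + xsq z) `^ (-1)).
    by apply/funext => z; rewrite powR_inv1.
  by apply: (measurableT_comp (measurable_powR (-1))); apply: mc; cont.
apply: measurable_funD; first by apply: mc; cont.
by apply: measurable_div_xsq; cont.
Qed.

(** The constant of [mul_src_rhs], plus the boundary constant [mul_const] times that of
    [energy_src_int_le], divided by the coercivity constant. *)
Definition bulk_const : R :=
  (4 * N ^+ 3 + mul_const n * (2 * N ^+ 3)) / (mu * (1 - 2 * mu)).

Lemma mul_coef_gt0 : 0 < mu * (1 - 2 * mu).
Proof. by rewrite mulr_gt0//; have := mu_lt; lra. Qed.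

Lemma mul_const_ge0 : 0 <= mul_const n :> R.
Proof.
rewrite /mul_const; have := @cspeed_gt0 R n => c0.
by rewrite addr_ge0 ?mulr_ge0 ?exprn_ge0 ?addr_ge0// ltW.
Qed.

Lemma bulk_const_ge0 : 0 <= bulk_const.
Proof.
apply: divr_ge0; last exact/ltW/mul_coef_gt0.
by apply: addr_ge0; [rewrite mulr_ge0 ?exprn_ge0|
  apply: mulr_ge0; [exact: mul_const_ge0|rewrite mulr_ge0 ?exprn_ge0]].
Qed.

Lemma bulk_estimate L : 1 <= L ->
  (\int[lebesgue_tx n]_(z in oslab T) (bulk L z)%:E <= bulk_const%:E * (II + E0))%E.
Proof.
move=> L1; have [n1 n2] := N3; have mul_coef_gt0 := mul_coef_gt0; have mul_const_ge0 := mul_const_ge0.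
have mO := @measurable_oslab R n T.
rewrite -(@lee_pmul2l _ (mu * (1 - 2 * mu))%:E)//.
rewrite muleA -EFinM /bulk_const mulrCA mulfV ?gt_eqF// mulr1.
rewrite -ge0_integralZl_EFin ?(ltW mul_coef_gt0)//; last 2 first.
- by move=> z _; rewrite lee_fin bulk_ge0.
- exact: mE (measurable_bulk L).
under eq_integral do rewrite -EFinM.
pose e k : R := k.+1%:R^-1.
have e0 k : 0 < e k by rewrite invr_gt0.
have se k (z : tx) : 0 < xsq z + e k by rewrite ltr_wpDl// xsq_ge0.
have c2 := @continuous_wq _ _ _ D; have c5 := wcphi D; have cx := @continuous_xsq R n.
pose G y z := mu * (1 - 2 * mu) * (kdel L y * kw mu L y * (q z ^+ 2 + phi z ^+ 2 / y)).
have G0 y z : 0 < y -> 0 <= G y z.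
  move=> y0; rewrite /G (mulr_ge0 (ltW mul_coef_gt0))//; apply: mulr_ge0; last first.
    by rewrite addr_ge0 ?sqr_ge0// divr_ge0 ?sqr_ge0 ?ltW.
  have /andP[k0 _] := kdel_bound mu_gt0 mu_lt L1 y0.
  by apply: mulr_ge0; [exact: ltW|apply: ltW; exact: kw_gt0].
have cG k : continuous (fun z => G (xsq z + e k) z).
  have cu : continuous (fun z : tx => xsq z + e k) by cont.
  have cV : continuous (fun z : tx => (xsq z + e k)^-1).
    by apply: continuousV_fun => // z; rewrite lt0r_neq0.
  have cd : continuous (fun z : tx => kdel L (xsq z + e k)).
    have c1 : continuous (fun z : tx => (L ^+ 2 + (xsq z + e k))^-1).
      apply: continuousV_fun => [z|]; last by cont.
      by rewrite lt0r_neq0// ltr_wpDl ?sqr_ge0.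
    by rewrite /kdel; cont.
  have ck : continuous (fun z : tx => kw mu L (xsq z + e k)).
    move=> z; apply: (@continuous_comp _ _ _ (fun z : tx => xsq z + e k) (kw mu L)).
      exact: cu.
    exact: continuous_kw.
  by rewrite /G; cont.
have cH k : continuous (fun z => xsq z / (xsq z + e k) * G (xsq z + e k) z).
  have cV : continuous (fun z : tx => (xsq z + e k)^-1).
    by apply: continuousV_fun => [z|]; [rewrite lt0r_neq0|cont].
  by have cGk := cG k; cont.
have H0 k z : 0 <= xsq z / (xsq z + e k) * G (xsq z + e k) z.
  by apply: mulr_ge0; [apply: divr_ge0; [exact: xsq_ge0|exact: ltW (se k z)]|exact: G0].
(* The factor [xsq z / (xsq z + e k)] is at most 1 and tends to 1 off the axis. On the axis it makes
   the approximations vanish, as [bulk] does there because a nonzero power of 0 is 0; without it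
   they could blow up. *)
apply: (@fatou_le _ _ _ (lebesgue_tx n) (oslab T)
  (fun k z => xsq z / (xsq z + e k) * G (xsq z + e k) z)) => //.
- by move=> k; apply: measurable_funTS; exact: mc.
- move=> z _.
  have [s0|sn0] := eqVneq (xsq z) 0.
    rewrite /bulk s0 /kw powR0 ?mul0r ?mulr0 ?mul0r ?mulr0; last first.
      by rewrite oppr_eq0 gt_eqF//; have := mu_lt; lra.
    by under eq_fun do rewrite !mul0r; exact: cvg_cst.
  have s0 : 0 < xsq z by rewrite lt_neqAle eq_sym sn0 xsq_ge0.
  have ce : (fun k => xsq z + e k) @ \oo --> xsq z.
    by rewrite -[X in _ --> X]addr0; apply: cvgD; [exact: cvg_cst|exact: cvg_harmonic].
  have ceV : (fun k => (xsq z + e k)^-1) @ \oo --> (xsq z)^-1 by exact: cvgV.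
  rewrite -[X in _ --> X]mul1r -[X in X * _](@mulfV _ (xsq z))//.
  apply: cvgM; first by apply: cvgM => //; exact: cvg_cst.
  apply: cvgM; first exact: cvg_cst.
  apply: cvgM; first apply: cvgM.
  + apply: cvgM; first exact: cvg_cst.
    apply: cvgV; first by rewrite gt_eqF// ltr_wpDl ?sqr_ge0.
    by apply: cvgD => //; exact: cvg_cst.
  + by apply: (cvg_comp _ _ ce); exact: continuous_kw.
  + apply: cvgD; first exact: cvg_cst.
    by apply: cvgM => //; exact: cvg_cst.
move=> k.
have est := mul_estimate n_ge3 D mu_gt0 mu_lt L1 (e0 k).
apply: (@le_trans _ _
  (\int[lebesgue_tx n]_(z in oslab T) (G (xsq z + e k) z)%:E)%E).
  apply: ge0_le_integral => //.
  - by move=> z _; rewrite lee_fin.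
  - by apply: mE; exact: mc.
  - by apply: mE; exact: mc.
  - move=> z _; rewrite lee_fin -[leRHS]mul1r; apply: ler_wpM2r; first exact: G0.
    by rewrite ler_pdivrMr// mul1r lerDl ltW.
apply: le_trans est _.
have k0 (z : tx) : 0 <= kw mu L (xsq z + e k) by apply/ltW/kw_gt0.
have t0 (z : tx) : 0 <= kw mu L (xsq z + e k) * Num.sqrt (xsq z) / (xsq z + e k).
  by apply: divr_ge0; [rewrite mulr_ge0// sqrtr_ge0|exact: ltW (se k z)].
apply: (@le_trans _ _ ((4 * N ^+ 3)%:E * (II + E0) +
  (mul_const n * (2 * N ^+ 3))%:E * (II + E0))%E); last first.
  by rewrite -ge0_muleDl ?lee_fin ?mulr_ge0 ?exprn_ge0.
apply: leeD; last first.
  by rewrite EFinM -muleA; apply: lee_wpmul2l; [rewrite lee_fin|exact: energy_src_int_le].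
apply: (@le_trans _ _ ((4 * N ^+ 3)%:E * II)%E); last first.
  apply: lee_wpmul2l; first by rewrite lee_fin mulr_ge0 ?exprn_ge0.
  exact: leeDl.
rewrite -ge0_integralZl_EFin//; last 2 first.
- by move=> z _; rewrite lee_fin rhs_src_ge0.
- exact: mE measurable_rhs_src.
apply: ae_ge0_le_integral => //.
- by move=> z _; rewrite lee_fin; exact: mul_src_ge0.
- apply: mE; apply: mc.
  have c1 := @continuous_wF _ _ _ D; have c3 := @continuous_wdh _ _ _ D.
  have c4 := @continuous_whh _ _ _ D.
  have cV : continuous (fun z : tx => (xsq z + e k)^-1).
    by apply: continuousV_fun => [z|]; [rewrite lt0r_neq0|cont].
  have cu : continuous (fun z : tx => xsq z + e k) by cont.
  have ck : continuous (fun z : tx => kw mu L (xsq z + e k)).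
    move=> z; apply: (@continuous_comp _ _ _ (fun z : tx => xsq z + e k) (kw mu L)).
      exact: cu.
    exact: continuous_kw.
  have cs : continuous (fun z : tx => Num.sqrt (xsq z)) by exact: continuous_sqrt_fun.
  by rewrite /mul_src; cont.
- by move=> z _; rewrite -EFinM lee_fin mulr_ge0 ?rhs_src_ge0// mulr_ge0 ?exprn_ge0.
- exact: emeasurable_funM (mE measurable_rhs_src).
(* On the axis [wK] is 0 by convention while the regularised weight is positive, so the comparison
   holds almost everywhere only. *)
apply: lebesgue_tx_axis; first exact: leq_trans n_ge3.
move=> z z0 _; rewrite -EFinM lee_fin; apply: le_trans (mul_src_rhs z).
have s0 : 0 < xsq z.
  rewrite lt_neqAle xsq_ge0 andbT eq_sym; apply: contra z0.
  rewrite xsqE sqrf_eq0 => /eqP x0; apply/eqP/rowP => i; rewrite mxE.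
  by apply/eqP; rewrite -normr_le0 -x0; exact: (le_eucl (fun i => z.2 0 i)).
have kk : kw mu L (xsq z + e k) <= wK z.
  apply: le_trans (kw_le (s := xsq z) mu_gt0 mu_lt L1 _) _.
    by rewrite s0 lerDl ltW.
  by rewrite /wK /kw !powRN invfM expr1n.
apply: le_mul_src => //; rewrite /wTH.
have rr : 0 < Num.sqrt (xsq z) by rewrite sqrtr_gt0.
rewrite -mulrA; apply: ler_pM => //.
  by apply: divr_ge0; [exact: sqrtr_ge0|exact: ltW (se k z)].
rewrite ler_pdivrMr// ler_pdivlMl// -expr2 sqr_sqrtr ?(ltW s0)//.
by rewrite lerDl ltW.
Qed.

End limit.

(** * Summation over scales *)

Section weight_comparison.
Context {R : realType} (mu : R).
Hypotheses (mu_gt0 : 0 < mu) (mu_lt : mu < 1 / 2).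
Implicit Types L s : R.

Let powR_mu2 (a b : R) : 0 < a -> 0 < b -> b <= 2 * a ->
  a `^ (- mu) <= 2 * b `^ (- mu).
Proof.
move=> a0 b0 ba; rewrite !powRN ler_pdivlMr ?powR_gt0// mulrC ler_pdivrMr ?powR_gt0//.
apply: (@le_trans _ _ ((2 * a) `^ mu)).
  by apply: ge0_ler_powR; rewrite ?nnegrE ?mulr_ge0// ltW.
rewrite powRM ?(ltW a0)// ler_wpM2r ?powR_ge0//.
by rewrite -[leRHS]powRr1// ler_powR ?ler1n//; have := mu_lt; lra.
Qed.

Let kw_kdel_ge0 L s : 1 <= L -> 0 <= s -> 0 <= kdel L s * kw mu L s.
Proof.
move=> L1 s0; apply: mulr_ge0.
  by rewrite divr_ge0 ?addr_ge0 ?sqr_ge0.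
by apply: mulr_ge0; exact: powR_ge0.
Qed.

(** For [s <= L ^ 2], [kdel L s] is at least 1/2 and [L ^ 2 + s] at most [2 L ^ 2]; each costs a
    factor 2. *)
Lemma near_weight L s : 1 <= L -> 0 <= s <= L ^+ 2 ->
  L `^ (- (2 * mu)) * s `^ (- (1 / 2 - mu)) <= 4 * (kdel L s * kw mu L s).
Proof.
move=> L1 /andP[s0 sL]; have L0 : 0 < L by exact: lt_le_trans L1.
have LL : 0 < L ^+ 2 by rewrite exprn_gt0.
have -> : L `^ (- (2 * mu)) = (L ^+ 2) `^ (- mu).
  by rewrite -powR_mulrn ?(ltW L0)// -powRrM mulrN.
have -> : 4 * (kdel L s * kw mu L s) =
    (2 * kdel L s) * (2 * (L ^+ 2 + s) `^ (- mu)) * s `^ (- (1 / 2 - mu)).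
  by rewrite /kw; ring.
rewrite ler_wpM2r ?powR_ge0//.
apply: (@le_trans _ _ (2 * (L ^+ 2 + s) `^ (- mu))).
  by apply: powR_mu2 => //; [rewrite ltr_pwDl|rewrite mulr_natl mulr2n lerD2l].
rewrite ler_peMl ?mulr_ge0 ?powR_ge0// /kdel mulrA ler_pdivlMr ?ltr_pwDl//.
by rewrite mul1r mulr_natl mulr2n lerD2l.
Qed.

(** The power of [s] decreases, and equality holds at [s = L ^ 2]. *)
Lemma far_weight L s : 1 <= L -> L ^+ 2 <= s ->
  L `^ (- (2 * mu)) * s `^ (- (1 / 2 - mu)) <= L^-1.
Proof.
move=> L1 Ls; have L0 : 0 < L by exact: lt_le_trans L1.
have LL : 0 < L ^+ 2 by rewrite exprn_gt0.
have s0 : 0 < s by exact: lt_le_trans Ls.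
rewrite !powRN -invfM lef_pV2 ?posrE ?mulr_gt0 ?powR_gt0//.
apply: (@le_trans _ _ (L `^ (2 * mu) * (L ^+ 2) `^ (1 / 2 - mu))).
  rewrite -powR_mulrn ?(ltW L0)// -powRrM -powRD; last by apply/implyP => _; rewrite gt_eqF.
  by rewrite (_ : 2 * mu + _ = 1) ?powRr1 ?(ltW L0)//; field.
apply: ler_wpM2l; first exact: powR_ge0.
by apply: ge0_ler_powR; rewrite ?nnegrE ?(ltW LL) ?(ltW s0)//; have := mu_lt; lra.
Qed.

Lemma far_kw L s : 1 <= L -> L ^+ 2 <= s -> kw mu 1 s <= L^-1.
Proof.
move=> L1 Ls; have L0 : 0 < L by exact: lt_le_trans L1.
have s0 : 0 < s by apply: lt_le_trans Ls; rewrite exprn_gt0.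
rewrite -[leRHS]mul1r ler_pdivlMr//.
by apply: kw_sqrt_le => //; exact: ltW.
Qed.

(** The hypotheses make [L] comparable with [<r>]: [s <= 4 L ^ 2] gives [kdel L s >= 1 / 5], and
    [L ^ 2 + s <= 2 (1 + s)] costs another factor 2. *)
Let kw_compare L s : 1 <= L -> 0 <= s -> L ^+ 2 <= 2 + s -> s <= 4 * L ^+ 2 ->
  kw mu 1 s <= 10 * (kdel L s * kw mu L s).
Proof.
move=> L1 s0 Ls sL; have L0 : 0 < L by exact: lt_le_trans L1.
have LL : 0 < L ^+ 2 by rewrite exprn_gt0.
have -> : 10 * (kdel L s * kw mu L s) =
    s `^ (- (1 / 2 - mu)) * ((5 * kdel L s) * (2 * (L ^+ 2 + s) `^ (- mu))).
  by rewrite /kw; ring.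
rewrite /kw expr1n ler_wpM2l ?powR_ge0//.
apply: (@le_trans _ _ (2 * (L ^+ 2 + s) `^ (- mu))).
  by apply: powR_mu2; rewrite ?ltr_pwDl//; lra.
rewrite ler_peMl ?mulr_ge0 ?powR_ge0// /kdel mulrA ler_pdivlMr ?ltr_pwDl//.
lra.
Qed.

(** In the shell [2 ^ j <= r < 2 ^ (j + 1)] the single scale [2 ^ j] suffices, and the scale 1 also
    covers [r < 1]; the other summands are nonnegative. *)
Lemma dyadic_weight m s : 0 <= s -> s < (2 ^+ m.+1) ^+ 2 ->
  kw mu 1 s <= 10 * \sum_(j < m.+1) kdel (2 ^+ j) s * kw mu (2 ^+ j) s.
Proof.
move=> s0; elim: m => [|m IH] sm.
  rewrite big_ord_recl big_ord0 addr0 expr0; apply: kw_compare => //.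
    by rewrite expr1n; lra.
  by move: sm; rewrite expr1n expr1; lra.
have L1 : (1 : R) <= 2 ^+ m.+1 by rewrite exprn_ege1// ler1n.
rewrite big_ord_recr /= mulrDr.
have [/IH h|h] := ltP s ((2 ^+ m.+1) ^+ 2).
  apply: le_trans h _; rewrite lerDl mulr_ge0//; exact: kw_kdel_ge0.
apply: (@le_trans _ _ (10 * (kdel (2 ^+ m.+1) s * kw mu (2 ^+ m.+1) s))).
  apply: kw_compare => //; first lra.
  by move: sm; rewrite [2 ^+ m.+2]exprS exprMn => /ltW; rewrite (_ : 2 ^+ 2 = 4 :> R)//; ring.
rewrite lerDr mulr_ge0// sumr_ge0// => j _; apply: kw_kdel_ge0 => //.
by rewrite exprn_ege1// ler1n.
Qed.

End weight_comparison.

Lemma dyadic_range {R : realType} (x : R) : 2 <= x ->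
  exists m : nat, x < 2 ^+ m.+1 /\ m.+1%:R * ln 2 <= 2 * ln x.
Proof.
move=> x2; have x0 : 0 <= x by lra.
have /andP[tx xt] := truncn_itv x0.
have t2 : (2 <= Num.truncn x)%N.
  by rewrite -ltnS -(ltr_nat R); apply: le_lt_trans x2 _.
have t0 : (0 < Num.truncn x)%N by exact: leq_trans t2.
have /= /andP[b1 b2] := trunc_log_bounds (isT : (1 < 2)%N) t0.
set m := trunc_log 2 _ in b1 b2.
exists m; split.
  by apply: lt_le_trans xt _; rewrite -natrX ler_nat.
have m1 : (1 <= m)%N.
  by rewrite -ltnS -(ltn_exp2l _ _ (isT : (1 < 2)%N)); apply: leq_ltn_trans b2.
have l2 : 0 < ln (2 : R) by rewrite ln_gt0// ltr1n.
(* As [x >= 2], the integer part [m] of the binary logarithm is at least 1, so [m + 1 <= 2 m]. *)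
apply: (@le_trans _ _ (2 * (m%:R * ln 2))).
  by rewrite mulrA ler_wpM2r ?(ltW l2)// -natrM ler_nat mul2n -addnn -add1n leq_add2r.
rewrite ler_wpM2l// mulr_natl -lnXn// ler_ln ?posrE ?exprn_gt0//; last by lra.
by apply: le_trans tx; rewrite -natrX ler_nat.
Qed.

Section weighted.
Context {R : realType} (n : nat).
Hypothesis n_ge3 : (3 <= n)%N.
Local Notation tx := (R * 'rV[R]_n)%type.
Local Notation mtx := (measurableTypeR R * 'rV[R]_n)%type.
Local Notation N := (n.+1%:R : R).
Variables (T : R) (D : wave_data n T) (mu : R).
Hypotheses (mu_gt0 : 0 < mu) (mu_lt : mu < 1 / 2).
Local Notation phi := (wphi D).
Local Notation q := (wq D).
Local Notation II := (\int[lebesgue_tx n]_(z in oslab T) (rhs_src D mu z)%:E)%E.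
Local Notation E0 := (wenergy D 0).
Local Notation mO := (@measurable_oslab R n T).

Let G (z : tx) := q z ^+ 2 + phi z ^+ 2 / xsq z.
(** The density [G] regularised with [eps = 1]. Its slab integral is bounded by [energy_hardy_slab],
    and it is comparable with [G] for [r >= 1]. *)
Let h1 (z : tx) := q z ^+ 2 + phi z ^+ 2 / (xsq z + 1).

Let G_ge0 z : 0 <= G z.
Proof. by rewrite addr_ge0 ?sqr_ge0// divr_ge0 ?sqr_ge0 ?xsq_ge0. Qed.

Let h1_ge0 z : 0 <= h1 z.
Proof. by rewrite addr_ge0 ?sqr_ge0// divr_ge0 ?sqr_ge0// addr_ge0 ?xsq_ge0. Qed.

Let ch1 : continuous h1.
Proof.
have c2 := @continuous_wq _ _ _ D; have c5 := wcphi D; have cx := @continuous_xsq R n.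
have cV : continuous (fun z : tx => (xsq z + 1)^-1).
  by apply: continuousV_fun => [z|]; [rewrite lt0r_neq0// ltr_wpDl ?xsq_ge0|cont].
by rewrite /h1; cont.
Qed.

Let Gh1 z : 1 <= xsq z -> G z <= 2 * h1 z.
Proof.
move=> s1; have q2 := sqr_ge0 (q z).
have : phi z ^+ 2 / xsq z <= 2 * (phi z ^+ 2 / (xsq z + 1)).
  rewrite mulrCA ler_wpM2l ?sqr_ge0// ler_pdivlMr ?ltr_wpDl ?xsq_ge0//.
  rewrite mulrC ler_pdivrMr; lra.
by rewrite /G /h1; lra.
Qed.

Let mE (g : tx -> R) : measurable_fun setT (g : mtx -> R) ->
  measurable_fun (oslab T : set mtx) (fun z => (g z)%:E).
Proof. exact: measurable_EFin_oslab. Qed.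

Let mG : measurable_fun setT (G : mtx -> R).
Proof.
have c2 := @continuous_wq _ _ _ D; have c5 := wcphi D.
apply: measurable_funD; first by apply: continuous_measurable_txV; cont.
by apply: measurable_div_xsq; cont.
Qed.

Let bc : 0 <= bulk_const n mu. Proof. exact: bulk_const_ge0. Qed.

(** [40 = 2 * 20]: the 2 compares [G] with [h1], and 20 comes from [energy_hardy_slab], whose factor
    [T] is absorbed by [1 / (1 + T)]. The factor [2 * N ^ 3] is that of [energy_src_int_le]. *)
Definition rest_const : R := 40 * (2 * N ^+ 3).

Lemma rest_const_gt0 : 0 < rest_const.
Proof. by rewrite /rest_const !mulr_gt0// exprn_gt0. Qed.

Let rc : 0 <= rest_const. Proof. exact: ltW rest_const_gt0. Qed.

Let IB : (0 <= II + E0)%E.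
Proof.
apply: adde_ge0; first exact: rhs_src_int_ge0.
by apply: integral_ge0 => x _; rewrite lee_fin sqr_ge0.
Qed.

Let rest : ((2 / (1 + T))%:E * \int[lebesgue_tx n]_(z in oslab T) (h1 z)%:E <=
  rest_const%:E * (II + E0))%E.
Proof.
have T0 := wT D; have T1 : 0 < 1 + T by lra.
have c0 : 0 <= 2 / (1 + T) by rewrite divr_ge0// ltW.
apply: (@le_trans _ _ ((2 / (1 + T))%:E * (T%:E * (20%:E * ((2 * N ^+ 3)%:E * (II + E0)))))%E).
  apply: lee_wpmul2l; first by rewrite lee_fin.
  apply: le_trans (energy_hardy_slab n_ge3 D ltr01) _.
  apply: lee_wpmul2l; first by rewrite lee_fin ltW.
  apply: lee_wpmul2l; first by rewrite lee_fin.
  exact: energy_src_int_le.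
rewrite !muleA -!EFinM; apply: lee_wpmul2r => //; rewrite lee_fin /rest_const.
rewrite ler_wpM2r ?mulr_ge0 ?exprn_ge0//.
rewrite (_ : _ * 20 = 40 * (T / (1 + T))); last by ring.
by rewrite ger_pMr// ler_pdivrMr// mul1r lerDr.
Qed.

(* A weight that is dominated near the axis by bulk weights and beyond
   [r = 1 + T] by [1 / (1 + T)]. *)
Let dominated (c : R) (Ls : seq R) (V : tx -> R) :
  measurable_fun setT (V : mtx -> R) -> (forall z, 0 <= V z) -> 0 <= c ->
  (forall L, L \in Ls -> 1 <= L) ->
  (forall z, V z <= c * \sum_(L <- Ls) kdel L (xsq z) * kw mu L (xsq z) \/
     (1 <= xsq z /\ V z <= (1 + T)^-1)) ->
  (\int[lebesgue_tx n]_(z in oslab T) (V z * G z)%:E <=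
   (c * (size Ls)%:R * bulk_const n mu + rest_const)%:E * (II + E0))%E.
Proof.
move=> mV V0 c0 Ls1 VL.
have T0 := wT D; have T1 : 0 < 1 + T by lra.
have i0 : 0 <= 2 / (1 + T) by rewrite divr_ge0// ltW.
have mh := continuous_measurable_txV ch1.
have mb L := @measurable_bulk _ _ _ D mu L.
have S0 z : 0 <= \sum_(L <- Ls) bulk D mu L z.
  by apply: sumr_ge0 => L _; exact: bulk_ge0.
have mS : measurable_fun setT ((fun z => \sum_(L <- Ls) bulk D mu L z) : mtx -> R).
  exact: (measurable_sum Ls (h := fun L z => bulk D mu L z)).
apply: (@le_trans _ _ (\int[lebesgue_tx n]_(z in oslab T)
  ((c * \sum_(L <- Ls) bulk D mu L z)%:E + (2 / (1 + T) * h1 z)%:E))%E).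
  apply: ge0_le_integral.
  - exact: mO.
  - by move=> z _; rewrite lee_fin mulr_ge0.
  - apply: mE; apply: measurable_funM => //.
  - apply: emeasurable_funD; apply: mE.
      by apply: measurable_funM => //; exact: measurable_cst.
    by apply: measurable_funM => //; exact: measurable_cst.
  - move=> z _; rewrite -EFinD lee_fin.
    have hz : 0 <= 2 / (1 + T) * h1 z by rewrite mulr_ge0.
    have cz : 0 <= c * \sum_(L <- Ls) bulk D mu L z by rewrite mulr_ge0.
    have [h|[s1 h]] := VL z.
      apply: (@le_trans _ _ (c * \sum_(L <- Ls) bulk D mu L z)); last by rewrite lerDl.
      rewrite /bulk -mulr_suml mulrA; exact: ler_wpM2r.
    apply: (@le_trans _ _ (2 / (1 + T) * h1 z)); last by rewrite lerDr.
    apply: le_trans (ler_pM (V0 z) (G_ge0 z) h (Gh1 s1)) _.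
    by rewrite le_eqVlt; apply/orP; left; apply/eqP; ring.
rewrite ge0_integralD//; last 5 first.
- exact: mO.
- by move=> z _; rewrite lee_fin mulr_ge0.
- by apply: mE; apply: measurable_funM => //; exact: measurable_cst.
- by move=> z _; rewrite lee_fin mulr_ge0.
- by apply: mE; apply: measurable_funM => //; exact: measurable_cst.
have cb : 0 <= c * (size Ls)%:R * bulk_const n mu by rewrite mulr_ge0// mulr_ge0.
rewrite (EFinD (_ * _) rest_const) ge0_muleDl ?lee_fin//; apply: leeD.
  under eq_integral do rewrite EFinM -sumEFin.
  rewrite ge0_integralZl_EFin//; last 3 first.
  - exact: mO.
  - by move=> z _; rewrite sumEFin lee_fin.
  - by under eq_fun do rewrite sumEFin; exact: mE.
  rewrite -mulrA EFinM -muleA; apply: lee_wpmul2l; first by rewrite lee_fin.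
  rewrite ge0_integral_sum//; last 3 first.
  - exact: mO.
  - by move=> L; apply: mE.
  - by move=> L z _; rewrite lee_fin bulk_ge0.
  elim: Ls Ls1 {VL S0 mS cb} => [|L Ls IH] Ls1; first by rewrite big_nil mul0r mul0e.
  have nb : 0 <= (size Ls)%:R * bulk_const n mu by apply: mulr_ge0.
  rewrite big_cons /= -natr1 mulrDl mul1r [(_ + bulk_const n mu)%R]addrC.
  rewrite (EFinD (bulk_const n mu)) ge0_muleDl ?lee_fin//.
  apply: leeD; first by apply: bulk_estimate => //; apply: Ls1; rewrite mem_head.
  by apply: IH => L' hL; apply: Ls1; rewrite inE hL orbT.
under eq_integral do rewrite EFinM.
rewrite ge0_integralZl_EFin//.
- exact: mO.
- by move=> z _; rewrite lee_fin.
- exact: mE.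
Qed.

(** The first two terms belong to a single scale, with the constant 4 of [near_weight]. The quotient
    belongs to at most [2 ln (2 + T) / ln 2] dyadic scales with the constant 10 of [dyadic_weight];
    for the far region it uses [ln (2 + T) >= ln 2]. *)
Definition weighted_const : R := 4 * bulk_const n mu + rest_const +
  (20 * bulk_const n mu + rest_const) / ln 2.

Lemma weighted_estimate :
  (((1 + T) `^ (- (2 * mu)))%:E *
    \int[lebesgue_tx n]_(z in oslab T) (xsq z `^ (- (1 / 2 - mu)) * G z)%:E +
   ((ln (2 + T))^-1)%:E *
    \int[lebesgue_tx n]_(z in oslab T) (kw mu 1 (xsq z) * G z)%:E <=
   weighted_const%:E * (II + E0))%E.
Proof.
have T0 := wT D; have T1 : 0 < 1 + T by lra.
have l2 : 0 < ln (2 : R) by rewrite ln_gt0// ltr1n.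
have mpow := @measurable_xsq_powR R n; have mkw1 := @measurable_kw_xsq R n mu 1.
have p0 : 0 <= (1 + T) `^ (- (2 * mu)) by exact: powR_ge0.
have kw0 s : 0 <= kw mu 1 s by apply: mulr_ge0; exact: powR_ge0.
rewrite /weighted_const (EFinD (_ + _) (_ / _)) ge0_muleDl ?lee_fin; last 2 first.
- by rewrite addr_ge0// mulr_ge0.
- by rewrite divr_ge0 ?(ltW l2)// addr_ge0// mulr_ge0.
apply: leeD.
  rewrite -ge0_integralZl_EFin//; last 3 first.
  - exact: mO.
  - by move=> z _; rewrite lee_fin mulr_ge0// powR_ge0.
  - by apply: mE; apply: measurable_funM.
  under eq_integral do rewrite -EFinM mulrA.
  have := @dominated 4 [:: 1 + T]
    (fun z => (1 + T) `^ (- (2 * mu)) * xsq z `^ (- (1 / 2 - mu))).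
  rewrite /= mulr1; apply => //.
  - by apply: measurable_funM => //; exact: measurable_cst.
  - by move=> z; rewrite mulr_ge0// powR_ge0.
  - by move=> L; rewrite inE => /eqP ->; lra.
  - move=> z; rewrite big_seq1; have [h|h] := leP (xsq z) ((1 + T) ^+ 2).
      by left; apply: near_weight; rewrite ?xsq_ge0//; lra.
    right; split; last by apply: far_weight; rewrite ?(ltW h)//; lra.
    by apply: le_trans (ltW h); rewrite exprn_ege1//; lra.
have [m [m1 m2]] : exists m : nat, 2 + T < 2 ^+ m.+1 /\ m.+1%:R * ln 2 <= 2 * ln (2 + T).
  by apply: dyadic_range; lra.
have lT : 0 < ln (2 + T) by rewrite ln_gt0//; lra.
apply: (@le_trans _ _ (((ln (2 + T))^-1)%:E *
    ((10 * m.+1%:R * bulk_const n mu + rest_const)%:E * (II + E0)))%E).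
  apply: lee_wpmul2l; first by rewrite lee_fin invr_ge0 ltW.
  have := @dominated 10 [seq 2 ^+ j | j : 'I_m.+1] (fun z => kw mu 1 (xsq z)).
  rewrite size_map size_enum_ord; apply => //.
  - by move=> L /mapP[j _ ->]; rewrite exprn_ege1// ler1n.
  - move=> z; rewrite big_map big_enum /=.
    have [h|h] := ltP (xsq z) ((2 ^+ m.+1) ^+ 2).
      by left; apply: dyadic_weight => //; exact: xsq_ge0.
    have Ls : (1 + T) ^+ 2 <= xsq z.
      apply: le_trans h; rewrite ler_sqr ?nnegrE ?exprn_ge0 ?(ltW T1)//.
      by move: m1; lra.
    right; split; last by apply: far_kw; rewrite ?Ls//; lra.
    by apply: le_trans Ls; rewrite exprn_ege1//; lra.
rewrite muleA -EFinM; apply: lee_wpmul2r => //; rewrite lee_fin.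
rewrite mulrC ler_pdivrMr// [leRHS]mulrAC ler_pdivlMr// mulrDl [leRHS]mulrDl; apply: lerD.
  have -> : 10 * m.+1%:R * bulk_const n mu * ln 2 =
    (10 * bulk_const n mu) * (m.+1%:R * ln 2) by ring.
  have -> : 20 * bulk_const n mu * ln (2 + T) =
    (10 * bulk_const n mu) * (2 * ln (2 + T)) by ring.
  by rewrite ler_wpM2l// mulr_ge0.
by rewrite ler_wpM2l// ler_ln ?posrE//; lra.
Qed.

End weighted.

(** * Bump functions and weak derivatives *)

Lemma Lnorm2_sqr {R : realType} d (X : measurableType d)
    (m : {measure set X -> \bar R}) (f : X -> R) :
  ('N[m]_2%:E[EFin \o f] ^+ 2 = \int[m]_x (f x ^+ 2)%:E)%E.
Proof.
have -> : ('N[m]_2%:E[EFin \o f] ^+ 2 = 'N[m]_2%:E[EFin \o f] `^ 2)%E.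
  have := Lnorm_ge0 m 2%:E (EFin \o f).
  case: ('N[m]_2%:E[EFin \o f])%E => [r| |]//= r0.
    by rewrite powR_mulrn// expr2.
  by rewrite mulyy pnatr_eq0.
rewrite poweR_Lnorm//; apply: eq_integral => x _.
have -> : `|(EFin \o f) x|%E = `|f x|%:E by [].
by rewrite poweR_EFin powR_mulrn// real_normK ?num_real.
Qed.

Section smooth_bump.
Context {R : realType}.

(** The function [x ^ (- m) exp (- 1 / x)] extended by 0. The powers are included because
    differentiation leads from [flat m] to [flat m.+1] and [flat m.+2]. *)
Definition flat (m : nat) (x : R) : R := if 0 < x then x^-1 ^+ m * expR (- x^-1) else 0.

(** From [y ^ (m + 1) <= (m + 1)! exp y] at [y = 1 / x]. *)
Lemma flat_bound m x : `|flat m x| <= m.+1`!%:R * `|x|.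
Proof.
rewrite /flat; case: ifPn => [x0|_]; last by rewrite normr0 mulr_ge0.
have y0 : 0 < x^-1 by rewrite invr_gt0.
rewrite gtr0_norm ?mulr_gt0 ?exprn_gt0 ?expR_gt0// gtr0_norm//.
rewrite expRN ler_pdivrMr ?expR_gt0// -mulrA mulrCA.
rewrite -ler_pdivrMl// -exprS -ler_pdivrMl ?ltr0n ?fact_gt0//.
apply: le_trans (expR_ge1Dxn m (ltW y0)).
by rewrite mulrC lerDr.
Qed.

Lemma is_derive_cvg (V : normedModType R) (f : V -> R) (x v : V) (d : R) :
  h^-1 *: (f (h *: v + x) - f x) @[h --> 0^'] --> d -> is_derive x v f d.
Proof. by move=> h; split; [apply/cvg_ex; exists d|exact: cvg_lim]. Qed.

Lemma is_derive_flat m x :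
  is_derive x (1 : R) (flat m) (flat m.+2 x - m%:R * flat m.+1 x).
Proof.
have [x0|x0|->] := ltgtP x 0.
- have -> : flat m.+2 x - m%:R * flat m.+1 x = 0.
    by rewrite /flat ltNge (ltW x0) /= mulr0 subr0.
  apply: (@near_eq_is_derive _ _ _ (cst 0)) => //.
    near=> y; rewrite /flat ifF//; apply/negbTE; rewrite -leNgt ltW//.
    by near: y; exact: lt_nbhsl.
- have D : is_derive x (1 : R) (fun x => x^-1 ^+ m * expR (- x^-1))
    (flat m.+2 x - m%:R * flat m.+1 x).
    have Dv : is_derive x (1 : R) (fun x : R => x^-1) (- x ^- 2 * 1).
      by apply: is_deriveV; rewrite ?gt_eqF//; exact: is_derive_id.
    have DX : is_derive x (1 : R) (fun x : R => x^-1 ^+ m)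
        (m%:R * x^-1 ^+ m.-1 * (- x ^- 2 * 1)).
      have -> : (fun x : R => x^-1 ^+ m) = (fun x : R => x^-1) ^+ m.
        by apply/funext => y; rewrite exprfctE.
      exact: is_deriveX Dv.
    have DE : is_derive x (1 : R) (fun x : R => expR (- x^-1))
        (expR (- x^-1) * - (- x ^- 2 * 1)).
      by apply: is_derive_comp_fun; exact: is_deriveN.
    apply: is_derive_eq (is_deriveM_fun DX DE) _.
    rewrite /flat x0; case: m {DX} => [|m] /=; rewrite ?mul0r ?subr0 ?add0r.
      by rewrite -exprVn; ring.
    by rewrite -exprVn !exprS; ring.
  apply: near_eq_is_derive D.
  near=> y; rewrite /flat ifT//.
  by near: y; exact: lt_nbhsr.
- have -> : flat m.+2 0 - m%:R * flat m.+1 0 = 0.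
    by rewrite /flat ltxx mulr0 subr0.
  apply: is_derive_cvg.
  (* At 0 the difference quotient of [flat m] is exactly [flat m.+1], which tends to 0 by
     [flat_bound]. *)
  have -> : (fun h : R => h^-1 *: (flat m (h *: 1 + 0) - flat m 0)) = flat m.+1.
    apply/funext => h; rewrite /GRing.scale /= mulr1 addr0 /flat ltxx subr0.
    by case: ifPn; rewrite ?mulr0// exprS mulrA.
  pose c : R := m.+2`!%:R.
  have ch : (fun h : R => c * `|h|) @ 0^' --> (0 : R).
    rewrite -[X in _ --> X](mulr0 c); apply: cvgM; first exact: cvg_cst.
    rewrite -[X in _ --> X](@normr0 _ R); apply: cvg_norm.
    exact: cvg_within.
  apply: (squeeze_cvgr _ _ ch); last first.
    by rewrite -[X in _ --> X]oppr0; exact: cvgN ch.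
  by apply: nearW => h; rewrite -ler_norml; exact: flat_bound.
Unshelve. all: by end_near.
Qed.

Lemma flat_ge0 m x : 0 <= flat m x.
Proof.
rewrite /flat; case: ifPn => // x0.
by rewrite mulr_ge0 ?expR_ge0// exprn_ge0// invr_ge0 ltW.
Qed.

Lemma flat_le1 x : flat 0 x <= 1.
Proof.
rewrite /flat; case: ifPn => // x0; rewrite expr0 mul1r -expR0 ler_expR oppr_le0.
by rewrite invr_ge0 ltW.
Qed.

Lemma flat_gt0 m x : flat m x != 0 -> 0 < x.
Proof. by rewrite /flat; case: ifPn; rewrite ?eqxx. Qed.

Lemma cvg_flat c : 0 < c -> flat 0 (k.+1%:R * c) @[k --> \oo] --> (1 : R).
Proof.
move=> c0.
have -> : (fun k => flat 0 (k.+1%:R * c)) = (fun k => expR (- (c^-1 * harmonic k))).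
  apply/funext => k; rewrite /flat mulr_gt0// expr0 mul1r invfM mulrC.
  by rewrite /harmonic.
have -> : (1 : R) = expR (- (c^-1 * 0)) by rewrite mulr0 oppr0 expR0.
have c1 : (fun k => - (c^-1 * harmonic k)) @ \oo --> - (c^-1 * 0).
  by apply: cvgN; apply: cvgM; [exact: cvg_cst|exact: cvg_harmonic].
by apply: (cvg_comp _ _ c1); exact: continuous_expR.
Qed.

(* The algebra generated by constants and rescaled [flat]s is closed under
   derivation, so its elements are smooth. *)
Inductive smooth_alg : (R -> R) -> Prop :=
| smooth_cst c : smooth_alg (fun=> c)
| smooth_flat m a b : smooth_alg (fun x => flat m (a * x + b))
| smooth_add f g : smooth_alg f -> smooth_alg g -> smooth_alg (fun x => f x + g x)
| smooth_mul f g : smooth_alg f -> smooth_alg g -> smooth_alg (fun x => f x * g x).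

Lemma smooth_alg_derive f : smooth_alg f ->
  exists2 f', smooth_alg f' & forall x, is_derive x (1 : R) f (f' x).
Proof.
elim=> {f} [c|m a b|f g _ [f' Sf Df] _ [g' Sg Dg]|f g Sf [f' Sf' Df] Sg [g' Sg' Dg]].
- by exists (fun=> 0); [exact: smooth_cst|move=> x; exact: is_derive_cst].
- exists (fun x => (flat m.+2 (a * x + b) + - m%:R * flat m.+1 (a * x + b)) * a).
    apply: smooth_mul; last exact: smooth_cst.
    apply: smooth_add; first exact: smooth_flat.
    by apply: smooth_mul; [exact: smooth_cst|exact: smooth_flat].
  move=> x; have Da : is_derive x (1 : R) (fun x => a * x + b) (a * 1 + 0).
    apply: is_deriveD_fun; apply: is_deriveMl_fun; exact: is_derive_id.
  apply: is_derive_eq (is_derive_comp_fun (is_derive_flat m _) Da) _.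
  by ring.
- exists (fun x => f' x + g' x); first exact: smooth_add.
  by move=> x; exact: is_deriveD_fun.
- exists (fun x => f' x * g x + f x * g' x).
    by apply: smooth_add; exact: smooth_mul.
  by move=> x; exact: is_deriveM_fun.
Qed.

Lemma smooth_alg_continuous f : smooth_alg f -> continuous f.
Proof.
move=> /smooth_alg_derive[f' _ Df] x; exact: is_derive_continuous (Df x).
Qed.

(** The arguments are written as affine functions of [x] to fall under [smooth_flat]. As [k] grows
    the bumps tend to the indicator of []a, b[] while staying below 1. *)
Definition bump (k : nat) (a b x : R) : R :=
  flat 0 (k.+1%:R * x + - (k.+1%:R * a)) * flat 0 (- k.+1%:R * x + k.+1%:R * b).

Lemma smooth_bump k a b : smooth_alg (bump k a b).
Proof. by apply: smooth_mul; exact: smooth_flat. Qed.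

Let bumpE k a b x : bump k a b x = flat 0 (k.+1%:R * (x - a)) * flat 0 (k.+1%:R * (b - x)).
Proof. by rewrite /bump; congr (flat 0 _ * flat 0 _); ring. Qed.

Lemma bump_ge0 k a b x : 0 <= bump k a b x.
Proof. by rewrite mulr_ge0// flat_ge0. Qed.

Lemma bump_le1 k a b x : bump k a b x <= 1.
Proof. by rewrite mulr_ile1 ?flat_ge0 ?flat_le1. Qed.

Lemma bump_neq0 k a b x : bump k a b x != 0 -> a < x < b.
Proof.
rewrite bumpE mulf_eq0 negb_or => /andP[/flat_gt0 + /flat_gt0].
by rewrite !pmulr_rgt0// !subr_gt0 => -> ->.
Qed.

Lemma cvg_bump a b x : bump k a b x @[k --> \oo] --> ((a < x < b)%R%:R : R).
Proof.
have [/andP[ax xb]|xab] := boolP (a < x < b).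
  rewrite -[X in _ --> X]mulr1; under eq_fun do rewrite bumpE.
  by apply: cvgM; apply: cvg_flat; rewrite subr_gt0.
have -> : (fun k => bump k a b x) = (fun=> 0).
  apply/funext => k; apply/eqP; apply: contraNT xab; exact: bump_neq0.
exact: cvg_cst.
Qed.

End smooth_bump.

Section test_functions.
Context {R : realType} (n : nat).
Local Notation rV := 'rV[R]_n.

Definition tensor (g : 'I_n -> R -> R) (x : rV) : R := \prod_i g i (x 0 i).

Lemma continuous_tensor (g : 'I_n -> R -> R) : (forall i, continuous (g i)) ->
  continuous (tensor g).
Proof.
move=> cg; rewrite /tensor; elim: (index_enum _) => [|i r IH].
  have -> : (fun x : rV => \prod_(i <- [::]) g i (x 0 i)) = cst 1.
    by apply/funext => x; rewrite big_nil.
  exact: cst_continuous.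
have -> : (fun x : rV => \prod_(j <- i :: r) g j (x 0 j)) =
    (fun x : rV => g i (x 0 i) * \prod_(j <- r) g j (x 0 j)).
  by apply/funext => x; rewrite big_cons.
apply: continuousM_fun => // x.
apply: (@continuous_comp _ _ _ (fun x : rV => x 0 i) (g i)).
  exact: coord_continuous.
exact: cg.
Qed.

Lemma is_derive_tensor (g : 'I_n -> R -> R) (a : 'I_n) (g' : R -> R) (x : rV) :
  (forall y, is_derive y (1 : R) (g a) (g' y)) ->
  is_derive x (ebase a) (tensor g) (tensor (fun i => if i == a then g' else g i) x).
Proof.
move=> Dg; pose c := \prod_(i | i != a) g i (x 0 i).
have -> : tensor (fun i => if i == a then g' else g i) x = c * g' (x 0 a).
  rewrite /tensor (bigD1 a)//= eqxx mulrC; congr (_ * _).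
  by apply: eq_bigr => i /negbTE ->.
apply: (is_derive_line (u := fun y : R => c * g a y) (z := x 0 a) (v := 1)).
move=> h; rewrite /tensor (bigD1 a)//= mulrC; congr (_ * _).
  by rewrite !mxE !eqxx.
by apply: eq_bigr => i ia; rewrite !mxE eqxx /= (negbTE ia) mulr0 add0r.
Qed.

(** Differentiation replaces one factor by its derivative, which is again in [smooth_alg]; hence the
    induction over all such tensors at once. *)
Lemma tensor_Ck k (g : 'I_n -> R -> R) : (forall i, smooth_alg (g i)) ->
  Ck (@ebase R n) setT k (tensor g).
Proof.
elim: k g => [|k IH] g Sg; (split; [apply: continuous_subspaceT;
  apply: continuous_tensor => i; exact: smooth_alg_continuous|]) => // a.
have [g' Sg' Dg] := smooth_alg_derive (Sg a).
have D x := is_derive_tensor x Dg.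
split=> [x _|]; first by rewrite derivable_inT; exact: ex_derive.
have -> : derive_in setT (ebase a) (tensor g) =
    tensor (fun i => if i == a then g' else g i).
  by apply/funext => x; rewrite derive_inT; exact: derive_val.
by apply: IH => i; case: ifP.
Qed.

Definition open_box (a b : 'I_n -> R) : set rV := [set x | forall i, a i < x 0 i < b i].

Definition box_bump k (a b : 'I_n -> R) : rV -> R := tensor (fun i => bump k (a i) (b i)).

Lemma box_bump_neq0 k a b x : box_bump k a b x != 0 -> open_box a b x.
Proof. by move=> /prodf_neq0 h i; apply: bump_neq0; exact: h. Qed.

Lemma open_box_sub a b (M : R) : (forall i, - M <= a i) -> (forall i, b i <= M) ->
  open_box a b `<=` box M.
Proof.
move=> Ma bM x /= xab i; have /andP[ax xb] := xab i.
rewrite ler_norml (le_trans (Ma i) (ltW ax)) (le_trans (ltW xb))//.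
Qed.

Lemma box_bump_test k a b : test_function (box_bump k a b).
Proof.
split=> [j|]; first by apply: tensor_Ck => i; exact: smooth_bump.
pose M := \sum_i (`|a i| + `|b i|).
have leM i : `|a i| + `|b i| <= M.
  by rewrite /M (bigD1 i)//= lerDl sumr_ge0// => j _; rewrite addr_ge0.
apply: (@subclosed_compact _ _ (box M)); [exact: closed_closure|exact: compact_box|].
have cM : closed (box M : set rV).
  apply: compact_closed; [exact: norm_hausdorff|exact: compact_box].
rewrite closureE => x; apply; split => // y /= /box_bump_neq0.
apply: open_box_sub => i; have := leM i; have := normr_ge0 (a i);
  have := normr_ge0 (b i); have := ler_norm (b i); have := ler_norm (- a i);
  rewrite normrN; lra.
Qed.

Lemma box_bump_bound k a b x : `|box_bump k a b x| <= 1.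
Proof.
apply: (big_ind (fun y : R => `|y| <= 1)); first by rewrite normr1.
  by move=> u v u1 v1; rewrite normrM mulr_ile1.
by move=> i _; rewrite ger0_norm ?bump_ge0// bump_le1.
Qed.

Lemma cvg_box_bump a b x :
  box_bump k a b x @[k --> \oo] --> (\1_(open_box a b) x : R).
Proof.
have -> : \1_(open_box a b) x = \prod_i ((a i < x 0 i < b i)%R%:R : R).
  rewrite indicE; have [xab|xab] := boolP (x \in open_box a b).
    by rewrite big1// => i _; move: xab; rewrite inE => ->.
  have /existsNP[i /negP ni] : ~ open_box a b x by rewrite -notin_setE.
  by rewrite (bigD1 i)//= (negbTE ni) mul0r.
rewrite /box_bump /tensor; elim: (index_enum _) => [|i r IH].
  under eq_fun do rewrite big_nil; rewrite big_nil; exact: cvg_cst.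
under eq_fun do rewrite big_cons; rewrite big_cons.
by apply: cvgM => //; exact: cvg_bump.
Qed.

End test_functions.

(** * The fundamental lemma of the calculus of variations *)

Section density.
Context {R : realType} (n : nat).
Local Notation rV := 'rV[R]_n.
Local Notation leb := (lebesgue_rV n).

Definition orthant (a : 'I_n -> R) : set rV := [set x | forall i, a i < x 0 i].

Lemma measurable_orthant a : measurable (orthant a).
Proof.
have -> : orthant a = [set x | forall i, `]a i, +oo[%classic (x 0 i)].
  by apply/seteqP; split => x /= xa i; have := xa i; rewrite /= in_itv /= andbT.
by apply: (measurable_rect (A := fun i => `]a i, +oo[%classic)) => i; exact: measurable_itv.
Qed.

Lemma measurable_open_box a b : measurable (open_box a b : set rV).
Proof.
have -> : (open_box a b : set rV) = [set x | forall i, `]a i, b i[%classic (x 0 i)].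
  by apply/seteqP; split => x /= xa i; have := xa i; rewrite /= in_itv.
by apply: (measurable_rect (A := fun i => `]a i, b i[%classic)) => i; exact: measurable_itv.
Qed.

Definition orthants : set (set rV) := range orthant.

Lemma setI_closed_orthants : setI_closed orthants.
Proof.
move=> _ _ [a _ <-] [b _ <-]; exists (fun i => Num.max (a i) (b i)) => //.
apply/seteqP; split => x /=.
  by move=> h; split => i; have := h i; rewrite gt_max => /andP[].
by move=> [ha hb] i; rewrite gt_max ha hb.
Qed.

Lemma orthants_generate : @measurable _ rV = <<s orthants >>.
Proof.
apply/seteqP; split; last first.
  apply: smallest_sub; first exact: sigma_algebra_measurable.
  by move=> _ [a _ <-]; exact: measurable_orthant.
pose X : measurableType _ := g_sigma_algebraType orthants.
have mid : measurable_fun setT ((fun x : rV => x) : X -> rV).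
  apply/measurable_fun_rVP => i.
  apply: (measurability _ (RGenOInfty.measurableE R)).
  move=> _ [_ [c ->] <-].
  (* A half-space is the increasing union of orthants whose other bounds tend to minus infinity. *)
  rewrite [X in measurable X](_ : _ =
      \bigcup_k (orthant (fun j => if j == i then c else - k%:R) : set X)); last first.
    apply/seteqP; split => [x [_]|x [k _] /= /(_ i)]; last first.
      by rewrite eqxx in_itv /= andbT.
    rewrite /= in_itv /= andbT => cx.
    exists (Num.truncn (\sum_j `|x 0 j|)).+1 => // j /=; case: eqP => [->//|_].
    rewrite ltrNl; apply: le_lt_trans (ler_norm _) _; rewrite normrN.
    apply: le_lt_trans (truncnS_gt _).
    by rewrite (bigD1 j)//= lerDl sumr_ge0.
  apply: bigcup_measurable => k _; apply: sub_sigma_algebra; by eexists.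
move=> A mA; have := mid measurableT A mA; by rewrite setTI.
Qed.

Variable d : rV -> R.
Hypothesis md : measurable_fun setT d.
Hypothesis id_box : forall M, leb.-integrable (box M) (EFin \o d).
Hypothesis d_test : forall psi : rV -> R, test_function psi ->
  (\int[leb]_x (d x * psi x)%:E = 0)%E.

Let bnd (a b : 'I_n -> R) : R := \sum_i (`|a i| + `|b i|).

Let sub_bnd a b : open_box a b `<=` box (bnd a b).
Proof.
have leM i : `|a i| + `|b i| <= bnd a b.
  by rewrite /bnd (bigD1 i)//= lerDl sumr_ge0// => j _; rewrite addr_ge0.
apply: open_box_sub => i; have := leM i; have := normr_ge0 (a i);
  have := normr_ge0 (b i); have := ler_norm (b i); have := ler_norm (- a i);
  rewrite normrN; lra.
Qed.

Let id_open a b : leb.-integrable (open_box a b) (EFin \o d).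
Proof.
apply: (integrableS _ _ _ (id_box (bnd a b))) => //.
  exact: measurable_box.
exact: measurable_open_box.
Qed.

(** Dominated convergence along the bumps, with [|d|] on a bounded box as majorant. *)
Let d_open_box a b : (\int[leb]_(x in open_box a b) (d x)%:E = 0)%E.
Proof.
pose f_ k x := (d x * box_bump k a b x)%:E.
pose f x := (d x * \1_(open_box a b) x)%:E.
pose g := (fun x => `|d x|%:E) \_ (box (bnd a b)).
have mb := @measurable_box R n (bnd a b).
have [] := @dominated_convergence _ _ _ leb setT measurableT f_ f g.
- move=> k; apply/measurable_EFinP; apply: measurable_funM => //.
  by apply: continuous_measurable_rV; apply: continuous_tensor => i;
    exact: smooth_alg_continuous (smooth_bump _ _ _).
- apply/measurable_EFinP; apply: measurable_funM => //.
  by apply: measurable_indic; exact: measurable_open_box.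
- apply: aeW => x _; apply: cvg_EFin; first exact: nearW.
  by apply: cvgM; [exact: cvg_cst|exact: cvg_box_bump].
- rewrite -integrable_mkcond//; have := integrable_abse (id_box (bnd a b)).
  by apply: eq_integrable.
- apply: aeW => x k _; rewrite /f_ /g patchE; case: ifPn => xM.
    by rewrite /= lee_fin normrM ler_piMr// box_bump_bound.
  have -> : box_bump k a b x = 0.
    apply/eqP; apply: contraNT xM => /box_bump_neq0 h.
    by rewrite inE; exact: sub_bnd.
  by rewrite mulr0 /= normr0.
move=> _ _; rewrite (_ : [sequence _]_n = fun=> 0%E); last first.
  by apply/funext => k /=; apply: d_test; exact: box_bump_test.
move/(cvg_lim (@ereal_hausdorff _)); rewrite lim_cst//= => E0.
rewrite integral_mkcond [RHS]E0; apply: eq_integral => x _.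
rewrite /f patchE indicE; case: ifPn => _; by rewrite ?mulr1 ?mulr0.
Qed.

(** Dynkin's lemma passes from orthants to measurable sets. The intersection with a bounded cube
    keeps [d] integrable and turns orthants into open boxes. *)
Let d_open (M : R) (A : set rV) : measurable A ->
  (\int[leb]_(x in A `&` open_box (fun=> (- M)%R) (fun=> M)) (d x)%:E = 0)%E.
Proof.
set O := open_box _ _ => mA.
have mO : measurable O by exact: measurable_open_box.
have iO : leb.-integrable O (EFin \o d) by exact: id_open.
have O0 : (\int[leb]_(x in O) (d x)%:E = 0)%E by exact: d_open_box.
have iS B : measurable B -> leb.-integrable (B `&` O) (EFin \o d).
  move=> mB; apply: (integrableS _ _ _ iO) => //; exact: measurableI.
move: (mA); rewrite orthants_generate => sA.
pose P (B : set rV) : Prop := (\int[leb]_(x in B `&` O) (d x)%:E = 0)%E.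
apply: (@dynkin_induction _ _ orthants P orthants_generate setI_closed_orthants
  _ _ _ _ _ sA); rewrite /P {P}.
- by rewrite setTI.
- move=> _ [a _ <-].
  have -> : orthant a `&` O = open_box (fun i => Num.max (a i) (- M)) (fun=> M).
    apply/seteqP; split => x /=.
      by move=> [h1 h2] i; rewrite gt_max h1 h2.
    by move=> h; split => i; have := h i; rewrite gt_max -andbA => /and3P[h1 h2 h3]//; apply/andP.
  exact: d_open_box.
- move=> B mB B0; have mBC := measurableC mB.
  have : (\int[leb]_(x in (B `&` O) `|` (~` B `&` O)) (d x)%:E = 0)%E.
    by rewrite -setIUl setUv setTI.
  rewrite integral_setU; last 4 first.
  - exact: measurableI.
  - exact: measurableI.
  - by apply/measurable_EFinP; exact: measurable_funTS.
  - by apply/disj_set2P; rewrite setIACA setICr set0I.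
  by rewrite B0 add0e.
- move=> F mF tF F0; rewrite setI_bigcupl integral_bigcup; last 3 first.
  - exact: trivIset_setIr.
  - by move=> k; exact: measurableI.
  - by rewrite -setI_bigcupl; apply: iS; exact: bigcup_measurable.
  by rewrite eseries0// => k _ _; exact: F0.
Qed.

(** The integrals over all measurable parts of a cube vanish, so [d = 0] almost everywhere in it;
    countably many cubes cover the space. *)
Lemma density_eq0 : {ae leb, forall x, d x = 0}.
Proof.
have H k : {ae leb, forall x, open_box (fun=> - k%:R) (fun=> k%:R) x -> d x = 0}.
  set O := open_box _ _; have mO : measurable O by exact: measurable_open_box.
  have := @integral_ae_eq _ _ _ leb O mO (fun x => 0%E) (EFin \o d) (id_open _ _).
  move=> /(_ (measurable_cst _)) h.
  have : ae_eq leb O (EFin \o d) (fun=> 0%E).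
    apply: h => E EO mE; rewrite integral0.
    by rewrite -(setIidl EO); exact: d_open.
  by apply: filterS => x h' /h' [].
have /ae_foralln := H; apply: filterS => x h.
apply: (h (Num.truncn (\sum_j `|x 0 j|)).+1) => i /=; rewrite -ltr_norml.
by apply: le_lt_trans (truncnS_gt _); rewrite (bigD1 i)//= lerDl sumr_ge0.
Qed.

End density.

Section weak_derivative.
Context {R : realType} (n : nat).
Local Notation rV := 'rV[R]_n.
Local Notation leb := (lebesgue_rV n).
Implicit Types (u w f psi : rV -> R).

Lemma L2_measurable u : L2 u -> measurable_fun setT u.
Proof. by move=> /sub_Lfun_mfun /set_mem. Qed.

Lemma L2_integrable_sqr u : L2 u -> leb.-integrable setT (fun x => (u x ^+ 2)%:E).
Proof. exact: Lfun2_integrable_sqr. Qed.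

Lemma integrable_sqr_bound d (X : measurableType d) (m : {measure set X -> \bar R})
    (D : set X) (v a b : X -> R) : measurable D -> measurable_fun D v ->
  m.-integrable D (EFin \o a) -> m.-integrable D (EFin \o b) ->
  (forall x, D x -> `|v x| <= a x + b x) -> m.-integrable D (EFin \o v).
Proof.
move=> mD mv ia ib vab; apply: (le_integrable mD _ _ (integrableD mD ia ib)).
  exact/measurable_EFinP.
by move=> x Dx /=; rewrite lee_fin (le_trans (vab x Dx))// ler_norm.
Qed.

Lemma L2_integrable_box w (M : R) : L2 w -> leb.-integrable (box M) (EFin \o w).
Proof.
move=> wL; have mb := @measurable_box R n M.
apply: (@integrable_sqr_bound _ _ leb (box M) w (fun x => w x ^+ 2) (cst 1)) => //.
- by apply: measurable_funTS; exact: L2_measurable.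
- by apply: integrableS (L2_integrable_sqr wL).
- by apply: integrable_continuous_box; exact: cst_continuous.
- move=> x _ /=; have := sqr_ge0 (`|w x| - 1).
  rewrite sqrrB real_normK ?num_real// mulr1 expr1n.
  by have := sqr_ge0 (w x); lra.
Qed.

Lemma test_functionP (a : 'I_n) psi : test_function psi ->
  [/\ continuous psi, continuous (fun x => 'D_(ebase a) psi x),
      (forall x, is_derive x (ebase a) psi ('D_(ebase a) psi x)) &
      exists M, forall x, psi x != 0 -> box M x].
Proof.
move=> [/(_ 1%N)[cpsi /(_ a)[dpsi [cdpsi _]]] cK].
have cT (g : rV -> R) : {within setT, continuous g} -> continuous g.
  by move=> h; apply/continuous_subspace_setT.
split.
- exact: cT.
- have -> : (fun x => 'D_(ebase a) psi x) = derive_in setT (ebase a) psi.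
    by apply/funext => x; rewrite derive_inT.
  exact: cT.
- by move=> x; split => //; rewrite -derivable_inT; exact: dpsi.
- have /compact_bounded[N [rN H]] := cK.
  exists (N + 1) => x px i; have xN : `|x| <= N + 1.
    by apply: H; [rewrite ltrDl|exact: subset_closure].
  apply: le_trans xN; rewrite -[leRHS]/(mx_norm x) mx_normrE.
  exact: (le_bigmax _ (fun ij : 'I_1 * 'I_n => `|x ij.1 ij.2|) (0, i)).
Qed.

(** Integration by parts of the compactly supported [u * psi], together with [u = f] almost
    everywhere, shows that [w - du] is orthogonal to every test function [psi]; the fundamental
    lemma concludes. *)
Lemma weak_partial_classical (a : 'I_n) f w u du : L2 f -> L2 w ->
  weak_partial a f w -> continuous u -> continuous du ->
  (forall x, is_derive x (ebase a) u (du x)) -> {ae leb, forall x, u x = f x} ->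
  {ae leb, forall x, w x = du x}.
Proof.
move=> fL wL wp cu cdu Du uf.
have mw := L2_measurable wL; have mdu := continuous_measurable_rV cdu.
suff : {ae leb, forall x, w x - du x = 0}.
  by apply: filterS => x /eqP; rewrite subr_eq0 => /eqP.
apply: density_eq0.
- exact: measurable_funB.
- move=> M; have mb := @measurable_box R n M.
  exact: (integrableB mb (L2_integrable_box M wL) (integrable_continuous_box M cdu)).
move=> psi tpsi.
have [cpsi cdpsi Dpsi [M sM]] := test_functionP a tpsi.
have mpsi := continuous_measurable_rV cpsi; have mdpsi := continuous_measurable_rV cdpsi.
have psi2 : leb.-integrable setT (EFin \o (fun x => psi x ^+ 2)).
  apply: (@integrable_box _ n M); first by cont.
  by move=> x; rewrite expf_eq0 /=; exact: sM.
have iw : leb.-integrable setT (EFin \o (fun x => w x * psi x)).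
  apply: (@integrable_sqr_bound _ _ leb setT _ (fun x => w x ^+ 2) (fun x => psi x ^+ 2)) => //.
  - exact: measurable_funM.
  - exact: L2_integrable_sqr.
  - move=> x _; have := sqr_ge0 (`|w x| - `|psi x|); rewrite sqrrB !real_normK ?num_real//.
    rewrite normrM; have := sqr_ge0 (w x); have := sqr_ge0 (psi x); lra.
have idu : leb.-integrable setT (EFin \o (fun x => du x * psi x)).
  apply: (@integrable_box _ n M); first by cont.
  by move=> x; rewrite mulf_eq0 negb_or => /andP[_]; exact: sM.
have iu : leb.-integrable setT (EFin \o (fun x => u x * 'D_(ebase a) psi x)).
  apply: (@integrable_box _ n M); first by cont.
  by move=> x; rewrite mulf_eq0 negb_or => /andP[_]; exact: derive_box (Dpsi x) sM.
have parts : (\int[leb]_x (du x * psi x + u x * 'D_(ebase a) psi x)%:E = 0)%E.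
  apply: (@integral_partial _ n M a (fun x => u x * psi x)).
  - by cont.
  - by cont.
  - by move=> x; exact: is_deriveM_fun.
  - by move=> x; rewrite mulf_eq0 negb_or => /andP[_]; exact: sM.
have fu : \int[leb]_x (f x * 'D_(ebase a) psi x) = \int[leb]_x (u x * 'D_(ebase a) psi x).
  congr fine; apply: ae_eq_integral => //.
  - by apply/measurable_EFinP; apply: measurable_funM => //; exact: L2_measurable.
  - by apply/measurable_EFinP; apply: measurable_funM => //; exact: continuous_measurable_rV.
  - by apply: filterS uf => x ux _; rewrite ux.
have parts' : \int[leb]_x (du x * psi x) + \int[leb]_x (u x * 'D_(ebase a) psi x) = 0.
  by rewrite -RintegralD// /Rintegral parts.
have E : \int[leb]_x (w x * psi x) = \int[leb]_x (du x * psi x).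
  have := wp psi tpsi; rewrite fu; move: parts'; lra.
have -> : (\int[leb]_x ((w x - du x) * psi x)%:E =
    \int[leb]_x ((w x * psi x)%:E - (du x * psi x)%:E))%E.
  by apply: eq_integral => x _; rewrite -EFinB mulrBl.
rewrite integralB//.
have fw := integrable_fin_num measurableT iw; have fd := integrable_fin_num measurableT idu.
by rewrite -(fineK fw) -(fineK fd) -EFinB; congr EFin; apply/eqP; rewrite subr_eq0; apply/eqP; exact: E.
Qed.

End weak_derivative.

(** * Second derivatives and extension beyond the slab *)

Section schwarz.
Context {R : realType} (V : normedModType R).
Variables (v w z : V) (u uv uw uvw uwv : V -> R) (O : set V).
Hypotheses (Duv : forall y, O y -> is_derive y v u (uv y))
  (Duw : forall y, O y -> is_derive y w u (uw y))
  (Duvw : forall y, O y -> is_derive y w uv (uvw y))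
  (Duwv : forall y, O y -> is_derive y v uw (uwv y)).
Hypotheses (Oz : nbhs z O) (cuvw : {for z, continuous uvw})
  (cuwv : {for z, continuous uwv}).

Let m (a b : R) : V := a *: v + (b *: w + z).

Let near_z (P : set V) : nbhs z P -> exists2 e : R, 0 < e &
  forall a b, `|a| <= e -> `|b| <= e -> P (m a b).
Proof.
move=> Pz; pose M (ab : R * R) : V := ab.1 *: v + (ab.2 *: w + z).
have cM : {for (0 : R, 0 : R), continuous M}.
  apply: continuousD.
    by apply: continuousZr_tmp; exact: cvg_fst.
  apply: continuousD; last exact: cst_continuous.
  by apply: continuousZr_tmp; exact: cvg_snd.
have M0 : M (0, 0) = z by rewrite /M /= !scale0r !add0r.
have /cM : nbhs (M (0, 0)) P by rewrite M0.
move=> /nbhs_ballP[e /= e0 He]; exists (e / 2); first by rewrite divr_gt0.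
move=> a b ae be; apply: (He (a, b)).
by split; rewrite /ball /= sub0r normrN; apply: (le_lt_trans (y := e / 2)) => //;
  rewrite ltr_pdivrMr// ltr_pMr// ltr1n.
Qed.

Let mvt (f f' : R -> R) (h : R) : 0 < h ->
  (forall a, 0 <= a <= h -> is_derive a (1 : R) f (f' a)) ->
  exists2 c, 0 <= c <= h & f h - f 0 = f' c * h.
Proof.
move=> h0 Df.
have D1 x : x \in `]0, h[ -> is_derive x (1 : R) f (f' x).
  by rewrite in_itv /= => /andP[x0 xh]; apply: Df; rewrite !ltW.
have D2 : {within `[0, h], continuous f}.
  apply: derivable_within_continuous => x; rewrite in_itv /= => xh.
  by have := Df x xh => D; exact: ex_derive.
have [c + E] := MVT_segment (ltW h0) D1 D2.
by rewrite in_itv /= => ch; exists c => //; rewrite E subr0.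
Qed.

(** By the mean value theorem, applied twice in either order, the second difference over a small
    square is each mixed derivative at some point of the square, up to the same factor [h ^ 2].
    Continuity at [z] identifies the two. *)
Lemma schwarz : uvw z = uwv z.
Proof.
apply/eqP; rewrite -subr_eq0 -normr_le0; apply/ler_addgt0Pr => e e0; rewrite add0r.
have e2 : 0 < e / 2 by rewrite divr_gt0.
have /cvgrPdist_lt/(_ _ e2) C1 := cuvw; have /cvgrPdist_lt/(_ _ e2) C2 := cuwv.
have [h h0 Hh] := near_z (filterI Oz (filterI C1 C2)).
have ab_h a : 0 <= a <= h -> `|a| <= h by case/andP => a0 ah; rewrite ger0_norm.
have HO a b : 0 <= a <= h -> 0 <= b <= h -> O (m a b).
  by move=> /ab_h ah /ab_h bh; have [] := Hh a b ah bh.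
have hh : 0 <= h <= h by rewrite lexx ltW.
have h00 : 0 <= (0 : R) <= h by rewrite lexx ltW.
have lv (f fv : V -> R) a b : is_derive (m a b) v f (fv (m a b)) ->
    is_derive a (1 : R) (fun a => f (m a b)) (fv (m a b)).
  by apply: is_derive_line => t; rewrite /m scalerDl addrA /GRing.scale /= mulr1.
have lw (f fw : V -> R) a b : is_derive (m a b) w f (fw (m a b)) ->
    is_derive b (1 : R) (fun b => f (m a b)) (fw (m a b)).
  apply: is_derive_line => t; congr f.
  by rewrite /m scalerDl addrCA [in RHS]/GRing.scale /= mulr1 !addrA.
pose del := u (m h h) - u (m h 0) - (u (m 0 h) - u (m 0 0)).
have [a1 [b1 [a1h b1h E1]]] : exists a b, [/\ 0 <= a <= h, 0 <= b <= h &
    del = uvw (m a b) * h * h].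
  have [a ah Ea] := @mvt (fun a => u (m a h) - u (m a 0))
    (fun a => uv (m a h) - uv (m a 0)) h h0
    (fun a ah => is_deriveB_fun (lv _ _ _ _ (Duv (HO _ _ ah hh))) (lv _ _ _ _ (Duv (HO _ _ ah h00)))).
  have [b bh Eb] := @mvt (fun b => uv (m a b)) (fun b => uvw (m a b)) h h0
    (fun b bh => lw _ _ _ _ (Duvw (HO _ _ ah bh))).
  by exists a, b; split => //; rewrite -Eb -Ea.
have [a2 [b2 [a2h b2h E2]]] : exists a b, [/\ 0 <= a <= h, 0 <= b <= h &
    del = uwv (m a b) * h * h].
  have [b bh Eb] := @mvt (fun b => u (m h b) - u (m 0 b))
    (fun b => uw (m h b) - uw (m 0 b)) h h0
    (fun b bh => is_deriveB_fun (lw _ _ _ _ (Duw (HO _ _ hh bh))) (lw _ _ _ _ (Duw (HO _ _ h00 bh)))).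
  have [a ah Ea] := @mvt (fun a => uw (m a b)) (fun a => uwv (m a b)) h h0
    (fun a ah => lv _ _ _ _ (Duwv (HO _ _ ah bh))).
  by exists a, b; split => //; rewrite -Ea -Eb /del; ring.
have E : uvw (m a1 b1) = uwv (m a2 b2).
  have hn : h != 0 by rewrite gt_eqF.
  by apply: (mulIf hn); apply: (mulIf hn); rewrite -E1 -E2.
have [_ [K1 _]] := Hh _ _ (ab_h _ a1h) (ab_h _ b1h).
have [_ [_ K2]] := Hh _ _ (ab_h _ a2h) (ab_h _ b2h).
rewrite (_ : uvw z - uwv z = (uvw z - uvw (m a1 b1)) - (uwv z - uwv (m a2 b2))); last first.
  by rewrite E; ring.
apply: le_trans (ler_normB _ _) _; rewrite [e]splitr.
by apply: lerD; exact: ltW.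
Qed.

End schwarz.

Section within_directions.
Context {R : realType} {V : normedModType R}.

Lemma within_eq (F : set_system R) (A : set R) : Filter F -> F A -> within A F = F.
Proof.
move=> FF FA; apply/funext => P; apply/propext; split.
  by move=> h; apply: filterS2 FA h => x Ax; exact.
by apply: filterS => x Px _.
Qed.

(** If small increments stay in [D], the derivative within [D] is the ordinary one. This covers all
    directions in the open slab and the space directions on its faces. *)
Lemma is_derive_in (D : set V) (u : V -> R) (z v : V) :
  (\forall h \near (0 : R)^', D (h *: v + z)) -> derivable_in D u z v ->
  is_derive z v u (derive_in D v u z).
Proof.
by move=> nD; rewrite /derivable_in /derive_in within_eq// => du; split.
Qed.

End within_directions.

Section clamp.
Context {R : realType} (n : nat).
Local Notation tx := (R * 'rV[R]_n)%type.
Variable T : R.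
Hypothesis T_gt0 : 0 < T.

(** Composition with this projection extends functions continuous on the slab to all of space-time
    without changing them on the slab. *)
Definition clamp (z : tx) : tx := (Num.min (Num.max z.1 0) T, z.2).

Lemma slab_clamp z : slab T (clamp z).
Proof.
apply/andP; split; rewrite /= ?ge_min ?lexx ?orbT//.
by rewrite le_min le_max lexx orbT ltW.
Qed.

Lemma clamp_id z : slab T z -> clamp z = z.
Proof.
by case: z => t x /andP[/= t0 tT]; rewrite /clamp /= max_l// min_l.
Qed.

Lemma oslab_slab z : oslab T z -> @slab R n T z.
Proof. by case/andP => t0 tT; apply/andP; rewrite !ltW. Qed.

Lemma continuous_clamp : continuous clamp.
Proof.
have cm : continuous (fun t : R => Num.min (Num.max t 0) T).
  move=> t; apply: (@continuous_min _ _ (fun t : R => Num.max t 0) (cst T)).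
    by apply: (@continuous_max _ _ id (cst 0)); [exact: cvg_id|exact: cst_continuous].
  exact: cst_continuous.
move=> z; apply: (@cvg_pair _ _ _ (nbhs z) (nbhs (Num.min (Num.max z.1 0) T)) (nbhs z.2));
  last exact: cvg_snd.
apply: (@continuous_comp _ _ _ fst (fun t : R => Num.min (Num.max t 0) T)).
  exact: cvg_fst.
exact: cm.
Qed.

Lemma continuous_clamp_comp (u : tx -> R) : {within slab T, continuous u} ->
  continuous (u \o clamp).
Proof.
move=> /subspace_continuousP cu z U /= Uz.
have := cu _ (slab_clamp z) U Uz; rewrite /within /= => h.
have {}h : nbhs z (fun y => slab T (clamp y) -> U (u (clamp y))).
  exact: continuous_clamp h.
change (nbhs z ((u \o clamp) @^-1` U)); apply: filterS h => y /=; apply.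
exact: slab_clamp.
Qed.

Lemma nbhs_oslab z : oslab T z -> nbhs z (@oslab R n T).
Proof.
case: z => t x /andP[/= t0 tT].
exists ([set s | 0 < s < T], setT); last by move=> [s y] [/= h _].
split; last exact: filterT.
have /near_in_itvoo : t \in `]0, T[ by rewrite in_itv /= t0.
by apply: filterS => s; rewrite in_itv.
Qed.

Lemma is_derive_pd (u : tx -> R) al z : oslab T z ->
  derivable_in (slab T) u z (tx_base al) -> is_derive z (tx_base al) u (pd T al u z).
Proof.
move=> zT; apply: is_derive_in.
have cl : {for (0 : R), continuous (fun h : R => h *: tx_base al + z)}.
  apply: continuousD; last exact: cst_continuous.
  by apply: continuousZr_tmp; exact: cvg_id.
have : nbhs (0 *: tx_base al + z) (@oslab R n T).
  by rewrite scale0r add0r; exact: nbhs_oslab.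
move=> /cl nz.
have : \forall h \near (0 : R), slab T (h *: tx_base al + z).
  by apply: (filterS _ (nz : nbhs (0 : R) (fun h => oslab T (h *: tx_base al + z)))) => h;
    exact: oslab_slab.
by move=> h; exact: (cvg_within _ h).
Qed.

Lemma is_derive_clamp (u : tx -> R) al z d : oslab T z ->
  is_derive z (tx_base al) u d -> is_derive z (tx_base al) (u \o clamp) d.
Proof.
move=> zT; apply: near_eq_is_derive.
by near=> y; rewrite /= clamp_id//; apply: oslab_slab; near: y; exact: nbhs_oslab.
Unshelve. all: by end_near.
Qed.

(** A space increment keeps the time fixed, so the faces are included; Hardy's inequality at [t = 0]
    and [t = T] and the identification of the initial gradient rely on this. *)
Lemma is_derive_pd_space (u : tx -> R) a t x : 0 <= t <= T ->
  derivable_in (slab T) u (t, x) (tx_base (lift ord0 a)) ->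
  is_derive (t, x) (tx_base (lift ord0 a)) u (pd T (lift ord0 a) u (t, x)).
Proof.
move=> tT; apply: is_derive_in; near=> h.
by rewrite /slab /= tx_base_lift /= scaler0 add0r.
Unshelve. all: by end_near.
Qed.

Lemma wave_data_of (h : 'I_n.+1 -> 'I_n.+1 -> tx -> R) (phi : tx -> R) :
  (forall al be, Ck (@tx_base R n) (slab T) 1 (h al be)) ->
  (forall z, slab T z -> \sum_al \sum_be `|h al be z| <= 1 / 2) ->
  (forall z al be, slab T z -> h al be z = h be al z) ->
  Ck (@tx_base R n) (slab T) 2 phi ->
  (forall t, 0 <= t <= T -> L2 (fun x => phi (t, x))) ->
  exists D : wave_data n T,
    [/\ wphi D = phi \o clamp, forall al, wp D al = pd T al phi \o clamp,
        forall al be, ws D al be = pd T al (pd T be phi) \o clamp,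
        forall al be, wH D al be = h al be \o clamp &
        forall ga al be, wdH D ga al be = pd T ga (h al be) \o clamp].
Proof.
move=> Ch hhalf hsym [cphi Cphi] L2phi.
have cp be : {within slab T, continuous (pd T be phi)} by have [_ []] := Cphi be.
have dphi be z : slab T z -> derivable_in (slab T) phi z (tx_base be).
  by have [d _] := Cphi be; exact: d.
have dp al be z : slab T z -> derivable_in (slab T) (pd T be phi) z (tx_base al).
  by have [_ [_ /(_ al)[d _]]] := Cphi be; exact: d.
have cs al be : {within slab T, continuous (pd T al (pd T be phi))}.
  by have [_ [_ /(_ al)[_ []]]] := Cphi be.
have ch al be : {within slab T, continuous (h al be)} by have [] := Ch al be.
have dh ga al be z : slab T z -> derivable_in (slab T) (h al be) z (tx_base ga).
  by have [_ /(_ ga)[d _]] := Ch al be; exact: d.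
have cdh ga al be : {within slab T, continuous (pd T ga (h al be))}.
  by have [_ /(_ ga)[_ []]] := Ch al be.
have Dphi al z (zT : oslab T z) := is_derive_pd zT (dphi al z (oslab_slab zT)).
have Dp al be z (zT : oslab T z) := is_derive_pd zT (dp al be z (oslab_slab zT)).
have Dh ga al be z (zT : oslab T z) := is_derive_pd zT (dh ga al be z (oslab_slab zT)).
have f1 : continuous (phi \o clamp) by exact: continuous_clamp_comp.
have f2 al : continuous (pd T al phi \o clamp) by exact: continuous_clamp_comp.
have f3 al be : continuous (pd T al (pd T be phi) \o clamp).
  exact: continuous_clamp_comp.
have f4 al be : continuous (h al be \o clamp) by exact: continuous_clamp_comp.
have f5 ga al be : continuous (pd T ga (h al be) \o clamp).
  exact: continuous_clamp_comp.
have f6 al z : oslab T z ->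
    is_derive z (tx_base al) (phi \o clamp) ((pd T al phi \o clamp) z).
  move=> zT /=; rewrite clamp_id; last exact: oslab_slab.
  by apply: is_derive_clamp => //; exact: Dphi.
have f7 al be z : oslab T z -> is_derive z (tx_base al) (pd T be phi \o clamp)
    ((pd T al (pd T be phi) \o clamp) z).
  move=> zT /=; rewrite clamp_id; last exact: oslab_slab.
  by apply: is_derive_clamp => //; exact: Dp.
have f8 ga al be z : oslab T z -> is_derive z (tx_base ga) (h al be \o clamp)
    ((pd T ga (h al be) \o clamp) z).
  move=> zT /=; rewrite clamp_id; last exact: oslab_slab.
  by apply: is_derive_clamp => //; exact: Dh.
have f9 a t x : 0 <= t <= T -> is_derive x (ebase a)
    (fun y => (phi \o clamp) (t, y)) ((pd T (lift ord0 a) phi \o clamp) (t, x)).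
  move=> tT /=; rewrite clamp_id//.
  have -> : (fun y => phi (clamp (t, y))) = (fun y => phi (t, y)).
    by apply/funext => y; rewrite clamp_id.
  by apply: is_derive_slice; apply: is_derive_pd_space => //; exact: dphi.
have f10 al be z : (h al be \o clamp) z = (h be al \o clamp) z.
  by apply: hsym; exact: slab_clamp.
(* [Ck] is defined by iterated directional derivatives and does not state the symmetry of the
   Hessian; Schwarz's theorem supplies it in the open slab. *)
have f11 al be z : oslab T z -> (pd T al (pd T be phi) \o clamp) z =
    (pd T be (pd T al phi) \o clamp) z.
  move=> zT; exact: (schwarz (f6 be) (f6 al) (f7 al be) (f7 be al) (nbhs_oslab zT)
    (f3 al be z) (f3 be al z)).
have f12 z : \sum_al \sum_be `|(h al be \o clamp) z| <= 1 / 2.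
  by apply: hhalf; exact: slab_clamp.
have f13 t : 0 <= t <= T ->
    (\int[lebesgue_rV n]_x ((phi \o clamp) (t, x) ^+ 2)%:E < +oo)%E.
  move=> tT; have iphi := L2_integrable_sqr (L2phi t tT).
  under eq_integral do rewrite /= clamp_id//.
  exact: integrable_lty iphi.
by exists (WaveData T_gt0 f1 f2 f3 f4 f5 f6 f7 f8 f9 f10 f11 f12 f13).
Qed.

End clamp.

(** * Explicit weights, initial energy and conclusion *)

Lemma L2norm_tx_sqr {R : realType} n (T : R) (u : R * 'rV[R]_n -> R) :
  (L2norm_tx T u ^+ 2 = \int[lebesgue_tx n]_(z in oslab T) (u z ^+ 2)%:E)%E.
Proof.
rewrite /L2norm_tx Lnorm2_sqr [RHS]integral_mkcond; apply: eq_integral => z _.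
by rewrite !patchE; case: ifPn => // _; rewrite expr0n.
Qed.

Section explicit_weights.
Context {R : realType} (n : nat) (mu : R).
Hypotheses (mu_gt0 : 0 < mu) (mu_lt : mu < 1 / 2).
Local Notation tx := (R * 'rV[R]_n)%type.
Local Notation r z := (xnorm z.2).
Local Notation jr z := (xbracket z.2).

Lemma xnormE (z : tx) : r z = Num.sqrt (xsq z).
Proof. by rewrite xsqE sqrtr_sqr ger0_norm// eucl_ge0. Qed.

Lemma xbracketE (z : tx) : jr z = Num.sqrt (1 + xsq z).
Proof. by rewrite /xbracket xsqE. Qed.

Lemma wKE (z : tx) : (r z `^ (1 - 2 * mu) * jr z `^ (2 * mu))^-1 = wK mu z.
Proof.
have s0 := xsq_ge0 z.
rewrite xnormE xbracketE !powR_sqrt ?addr_ge0// /wK /kw !powRN invfM expr1n.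
by congr ((_ `^ _)^-1 * (_ `^ _)^-1); field.
Qed.

Lemma wTHE (z : tx) : (r z `^ (2 - 2 * mu) * jr z `^ (2 * mu))^-1 = wTH mu z.
Proof.
have s0 := xsq_ge0 z.
rewrite /wTH -wKE -invfM mulrAC; congr (_ * _)^-1.
rewrite xnormE !powR_sqrt// -powR12_sqrt// -powRD.
  by congr (_ `^ _); field.
by apply/implyP => /eqP; have := mu_lt; lra.
Qed.

Lemma sqr_weight1 (z : tx) (p : R) :
  (r z `^ (- (1 / 2) + mu) * p) ^+ 2 = xsq z `^ (- (1 / 2 - mu)) * p ^+ 2.
Proof.
rewrite exprMn sqr_powR xnormE powR_sqrt ?xsq_ge0//.
by congr (_ `^ _ * _); field.
Qed.

(** On the axis both sides vanish, a nonzero power of 0 being 0, so the identity holds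
    everywhere. *)
Lemma sqr_weight3 (z : tx) (p : R) :
  (r z `^ (- (3 / 2) + mu) * p) ^+ 2 = xsq z `^ (- (1 / 2 - mu)) * (p ^+ 2 / xsq z).
Proof.
rewrite exprMn sqr_powR xnormE powR_sqrt ?xsq_ge0//.
have -> : 2 * (- (3 / 2) + mu) / 2 = - (1 / 2 - mu) - 1 by field.
rewrite powRD; last by apply/implyP => /eqP; have := mu_lt; lra.
by rewrite powR_inv1 ?xsq_ge0// mulrAC mulrA.
Qed.

Lemma sqr_bracket (z : tx) : (jr z `^ (- mu)) ^+ 2 = (1 + xsq z) `^ (- mu).
Proof.
rewrite sqr_powR xbracketE powR_sqrt ?addr_ge0 ?xsq_ge0//.
by congr (_ `^ _); field.
Qed.

End explicit_weights.

Lemma wFE {R : realType} n (T : R) (D : wave_data n T) z :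
  wF D z = ws D ord0 ord0 z - \sum_(a < n) ws D (lift ord0 a) (lift ord0 a) z +
    \sum_al \sum_be wH D al be z * ws D al be z.
Proof.
have -> : wF D z = \sum_al esgn al * ws D al al z +
    \sum_al \sum_be wH D al be z * ws D al be z.
  rewrite -big_split /=; apply: eq_bigr => al _.
  rewrite (eq_bigr (fun be => (al == be)%:R * esgn al * ws D al be z +
    wH D al be z * ws D al be z)) => [|be _]; last by rewrite /wG /mink mulrDl.
  rewrite big_split /=; congr (_ + _).
  rewrite (bigD1 al)//= eqxx mul1r big1 ?addr0// => be /negbTE.
  by rewrite eq_sym => ->; rewrite !mul0r.
congr (_ + _); rewrite big_ord_recl /esgn eqxx mul1r; congr (_ + _).
by rewrite -sumrN; apply: eq_bigr => a _; rewrite mulN1r.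
Qed.

Lemma initial_energy {R : realType} n (T : R) (f g : 'rV[R]_n -> R)
    (phi : R * 'rV[R]_n -> R) (D : wave_data n T) : 
  (forall x, wphi D (0, x) = phi (0, x)) ->
  (forall al x, wp D al (0, x) = pd T al phi (0, x)) ->
  H1 f -> L2 g ->
  {ae lebesgue_rV n, forall x, phi (0, x) = f x} ->
  {ae lebesgue_rV n, forall x, pd T ord0 phi (0, x) = g x} ->
  (wenergy D 0 = L2norm (wgrad_norm f) ^+ 2 + L2norm g ^+ 2)%E.
Proof.
move=> phiE pE [fL fw] gL phif phig.
have T0 : 0 <= (0 : R) <= T by rewrite lexx ltW// (wT D).
(* [xget] falls back on its default only when no weak derivative in [L2] exists, which [H1 f]
   excludes. *)
have W a : L2 (wpartial a f) /\ weak_partial a f (wpartial a f).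
  rewrite /wpartial; have [w wL ww] := fw a.
  by apply: (@xgetPex _ (cst 0) [set w | L2 w /\ weak_partial a f w]); exists w.
have ap a : {ae lebesgue_rV n, forall x, wpartial a f x = wp D (lift ord0 a) (0, x)}.
  have [wL ww] := W a.
  apply: (weak_partial_classical fL wL ww (u := fun x => wphi D (0, x))).
  - by apply: continuous_slice; exact: wcphi.
  - by apply: continuous_slice; exact: wcp.
  - by move=> x; exact: wDphix.
  - by apply: filterS phif => x; rewrite phiE.
have gm := L2_measurable gL.
have wm a := L2_measurable (W a).1.
rewrite /L2norm !Lnorm2_sqr -ge0_integralD//; last 4 first.
- by move=> x _; rewrite lee_fin sqr_ge0.
- apply/measurable_EFinP.
  have -> : (fun x => wgrad_norm f x ^+ 2) = (fun x => \sum_a wpartial a f x ^+ 2).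
    by apply/funext => x; rewrite eucl_sqr.
  by apply: measurable_sum => a; exact: measurable_funX.
- by move=> x _; rewrite lee_fin sqr_ge0.
- by apply/measurable_EFinP; exact: measurable_funX.
apply: ae_eq_integral => //.
- apply/measurable_EFinP; apply: continuous_measurable_rV.
  have cq := @continuous_wq _ _ _ D.
  by apply: (@continuous_slice _ _ (fun z => wq D z ^+ 2)); cont.
- apply: emeasurable_funD; apply/measurable_EFinP.
    have -> : (fun x => wgrad_norm f x ^+ 2) = (fun x => \sum_a wpartial a f x ^+ 2).
      by apply/funext => x; rewrite eucl_sqr.
    by apply: measurable_sum => a; exact: measurable_funX.
  exact: measurable_funX.
have apA : {ae lebesgue_rV n, forall x, forall a, wpartial a f x = wp D (lift ord0 a) (0, x)}.
  exact: filter_forall.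
apply: filterS2 phig apA => x gx wx _.
rewrite -EFinD wq_sqr eucl_sqr big_ord_recl pE gx addrC; congr (EFin (_ + _)).
by apply: eq_bigr => a _; rewrite wx.
Qed.

Theorem theorem2p1 (R : realType) (n : nat) (mu : R)
    (n_ge3 : (3 <= n)%N) (mu_gt0 : 0 < mu) (mu_lt : mu < 1 / 2) :
  exists2 C1 : R, 0 < C1 &
  forall (T : R) (h : 'I_n.+1 -> 'I_n.+1 -> R * 'rV[R]_n -> R)
    (f g : 'rV[R]_n -> R) (phi F : R * 'rV[R]_n -> R),
  let dphi z := eucl (fun al => pd T al phi z) in
  let phidphi z := eucl (fun al => phi z * pd T al phi z) in
  let normh z := eucl (fun p : 'I_n.+1 * 'I_n.+1 => h p.1 p.2 z) in
  let dh z := eucl (fun p : 'I_n.+1 * 'I_n.+1 * 'I_n.+1 =>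
    pd T p.2 (h p.1.1 p.1.2) z) in
  let r (z : R * 'rV[R]_n) := xnorm z.2 in
  let jr (z : R * 'rV[R]_n) := xbracket z.2 in
  0 < T ->
  (forall al be, Ck (@tx_base R n) (slab T) 1 (h al be)) ->
  (exists M : R, forall al be z, slab T z ->
     `|h al be z| <= M /\ forall ga, `|pd T ga (h al be) z| <= M) ->
  (forall z, slab T z -> \sum_al \sum_be `|h al be z| <= 1 / 2) ->
  (forall z al be, slab T z -> h al be z = h be al z) ->
  H1 f ->
  L2 g ->
  Ck (@tx_base R n) (slab T) 2 phi ->
  (forall z, oslab T z ->
     pd T ord0 (pd T ord0 phi) z
     - \sum_(a < n) pd T (lift ord0 a) (pd T (lift ord0 a) phi) z
     + \sum_al \sum_be h al be z * pd T al (pd T be phi) z = F z) ->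
  {ae lebesgue_rV n, forall x, phi (0, x) = f x} ->
  {ae lebesgue_rV n, forall x, pd T ord0 phi (0, x) = g x} ->
  C0H1 T (fun t x => phi (t, x)) ->
  C1L2 T (fun t x => phi (t, x)) ->
  (lebesgue_tx n).-integrable (oslab T) (fun z =>
    (dphi z * `|F z|
     + `|phi z| * `|F z| / (r z `^ (1 - 2 * mu) * jr z `^ (2 * mu)))%:E) ->
  (((1 + T) `^ (- (2 * mu)))%:E *
     (L2norm_tx T (fun z => (r z `^ (- (3 / 2) + mu) * phi z)%R) ^+ 2 +
      L2norm_tx T (fun z => (r z `^ (- (1 / 2) + mu) * dphi z)%R) ^+ 2) +
   ((ln (2 + T))^-1)%:E *
     (L2norm_tx T
        (fun z => (r z `^ (- (3 / 2) + mu) * jr z `^ (- mu) * phi z)%R) ^+ 2 +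
      L2norm_tx T
        (fun z => (r z `^ (- (1 / 2) + mu) * jr z `^ (- mu) * dphi z)%R) ^+ 2)
   <= C1%:E * (L2norm (wgrad_norm f) ^+ 2 + L2norm g ^+ 2) +
      C1%:E * \int[lebesgue_measure]_(t in `]0%R, T[)
        \int[lebesgue_rV n]_x
          (let z := (t, x) in
           (dphi z * `|F z|
            + `|phi z| * `|F z| / (r z `^ (1 - 2 * mu) * jr z `^ (2 * mu))
            + dh z * dphi z ^+ 2
            + dh z * phidphi z / (r z `^ (1 - 2 * mu) * jr z `^ (2 * mu))
            + normh z * dphi z ^+ 2
                / (r z `^ (1 - 2 * mu) * jr z `^ (2 * mu))
            + normh z * phidphi z
                / (r z `^ (2 - 2 * mu) * jr z `^ (2 * mu)))%R%:E))%E.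
Proof.
have n_gt0 : (0 < n)%N by exact: leq_trans n_ge3.
have C_gt0 : 0 < weighted_const n mu :> R.
  have rc := @rest_const_gt0 R n; have bc := bulk_const_ge0 n mu_gt0 mu_lt.
  have l2 : 0 < ln (2 : R) by rewrite ln_gt0// ltr1n.
  rewrite /weighted_const ltr_pwDl//; first by rewrite ltr_wpDl// mulr_ge0.
  by rewrite divr_ge0 ?(ltW l2)// addr_ge0 ?(ltW rc)// mulr_ge0.
exists (weighted_const n mu) => // T h f g phi F dphi phidphi normh dh r jr T_gt0 Ch _
  hhalf hsym H1f L2g Cphi eqF phi0 dphi0 [H1phi _] _ _.
have L2phi t : 0 <= t <= T -> L2 (fun x => phi (t, x)).
  by move=> tT; have [] := H1phi t; rewrite // in_itv.
have [D [phiE pE sE HE dHE]] := wave_data_of T_gt0 Ch hhalf hsym Cphi L2phi.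
have cl (z : R * 'rV[R]_n) : slab T z -> clamp T z = z by exact: clamp_id.
have phiD z : slab T z -> wphi D z = phi z by move=> zT; rewrite phiE /= cl.
have qD z : slab T z -> wq D z = dphi z.
  by move=> zT; congr Num.sqrt; apply: eq_bigr => al _; rewrite pE /= cl.
have hD z : slab T z -> whh D z = normh z.
  by move=> zT; congr Num.sqrt; apply: eq_bigr => al _; rewrite HE /= cl.
have dhD z : slab T z -> wdh D z = dh z.
  by move=> zT; congr Num.sqrt; apply: eq_bigr => al _; rewrite dHE /= cl.
have FD z : oslab T z -> wF D z = F z.
  move=> zT; have zS := oslab_slab zT; rewrite wFE -eqF//.
  congr (_ - _ + _).
  - by rewrite sE /= cl.
  - by apply: eq_bigr => a _; rewrite sE /= cl.
  - by apply: eq_bigr => al _; apply: eq_bigr => be _; rewrite HE sE /= cl.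
have s0 (x : 'rV[R]_n) : slab T (0 : R, x) by rewrite /slab /= lexx ltW.
have E0 := initial_energy (fun x => phiD _ (s0 x))
  (fun al x => etrans (congr1 (@^~ (0, x)) (pE al)) (congr1 (pd T al phi) (cl _ (s0 x))))
  H1f L2g phi0 dphi0.
set II := (\int[lebesgue_measure]_(t in _) _)%E.
have -> : II = (\int[lebesgue_tx n]_(z in oslab T) (rhs_src D mu z)%:E)%E.
  rewrite /II (ge0_slab_integral (u := fun z => (rhs_src D mu z)%:E)); last 2 first.
  - apply: measurable_funTS; apply/measurable_EFinP; exact: measurable_rhs_src.
  - by move=> z _; rewrite lee_fin; exact: rhs_src_ge0.
  apply: eq_integral => t; rewrite inE /= in_itv /= => tT.
  apply: eq_integral => x _ /=.
  have zT : oslab T (t, x) by [].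
  have zS := oslab_slab zT.
  have pdp : phidphi (t, x) = `|phi (t, x)| * dphi (t, x) by exact: euclZ.
  rewrite pdp wKE wTHE// /rhs_src qD// hD// dhD// phiD// FD//.
rewrite -E0 -ge0_muleDr; last 2 first.
- by apply: integral_ge0 => x _; rewrite lee_fin sqr_ge0.
- by apply: integral_ge0 => z _; rewrite lee_fin; exact: rhs_src_ge0.
rewrite [X in (_ <= _ * X)%E]addeC.
apply: le_trans (weighted_estimate n_ge3 D mu_gt0 mu_lt).
have mtx (u : R * 'rV[R]_n -> R) : continuous u ->
    measurable_fun setT (u : measurableTypeR R * 'rV[R]_n -> R).
  exact: continuous_measurable_txV.
have mq2 : measurable_fun setT
    ((fun z => wq D z ^+ 2) : measurableTypeR R * 'rV[R]_n -> R).
  by apply: mtx; have cq := @continuous_wq _ _ _ D; cont.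
have mp2 : measurable_fun setT
    ((fun z => wphi D z ^+ 2 / xsq z) : measurableTypeR R * 'rV[R]_n -> R).
  by apply: measurable_div_xsq; have cp := wcphi D; cont.
have split_int (k : R * 'rV[R]_n -> R) :
    measurable_fun setT (k : measurableTypeR R * 'rV[R]_n -> R) ->
    (forall z, 0 <= k z) ->
    (\int[lebesgue_tx n]_(z in oslab T) (k z * (wphi D z ^+ 2 / xsq z))%:E +
     \int[lebesgue_tx n]_(z in oslab T) (k z * wq D z ^+ 2)%:E =
     \int[lebesgue_tx n]_(z in oslab T)
        (k z * (wq D z ^+ 2 + wphi D z ^+ 2 / xsq z))%:E)%E.
  move=> mk k0; rewrite -ge0_integralD//.
  - by apply: eq_integral => z _; rewrite -EFinD -mulrDr addrC.
  - exact: measurable_oslab.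
  - by move=> z _; rewrite lee_fin mulr_ge0// divr_ge0 ?sqr_ge0 ?xsq_ge0.
  - by apply: measurable_EFin_oslab; exact: measurable_funM.
  - by move=> z _; rewrite lee_fin mulr_ge0// sqr_ge0.
  - by apply: measurable_EFin_oslab; exact: measurable_funM.
have kE z : kw mu 1 (xsq z) = xsq z `^ (- (1 / 2 - mu)) * (jr z `^ (- mu)) ^+ 2.
  by rewrite /jr sqr_bracket /kw expr1n.
have mpow := @measurable_xsq_powR R n; have mkw1 := @measurable_kw_xsq R n mu 1.
rewrite !L2norm_tx_sqr -!split_int//; last 2 first.
- by move=> z; rewrite mulr_ge0// powR_ge0.
- by move=> z; exact: powR_ge0.
(* What remains is an equality: the four squared norms are the parts with [phi ^ 2 / r ^ 2] and with
   [|d phi| ^ 2] of the two weighted integrals. *)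
rewrite le_eqVlt; apply/orP; left; apply/eqP.
congr (_ * (_ + _) + _ * (_ + _))%E; apply: eq_integral => z; rewrite inE => zT;
  have zS := oslab_slab zT; congr EFin; rewrite -?phiD// -?qD//.
- by rewrite sqr_weight3.
- by rewrite sqr_weight1.
- by rewrite kE mulrAC exprMn sqr_weight3// mulrAC.
- by rewrite kE mulrAC exprMn sqr_weight1// mulrAC.
Qed.
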